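(* Let $0<\alpha<\frac12$ be fixed and let $Z_\alpha$ be the minimum cost of a spanning tree $T$ of the randomly coloured, randomly weighted complete graph $K_n$ subject to $|E_R\cap T|\le \alpha n$ (as defined in the context). Then: (a) If $\frac14<\alpha<\frac12$, then $$\mathbb{E} Z_\alpha\sim \zeta(3)+(1-2\alpha)^2 .$$ (b) More generally, let $$f(x)=\frac1x\sum_{k=1}^\infty \frac{k^{k-2}}{k!}(xe^{-x})^k=\begin{cases}1-\frac x2 & x\le 1,\\[2pt] \frac yx\left(1-\frac y2\right) & x>1,\end{cases}$$ where, for $x>1$, $y<1$ satisfies $ye^{-y}=xe^{-x}$. If $\psi$ is the solution to $f(\psi)=2\alpha$, then for any $0<\alpha<\frac12$, $$\mathbb{E} Z_\alpha\sim \zeta(3)+\int_{0}^{\psi} f(x)\,dx-2\alpha\psi .$$ (c) Furthermore, $Z_\alpha\sim\mathbb{E} Z_\alpha$ w.h.p.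
   Context: Model: in the complete graph $K_n$, each edge $e$ is given an independent cost $X_e$ uniformly distributed on $[0,1]$, and each edge is, independently of everything else, coloured red or blue with probability $1/2$ each. $E_R$ is the set of red edges. The cost of a spanning tree $T$ (identified with its edge set) is $C(T)=\sum_{e\in T}X_e$, and $Z_\alpha=\min\{C(T): T \text{ a spanning tree of } K_n,\ |E_R\cap T|\le\alpha n\}$. It is assumed that $\alpha n$ is an integer. The paper specifies no value for $Z_\alpha$ in the event that no spanning tree satisfies the colour constraint. Notation: $\zeta(3)=\sum_{k\ge1}k^{-3}$. Asymptotics are as $n\to\infty$ with $\alpha$ fixed; $a_n\sim b_n$ means $a_n=(1+o(1))b_n$. Events $\mathcal{E}_n$ occur with high probability (w.h.p.) if $\Pr[\mathcal{E}_n]\to1$; ''$Z\sim b_n$ w.h.p.'' means that for every $\varepsilon>0$, $|Z-b_n|\le\varepsilon b_n$ w.h.p. The domain of $f$ is $x\geq 0$ with $f(0)=1$ by continuity. *)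

(* Defs.v *)
From HB Require Import structures.
From mathcomp Require Import all_boot all_order all_algebra.
From mathcomp Require Import all_classical all_reals all_analysis.
Set Implicit Arguments.
Unset Strict Implicit.
Unset Printing Implicit Defensive.
Import Order.TTheory GRing.Theory Num.Theory.
Import numFieldNormedType.Exports.
Local Open Scope classical_set_scope.
Local Open Scope ring_scope.

(* Edges of K_n, with vertex set 'I_n. *)
Definition edge (n : nat) := {e : {set 'I_n} | #|e| == 2}.

Definition adj n (T : {set edge n}) : rel 'I_n :=
  fun x y => [exists e : edge n, (e \in T) && (val e == [set x; y]%SET)].

Definition connected_graph n (T : {set edge n}) : Prop :=
  forall x y : 'I_n, connect (adj T) x y.

(* Closed walks x - y - x are 2-cycles of the symmetric relation adj T, hence
   the length condition. *)
Definition acyclic_graph n (T : {set edge n}) : Prop :=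
  forall s : seq 'I_n, (2 < size s)%N -> ~ ucycle (adj T) s.

Definition spanning_tree n (T : {set edge n}) : Prop :=
  connected_graph T /\ acyclic_graph T.

Section Optimum.
Context {R : realType} (alpha : R) (n : nat).
Variables (cost : edge n -> R) (red : edge n -> bool).

Definition tree_cost (T : {set edge n}) : R := \sum_(e in T) cost e.

Definition feasible (T : {set edge n}) : Prop :=
  spanning_tree T /\ #|[set e in T | red e]%SET|%:R <= alpha * n%:R.

(* [z0] is the value taken when no spanning tree is feasible. *)
Definition min_tree_cost (z0 : R) : R :=
  if [pick T : {set edge n} | `[< feasible T >]] is Some T0
  then tree_cost [arg min_(T < T0 | `[< feasible T >]) tree_cost T]%O
  else z0.

End Optimum.

Section Model.
Context {R : realType} {n : nat} {d : measure_display}.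
Context {Om : measurableType d} (P : probability Om R).
Variables (X : edge n -> {RV P >-> R}) (red : edge n -> {RV P >-> bool}).

(* As A e and B e may be full, the last clause contains the product rule for
   every subfamily of the X e and red e, i.e., it is mutual independence of the
   whole family. *)
Definition randomly_coloured_costs : Prop :=
  [/\ forall e (A : set R), measurable A ->
        distribution P (X e) A = uniform_prob (@ltr01 R) A,
      forall e, P [set w | red e w] = (2^-1)%:E &
      forall (A : edge n -> set R) (B : edge n -> set bool),
        (forall e, measurable (A e)) -> (forall e, measurable (B e)) ->
        P (\bigcap_(e in setT) (X e @^-1` A e `&` red e @^-1` B e)) =
        (\prod_(e : edge n) (P (X e @^-1` A e) * P (red e @^-1` B e)))%E].

Definition Zalpha (alpha z0 : R) : Om -> R :=
  fun w => min_tree_cost alpha (fun e => X e w) (fun e => red e w) z0.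

Definition EZalpha (alpha z0 : R) : R := fine 'E_P[Zalpha alpha z0].

End Model.

(* n tends to infinity along the n for which alpha n is an integer. *)
Definition integral_oo {R : realType} (alpha : R) : set_system nat :=
  within [set n : nat | alpha * n%:R \is a Num.int] \oo.

#[global] Instance integral_oo_filter {R : realType} (alpha : R) :
  Filter (integral_oo alpha).
Proof. exact: within_filter. Qed.

Canonical integral_oo_filter_on {R : realType} (alpha : R) :=
  FilterType (integral_oo alpha) (integral_oo_filter alpha).

Definition zeta3 (R : realType) : R :=
  limn (fun N => \sum_(1 <= k < N) k%:R ^- 3 : R).

(* f (0) = 1 by continuity; only x >= 0 is relevant. *)
Definition f {R : realType} (x : R) : R :=
  if x == 0 then 1 else
  x^-1 * limn (fun N => \sum_(1 <= k < N)
           (k%:R ^ (k%:Z - 2) / k`!%:R * (x * expR (- x)) ^+ k) : R).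

Definition limit_cost {R : realType} (alpha psi : R) : R :=
  zeta3 R + \int[lebesgue_measure]_(x in `[0, psi]) f x - 2 * alpha * psi.

(* Main.v *)
Require Import Defs.
From HB Require Import structures.
From mathcomp Require Import all_boot all_order all_algebra.
From mathcomp Require Import all_classical all_reals all_analysis measurable_realfun.
From mathcomp Require Import ring lra zify.
Import Order.TTheory GRing.Theory Num.Theory.
Import numFieldNormedType.Exports.
Local Open Scope classical_set_scope.
Local Open Scope ring_scope.

Set Implicit Arguments.
Unset Strict Implicit.
Unset Printing Implicit Defensive.

(** Give every edge e the penalised weight X_e + (2 psi / n) [e is red]. For each
psi >= 0, a feasible tree costs at least M(psi) - 2 alpha psi, where M(psi) is
the least weight of a spanning tree: this is weak Lagrangian duality
([optimum_ge]). The theorem holds because the duality gap vanishes in the limit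
for the psi with f psi = 2 alpha, at which the limit of the dual bound is
largest.

The minimum M(psi) is computed by counting components. Let G_t be the graph of
the edges of weight at most t, and kappa (G_t) its number of components. A
connected graph has at least kappa (G_t) - 1 edges heavier than t, and the tree
found by the greedy algorithm has exactly that many ([greedy_forest]). Summing
over a mesh of thresholds t with step dl / n evaluates M(psi) up to an error of
dl ([connected_cost_ge], [exists_light_tree]). At t = u / n an edge is present
with probability x / n, where x = max (u / 2, u - psi), independently of the
other edges ([prob_low], [edge_prob_small]), and kappa (G_t) / n tends to f x
([kappa_LLN]). Indeed, kappa is the sum over the vertices of 1 / (size of the
component); the exploration of a component converges to a branching process
with Poisson (x) offspring ([expl_cvg]), and f x is the mean of 1 / (total
progeny) for this process. The concentration of kappa comes from the
Efron-Stein inequality ([Ex_variance]). So M(psi) tends to the integral of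
f (max (u / 2, u - psi)) over u >= 0, which is the integral of f over the
half-line, zeta(3) ([integral_f]), plus its integral over [0, psi]
([riemann_lim]); large thresholds are dealt with by the exponential bound
[kappa_tail]. Call this limit L(psi) ([mst_limit]).

The function L is concave with derivative f, and f is decreasing and has no
jumps. If a tree is nearly optimal for the penalty psi + eta, the bounds below
at the penalties psi and psi + 2 eta squeeze twice its proportion of red edges
between two difference quotients of L ([optimum_le]). For f psi = 2 alpha and
slightly larger penalties, the quotients are smaller than 2 alpha, so the tree
is feasible, and close to 2 alpha, so that it has paid almost 2 alpha psi of
penalty and costs about L(psi) - 2 alpha psi ([perturbation], [mst_event]).

Thus the optimum Z is close to L(psi) - 2 alpha psi outside an event of small probability.
On that event Z is bounded by the cost of an entirely blue tree, found with
penalty 1, whose mesh sum has a small tail in mean ([Zalpha_le_blue],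
[integral_bad]). Hence the mean of |Z - (L(psi) - 2 alpha psi)| tends to 0
([mean_deviation]), and this gives both the expectation and, by Markov's
inequality, the concentration. For alpha > 1 / 4 one has psi = 2 (1 - 2 alpha),
which is less than 1, and f x = 1 - x / 2 on [0, psi]. *)

(** * Total progeny of a Poisson branching process *)

Section Progeny.
Variable R : realType.
Implicit Types (x s : R) (j k K L m M N : nat).

Definition pois x m : R := expR (- x) * (x ^+ m / m`!%:R).

(** The probability that a branching process with Poisson (x) offspring,
started from j individuals, has exactly k individuals in all. One individual is
revealed at a time, so that the recursion is structural in k. *)
Fixpoint progeny x k j {struct k} : R :=
  match k, j with
  | 0%N, 0%N => 1
  | 0%N, _.+1 => 0
  | _.+1, 0%N => 0
  | k'.+1, j'.+1 => \sum_(m < k'.+1) pois x m * progeny x k' (j' + m)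
  end.

Lemma pois_ge0 x m : 0 <= x -> 0 <= pois x m.
Proof.
by move=> x0; rewrite mulr_ge0 ?expR_ge0 // divr_ge0 ?exprn_ge0 ?ler0n.
Qed.

Lemma progeny_ge0 x k j : 0 <= x -> 0 <= progeny x k j.
Proof.
move=> x0; elim: k j => [|k IH] [|j] //=.
by apply: sumr_ge0 => m _; rewrite mulr_ge0 ?pois_ge0.
Qed.

Lemma progeny_small x k j : (k < j)%N -> progeny x k j = 0.
Proof.
elim: k j => [|k IH] [|j] //= kj.
by apply: big1 => m _; rewrite IH ?mulr0 //; lia.
Qed.

Lemma sum_ord_stable (F : nat -> R) M N : (M <= N)%N ->
  (forall m, (M <= m)%N -> F m = 0) -> \sum_(m < N) F m = \sum_(m < M) F m.
Proof.
move=> MN F0; rewrite (big_ord_widen _ F MN) [RHS]big_mkcond /=.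
by apply: eq_bigr => i _; case: ltnP => // /F0.
Qed.

(** The sum may stop at any M beyond k - j, since fewer than j individuals
are impossible; a common bound of summation for several k and j is needed
below. *)
Lemma progenyS x k j M : (k < j + M)%N ->
  progeny x k.+1 j.+1 = \sum_(m < M) pois x m * progeny x k (j + m).
Proof.
move=> kM /=; set F := fun m => pois x m * progeny x k (j + m).
rewrite -(@sum_ord_stable F k.+1 (k.+1 + M)) ?leq_addr //; last first.
  by move=> m km; rewrite /F progeny_small ?mulr0 //; lia.
rewrite -(@sum_ord_stable F M (k.+1 + M)) ?leq_addl // => m Mm.
by rewrite /F progeny_small ?mulr0 //; lia.
Qed.

(** A linear function of m averaged against a binomial expansion, by
absorption: m C(r, m) = r C(r - 1, m - 1). The factor c + 1 on the left avoids the
exponent r - 1. *)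
Lemma sum_bin_linear (c j : R) r :
  (\sum_(m < r.+1) (j + m%:R) * 'C(r, m)%:R * c ^+ (r - m)) * (c + 1) =
  (c + 1) ^+ r * (j * (c + 1) + r%:R).
Proof.
have -> : \sum_(m < r.+1) (j + m%:R) * 'C(r, m)%:R * c ^+ (r - m) =
   j * (c + 1) ^+ r + \sum_(m < r.+1) m%:R * 'C(r, m)%:R * c ^+ (r - m).
  rewrite exprDn mulr_sumr -big_split /=; apply: eq_bigr => m _.
  by rewrite expr1n mulr1 -mulr_natr; ring.
rewrite mulrDl.
have -> : (\sum_(m < r.+1) m%:R * 'C(r, m)%:R * c ^+ (r - m)) * (c + 1) =
   r%:R * (c + 1) ^+ r.
  case: r => [|r]; first by rewrite big_ord1 !mul0r.
  rewrite big_ord_recl /= !mul0r add0r exprSr mulrA; congr (_ * _).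
  rewrite exprDn mulr_sumr; apply: eq_bigr => m _.
  rewrite /bump /= add1n subSS.
  by rewrite -natrM -mul_bin_diag natrM expr1n mulr1 -mulr_natr; ring.
ring.
Qed.

(** The Borel-Tanner distribution. In the induction on k, the offspring m of
the first individual enters linearly, through j + m, against a binomial
expansion. *)
Lemma progenyE x k j : (j <= k.+1)%N ->
  progeny x k.+1 j = j%:R / k.+1%:R * expR (- x * k.+1%:R)
    * ((k.+1%:R * x) ^+ (k.+1 - j) / (k.+1 - j)`!%:R).
Proof.
elim: k j => [|k IH] [|j] // jk; rewrite ?mul0r //.
  have -> : j = 0%N by lia.
  by rewrite /= big_ord1 /pois subnn !expr0 fact0 !invr1 !mulr1 mul1r.
have [r kE] : exists r, k.+1 = (j + r)%N by exists (k.+1 - j)%N; lia.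
rewrite (@progenyS _ _ _ r.+1); last lia.
rewrite -[(k.+2 - _)%N]/(k.+1 - j)%N.
have -> : (k.+1 - j)%N = r by lia.
set c : R := k.+1%:R.
have c0 : c != 0 by rewrite pnatr_eq0.
have c10 : c + 1 != 0 by rewrite /c natr1 pnatr_eq0.
have -> : k.+2%:R = c + 1 :> R by rewrite -natr1.
have r0 : r`!%:R != 0 :> R by rewrite pnatr_eq0 -lt0n fact_gt0.
transitivity (expR (- x * (c + 1)) * x ^+ r / (c * r`!%:R) *
   \sum_(m < r.+1) (j%:R + m%:R) * 'C(r, m)%:R * c ^+ (r - m)).
  rewrite mulr_sumr; apply: eq_bigr => m _.
  have mr : (m <= r)%N by rewrite -ltnS.
  rewrite IH; last lia.
  have -> : (k.+1 - (j + m))%N = (r - m)%N by lia.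
  rewrite /pois mulrDr mulr1 expRD exprMn -/c natrD.
  have -> : x ^+ r = x ^+ m * x ^+ (r - m) by rewrite -exprD subnKC.
  have -> : r`!%:R = 'C(r, m)%:R * (m`!%:R * (r - m)`!%:R) :> R.
    by rewrite -!natrM bin_fact.
  have m0 : m`!%:R != 0 :> R by rewrite pnatr_eq0 -lt0n fact_gt0.
  have rm0 : (r - m)`!%:R != 0 :> R by rewrite pnatr_eq0 -lt0n fact_gt0.
  have b0 : 'C(r, m)%:R != 0 :> R by rewrite pnatr_eq0 -lt0n bin_gt0.
  by field; rewrite m0 rm0 b0 nat1r pnatr_eq0.
apply: (mulIf c10); rewrite -[LHS]mulrA sum_bin_linear [in RHS]exprMn.
have -> : r%:R = c - j%:R :> R by rewrite /c kE natrD; ring.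
rewrite -natr1; by field; rewrite r0 !(nat1r, natr1) !pnatr_eq0.
Qed.

End Progeny.
#[global] Arguments progeny : simpl never.

(** * Extinction *)

Lemma cvg_sumr {R : realType} {T : Type} (F : set_system T) {FF : Filter F}
    (I : Type) (r : seq I) (Q : pred I) (u : I -> T -> R) (l : I -> R) :
  (forall i, Q i -> u i x @[x --> F] --> l i) ->
  \sum_(i <- r | Q i) u i x @[x --> F] --> \sum_(i <- r | Q i) l i.
Proof. by move=> H; apply: cvg_big H; exact: (@add_continuous R^o). Qed.

Lemma cvg_exprn_fun {R : realType} {T : Type} (F : set_system T) {FF : Filter F}
    (u : T -> R) (l : R) m :
  u x @[x --> F] --> l -> u x ^+ m @[x --> F] --> l ^+ m.
Proof. by move=> ul; exact: (@cvg_comp _ _ _ u (fun y => y ^+ m) F (nbhs l) (nbhs (l ^+ m)) ul (@exprn_continuous R m l)). Qed.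

Section Extinction.
Variable R : realType.
Implicit Types (x s : R) (j k K L m M N : nat).

(** The probability that j individuals have at most K individuals in their
total progeny. *)
Definition extinct x K j : R := \sum_(k < K.+1) progeny x k j.

Lemma series_exp_coeff_cvg x : series (exp_coeff x) @ \oo --> expR x.
Proof. exact: is_cvg_series_exp_coeff. Qed.

Lemma sum_exp_coeff_le x M : 0 <= x ->
  \sum_(m < M) x ^+ m / m`!%:R <= expR x.
Proof.
move=> x0; rewrite -(cvg_lim (@Rhausdorff R) (@series_exp_coeff_cvg x)).
have -> : \sum_(m < M) x ^+ m / m`!%:R = series (exp_coeff x) M.
  by rewrite /series /= big_mkord.
apply: nondecreasing_cvgn_le; last exact: is_cvg_series_exp_coeff.
apply/nondecreasing_seqP => n; rewrite /series /= big_nat_recr //= lerDl.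
exact: exp_coeff_ge0.
Qed.

Lemma sum_pois_le1 x M : 0 <= x -> \sum_(m < M) pois x m <= 1.
Proof.
move=> x0; rewrite /pois -mulr_sumr expRN.
by rewrite ler_pdivrMl ?expR_gt0 // mulr1 sum_exp_coeff_le.
Qed.

Lemma extinct0 x K : extinct x K 0 = 1.
Proof.
by rewrite /extinct big_ord_recl big1 ?addr0 // => i _.
Qed.

Lemma extinct0S x j : extinct x 0 j.+1 = 0.
Proof. by rewrite /extinct big_ord1. Qed.

Lemma extinctS x K j :
  extinct x K.+1 j.+1 = \sum_(m < K.+1) pois x m * extinct x K (j + m).
Proof.
rewrite /extinct big_ord_recl add0r.
under eq_bigr => i _ do rewrite -[nat_of_ord (lift _ _)]/(i.+1)
  (@progenyS _ _ _ _ K.+1) ?ltn_addl //.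
by rewrite exchange_big; apply: eq_bigr => m _; rewrite mulr_sumr.
Qed.

Section nonneg.
Variable x : R.
Hypothesis x0 : 0 <= x.

Lemma extinct_ge0 K j : 0 <= extinct x K j.
Proof. by apply: sumr_ge0 => k _; exact: progeny_ge0. Qed.

Lemma extinct_le1 K j : extinct x K j <= 1.
Proof.
elim: K j => [|K IH] [|j]; rewrite ?extinct0 ?extinct0S //.
rewrite extinctS (le_trans _ (sum_pois_le1 K.+1 x0)) //.
by apply: ler_sum => m _; rewrite ler_piMr ?pois_ge0.
Qed.

Lemma extinct_homo j : {homo (fun K => extinct x K j) : K L / (K <= L)%N >-> K <= L}.
Proof.
apply: homo_leq => [//|y z w|K]; first exact: le_trans.
by rewrite [leRHS]/extinct big_ord_recr lerDl; exact: progeny_ge0.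
Qed.

(** Two independent families, one with at most K and the other with at
most L members, have at most K + L members together. *)
Lemma extinct_supermul K L i j :
  extinct x K i * extinct x L j <= extinct x (K + L) (i + j).
Proof.
elim: K i => [|K IH] [|i]; rewrite ?extinct0 ?extinct0S ?mul1r ?mul0r.
- by rewrite !add0n.
- exact: extinct_ge0.
- by rewrite add0n extinct_homo // leq_addl.
rewrite !addSn !extinctS mulr_suml.
apply: (@le_trans _ _ (\sum_(m < K.+1) pois x m * extinct x (K + L) (i + j + m))).
  apply: ler_sum => m _; rewrite -mulrA ler_wpM2l ?pois_ge0 //.
  by rewrite addnAC IH.
rewrite -addSn big_split_ord /= lerDl sumr_ge0 // => m _.
by rewrite mulr_ge0 ?pois_ge0 ?extinct_ge0.
Qed.

Lemma extinct_pow K m : extinct x K 1 ^+ m <= extinct x (K * m) m.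
Proof.
elim: m => [|m IH]; first by rewrite expr0 extinct0.
rewrite exprS mulnS -[m.+1 in leRHS]add1n.
apply: le_trans (extinct_supermul _ _ _ _).
by rewrite ler_wpM2l ?extinct_ge0.
Qed.

Lemma extinct_cvg j : cvgn (fun K => extinct x K j).
Proof.
apply: nondecreasing_is_cvgn; first exact: extinct_homo.
by exists 1 => _ [K _ <-]; exact: extinct_le1.
Qed.

End nonneg.

(** Subcritical and critical processes die out. The extinction probability s
satisfies s >= exp (x (s - 1)): a family dies out if the families of all the
children do, and these are independent. For s < 1 and x <= 1 this contradicts
exp y > 1 + y. *)
Lemma extinct1_cvg1 x : 0 < x <= 1 -> extinct x K 1 @[K --> \oo] --> (1 : R).
Proof.
move=> /andP[x0 x1]; have x0' := ltW x0.
have [s0 sE] : exists s, s = limn (fun K => extinct x K 1) by eexists.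
have cs : extinct x K 1 @[K --> \oo] --> s0.
  by rewrite sE; apply: extinct_cvg.
have s_ge0 : 0 <= s0.
  by rewrite sE; apply: limr_ge; [exact: extinct_cvg|near=> n; exact: extinct_ge0].
have s_le1 : s0 <= 1.
  by rewrite sE; apply: limr_le; [exact: extinct_cvg|near=> n; exact: extinct_le1].
have s_ge K : extinct x K 1 <= s0.
  rewrite sE; apply: (nondecreasing_cvgn_le (u_ := fun K => extinct x K 1)).
  - exact: extinct_homo.
  - exact: extinct_cvg.
have H M : \sum_(m < M) pois x m * s0 ^+ m <= s0.
  have c : \sum_(m < M) pois x m * extinct x K 1 ^+ m @[K --> \oo]
      --> \sum_(m < M) pois x m * s0 ^+ m.
    apply: cvg_sumr => m _; apply: cvgMr; exact: cvg_exprn_fun.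
  rewrite -(cvg_lim (@Rhausdorff R) c); apply: limr_le; first exact: cvgP c.
  near=> K; apply: le_trans (s_ge (M + K * M).+1).
  rewrite extinctS -addnS big_split_ord /= ler_wpDr //.
    by apply: sumr_ge0 => m _; rewrite mulr_ge0 ?pois_ge0 ?extinct_ge0.
  apply: ler_sum => m _; rewrite ler_wpM2l ?pois_ge0 //.
  apply: le_trans (extinct_pow x0' _ _) _.
  by apply: extinct_homo => //; rewrite (leq_trans _ (leq_addl _ _)) // leq_mul2l ltnW ?orbT.
(* The generating function of the Poisson law, one partial sum at a time. *)
have fixp : expR (x * (s0 - 1)) <= s0.
  have c : expR (- x) * series (exp_coeff (x * s0)) M @[M --> \oo]
      --> expR (- x) * expR (x * s0).
    by apply: cvgMr; exact: series_exp_coeff_cvg.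
  have -> : x * (s0 - 1) = - x + x * s0 by ring.
  rewrite expRD -(cvg_lim (@Rhausdorff R) c); apply: limr_le; first exact: cvgP c.
  near=> M; apply: le_trans (H M).
  rewrite /series /= big_mkord mulr_sumr ler_sum // => m _.
  by rewrite /exp_coeff /pois /= exprMn le_eqVlt; apply/orP; left; apply/eqP; ring.
suff <- : s0 = 1 by [].
apply/eqP; rewrite eq_le s_le1 /= leNgt; apply/negP => s1.
have xs : x * (s0 - 1) != 0 by apply: mulf_neq0; [rewrite gt_eqF | rewrite lt_eqF ?subr_lt0].
have := expR_gt1Dx xs; nra.
Unshelve. all: by end_near. Qed.

Lemma extinct2_cvg1 x : 0 < x <= 1 -> extinct x K 2 @[K --> \oo] --> (1 : R).
Proof.
move=> /[dup] x01 /andP[/ltW x0 x1].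
have c := @extinct_cvg x x0 2.
suff <- : limn (fun K => extinct x K 2) = 1 by [].
apply/eqP; rewrite eq_le; apply/andP; split.
  by apply: limr_le => //; near=> n; exact: extinct_le1.
have c2 : extinct x K 1 * extinct x K 1 @[K --> \oo] --> (1 * 1 : R).
  by apply: cvgM; exact: extinct1_cvg1.
rewrite -[leLHS]mulr1 -(cvg_lim (@Rhausdorff R) c2).
apply: limr_le; first exact: cvgP c2.
near=> K; apply: le_trans (extinct_supermul x0 _ _ _ _) _.
apply: (nondecreasing_cvgn_le (u_ := fun K => extinct x K 2)) => //.
exact: extinct_homo.
Unshelve. all: by end_near. Qed.

End Extinction.

(** * The function f as a mean over total progenies *)

Section Limit_function.
Variable R : realType.
Implicit Types (x y : R) (k K N : nat).

(** The mean of 1 / (total progeny), restricted to total progenies less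
than N. *)
Definition fsum x N : R := \sum_(1 <= k < N) progeny x k 1 / k%:R.

Lemma f_term x k : 0 < x -> x^-1 * (k.+1%:R ^ (k.+1%:Z - 2) / k.+1`!%:R
    * (x * expR (- x)) ^+ k.+1) = progeny x k.+1 1 / k.+1%:R.
Proof.
move=> x0; have k0 : k.+1%:R != 0 :> R by rewrite pnatr_eq0.
have -> : k.+1%:Z - 2 = k%:Z - 1 by lia.
rewrite progenyE // subn1 /= expfzDr // exprN1 expRM_natr.
rewrite factS natrM -!exprnP !exprMn [x ^+ k.+1]exprS mul1r.
have f0 : k`!%:R != 0 :> R by rewrite pnatr_eq0 -lt0n fact_gt0.
by field; rewrite f0 nat1r k0 gt_eqF.
Qed.

Lemma fsum_homo x : 0 <= x -> {homo fsum x : M N / (M <= N)%N >-> M <= N}.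
Proof.
move=> x0; apply/nondecreasing_seqP => -[|n]; first by rewrite /fsum !big_geq.
by rewrite /fsum [leRHS]big_nat_recr //= lerDl divr_ge0 ?progeny_ge0.
Qed.

(** The tail is at most 1 / (K + 1) times a probability, so it is small
uniformly in x. *)
Lemma fsum_tail x K N : 0 <= x -> (K < N)%N ->
  fsum x N - fsum x K.+1 <= K.+1%:R^-1.
Proof.
move=> x0 KN; rewrite /fsum (@big_cat_nat _ _ _ K.+1) //=. rewrite lerBlDl lerD2l.
apply: (@le_trans _ _ (K.+1%:R^-1 * extinct x N 1)); last first.
  by rewrite ler_piMr ?extinct_le1.
rewrite /extinct -(big_mkord xpredT (fun k => progeny x k 1)).
rewrite [X in _ * X](@big_cat_nat _ _ _ K.+1) //=; last lia.
rewrite [X in _ + X]big_nat_recr //= mulrDr ler_wpDl //.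
  by rewrite mulr_ge0 // sumr_ge0 // => k _; exact: progeny_ge0.
rewrite mulrDr ler_wpDr ?mulr_ge0 ?progeny_ge0 // mulr_sumr.
rewrite big_nat_cond [leRHS]big_nat_cond; apply: ler_sum => k /andP[/andP[Kk _] _].
rewrite mulrC ler_wpM2r ?progeny_ge0 // lef_pV2 ?posrE ?ltr0n ?ler_nat //; lia.
Qed.

Lemma fsum_le1 x N : 0 <= x -> fsum x N <= 1.
Proof.
move=> x0; case: N => [|N]; first by rewrite /fsum big_geq.
by have := @fsum_tail x 0 N.+1 x0 isT; rewrite [fsum x 1]big_geq // subr0 invr1.
Qed.

Lemma fsum_ge0 x N : 0 <= x -> 0 <= fsum x N.
Proof. by move=> x0; apply: sumr_ge0 => k _; rewrite divr_ge0 ?progeny_ge0. Qed.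

Lemma f_cvg_pos x : 0 < x -> fsum x N @[N --> \oo] --> (f x : R).
Proof.
move=> x0; have cf : cvgn (fsum x).
  apply: nondecreasing_is_cvgn; first exact/fsum_homo/ltW.
  by exists 1 => _ [N _ <-]; exact/fsum_le1/ltW.
suff <- : limn (fsum x) = f x by [].
rewrite /f gt_eqF //.
set l := (X in _ = _ * X); pose u N := (\sum_(1 <= k < N) (k%:R ^ (k%:Z - 2) / k`!%:R * (x * expR (- x)) ^+ k) : R); have {l}-> : l = limn u by [].
have fE : fsum x = (fun N => x^-1 * u N).
  apply/funext => N; rewrite /fsum /u mulr_sumr big_nat_cond [RHS]big_nat_cond.
  by apply: eq_bigr => -[|k] // _; rewrite -f_term.
have uE : u = (fun N => x * fsum x N).
  by apply/funext => N; rewrite fE mulrA divff ?mul1r ?gt_eqF.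
have cu : cvgn u by rewrite uE; exact: is_cvgMr.
rewrite fE; apply/cvg_lim => //; exact: cvgMr.
Qed.

Lemma fsum0 N : fsum 0 N.+2 = 1 :> R.
Proof.
rewrite /fsum big_add1 /= big_mkord big_ord_recl big1 ?addr0 => [|i _].
  by rewrite progenyE // oppr0 mul0r expR0 subnn expr0 fact0 !divr1 !mulr1.
by rewrite progenyE // mulr0 expr0n /= !(mul0r, mulr0).
Qed.

Lemma f_cvg x : 0 <= x -> fsum x N @[N --> \oo] --> (f x : R).
Proof.
rewrite le_eqVlt => /predU1P[<-|]; last exact: f_cvg_pos.
rewrite /f eqxx -cvg_shiftS -cvg_shiftS /=.
by under eq_fun do rewrite fsum0; exact: cvg_cst.
Qed.

Lemma f_ge0 x : 0 <= x -> 0 <= f x.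
Proof.
move=> x0; have c := f_cvg x0; rewrite -(cvg_lim (@Rhausdorff R) c).
apply: limr_ge; first exact: cvgP c.
by near=> n; exact: fsum_ge0.
Unshelve. all: by end_near. Qed.

Lemma f_fsum x K : 0 <= x -> `|f x - fsum x K.+1| <= K.+1%:R^-1.
Proof.
move=> x0; have c := f_cvg x0.
have c1 : fsum x N - fsum x K.+1 @[N --> \oo] --> f x - fsum x K.+1.
  by apply: cvgB => //; exact: cvg_cst.
rewrite ger0_norm; last first.
  rewrite -(cvg_lim (@Rhausdorff R) c1); apply: limr_ge; first exact: cvgP c1.
  near=> N; rewrite subr_ge0; apply: fsum_homo => //.
  by near: N; exact: nbhs_infty_ge.
rewrite -(cvg_lim (@Rhausdorff R) c1); apply: limr_le; first exact: cvgP c1.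
near=> N; apply: fsum_tail => //.
by near: N; exact: nbhs_infty_gt.
Unshelve. all: by end_near. Qed.

(** In a tree with k vertices, 1 / k is 1 minus half of the mean degree. On the
left is the mean of 1 / k on the event that the total progeny is k. On the right,
the mean degree of the root on this event is x times the probability that two
independent trees, the two sides of an edge at the root, have k vertices
together. *)
Lemma progeny12 x k : progeny x k.+1 1 / k.+1%:R =
  progeny x k.+1 1 - x / 2 * progeny x k.+1 2.
Proof.
case: k => [|k]; first by rewrite (@progeny_small _ _ 1 2) // mulr0 subr0 divr1.
rewrite !progenyE // !subSS !subn0.
have f0 : k`!%:R != 0 :> R by rewrite pnatr_eq0 -lt0n fact_gt0.
rewrite factS natrM exprS -[k.+2%:R]natr1.
set c := k.+1%:R; have c0 : c != 0 :> R by rewrite pnatr_eq0.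
have c1 : c + 1 != 0 by rewrite natr1 pnatr_eq0.
by field; rewrite f0 !(nat1r, natr1) !pnatr_eq0.
Qed.

(** Both distributions in [progeny12] have total mass 1, as the process dies
out. *)
Lemma f_small x : 0 <= x <= 1 -> f x = 1 - x / 2.
Proof.
move=> /andP[]; rewrite le_eqVlt => /predU1P[<- _|x0 x1].
  by rewrite /f eqxx mul0r subr0.
have c : extinct x N 1 - x / 2 * extinct x N 2 @[N --> \oo] --> 1 - x / 2 * 1.
  apply: cvgB; first by apply: extinct1_cvg1; rewrite x0.
  by apply: cvgMr; apply: extinct2_cvg1; rewrite x0.
have c' : fsum x N.+1 @[N --> \oo] --> (f x : R).
  by rewrite (cvg_shiftS (fsum x)); apply/f_cvg/ltW.
rewrite mulr1 in c.
rewrite -(cvg_lim (@Rhausdorff R) c) -(cvg_lim (@Rhausdorff R) c').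
congr (limn _); apply/funext => N.
rewrite /fsum /extinct !big_ord_recl /= !add0r big_add1 /= big_mkord mulr_sumr -sumrB.
by apply: eq_bigr => i _; rewrite progeny12.
Qed.

End Limit_function.

(** * Shape of f *)

Section Shape.
Variable R : realType.
Implicit Types (a b x y : R).

Lemma xexpN_inc a b : a < b -> b <= 1 -> a * expR (- a) < b * expR (- b).
Proof.
move=> ab b1; have -> : - b = - a + (a - b) by ring.
rewrite expRD mulrCA [ltRHS]mulrCA [a * _]mulrC -subr_gt0.
rewrite [X in _ < X - _]mulrCA [X in _ < X - _]mulrA -mulrA -mulrBr.
rewrite pmulr_rgt0 ?expR_gt0 // subr_gt0.
have d0 : a - b != 0 by rewrite subr_eq0 lt_eqF.
have [b0|b0] := leP b 0.
  have := expR_lt1 (a - b); rewrite subr_lt0 ab => /idP e1.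
  by have := expR_gt0 (a - b); nra.
by have := expR_gt1Dx d0; nra.
Qed.

Lemma xexpN_dec a b : 1 <= a -> a < b -> b * expR (- b) < a * expR (- a).
Proof.
move=> a1 ab; have -> : - a = - b + (b - a) by ring.
rewrite expRD mulrCA -[ltLHS]mulrC ltr_pM2l ?expR_gt0 //.
have d0 : b - a != 0 by rewrite subr_eq0 gt_eqF.
by have := expR_gt1Dx d0; nra.
Qed.

Lemma conj_exists x : 1 < x ->
  exists2 y : R, 0 < y < 1 & y * expR (- y) = x * expR (- x).
Proof.
move=> x1.
have c : {within `[0, 1], continuous (fun y : R => y * expR (- y))}.
  apply: continuous_subspaceT => y; apply: cvgM; first exact: cvg_id.
  apply: (continuous_comp (f := -%R) (g := @expR R)).
    exact: oppr_continuous.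
  exact: continuous_expR.
have x0 : 0 < x * expR (- x) by rewrite mulr_gt0 ?expR_gt0; lra.
have xe : x * expR (- x) < 1 * expR (- 1) by apply: xexpN_dec.
have [|y] := IVT (ler01 : 0 <= 1 :> R) c (v := x * expR (- x)).
  by rewrite mul0r ge_min (ltW x0) le_max (ltW xe) orbT.
rewrite in_itv /= => /andP[y0 y1] yE; exists y => //; apply/andP; split.
  by rewrite lt_neqAle y0 andbT; apply/eqP => y0'; move: x0; rewrite -yE -y0' mul0r ltxx.
by rewrite lt_neqAle y1 andbT; apply/eqP => y1'; move: xe; rewrite -yE y1' ltxx.
Qed.

Lemma conj_unique x y y' : y < 1 -> y' < 1 ->
  y * expR (- y) = x * expR (- x) -> y' * expR (- y') = x * expR (- x) -> y = y'.
Proof.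
move=> y1 y1' e e'; apply/eqP; rewrite eq_le !leNgt; apply/andP; split;
  apply/negP => /xexpN_inc; rewrite e e' ltxx => /(_ (ltW _)); by [move=> /(_ y1)|move=> /(_ y1')].
Qed.

(** The series depends on x only through x exp (- x), which takes the same value
at the conjugate y < 1. *)
Lemma f_conj x y : 1 < x -> y < 1 -> y * expR (- y) = x * expR (- x) ->
  f x = y / x * (1 - y / 2).
Proof.
move=> x1 y1 yx; have x0 : 0 < x by lra.
have y0 : 0 < y.
  have : 0 < y * expR (- y) by rewrite yx mulr_gt0 ?expR_gt0.
  by rewrite pmulr_lgt0 ?expR_gt0.
rewrite -(@f_small _ y) ?(ltW y0) ?(ltW y1) // /f !gt_eqF // yx.
by rewrite [RHS]mulrA; congr (_ * _); field; rewrite !gt_eqF.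
Qed.

(** On [0, 1] the function is affine. Beyond 1 it is the product of y (1 - y / 2)
and 1 / x, where the conjugate y decreases as x increases. *)
Lemma f_dec a b : 0 <= a -> a < b -> f b < f a.
Proof.
move=> a0 ab; have [b1|b1] := leP b 1.
  by rewrite !f_small; lra.
have [y /andP[y0 y1] yE] := conj_exists b1.
have b0 : 0 < b by lra.
have ib1 : b^-1 < 1 by rewrite invf_lt1.
have ib0 : 0 < b^-1 by rewrite invr_gt0.
rewrite (f_conj b1 y1 yE).
have [a1|a1] := leP a 1.
  rewrite f_small ?a0 // mulrAC.
  have h : y * (1 - y / 2) <= 2^-1 by nra.
  have h0 : 0 < y * (1 - y / 2) by nra.
  have : y * (1 - y / 2) / b < 2^-1 by nra.
  lra.
have [z /andP[z0 z1] zE] := conj_exists a1.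
rewrite (f_conj a1 z1 zE).
have yz : y < z.
  rewrite ltNge; apply/negP; rewrite le_eqVlt => /predU1P[zy|zy].
    by have := xexpN_dec (ltW a1) ab; rewrite -yE -zE zy ltxx.
  have := xexpN_inc zy (ltW y1); rewrite yE zE => h.
  by have := lt_trans h (xexpN_dec (ltW a1) ab); rewrite ltxx.
have iab : b^-1 < a^-1 by rewrite ltf_pV2 ?posrE //; lra.
rewrite mulrAC [ltRHS]mulrAC; apply: ltr_pM => //; try nra; exact: ltW.
Qed.

Lemma f_nonincr a b : 0 <= a -> a <= b -> f b <= f a.
Proof.
by move=> a0; rewrite le_eqVlt => /predU1P[->//|ab]; exact/ltW/f_dec.
Qed.

Lemma f_gt0 a : 0 <= a -> 0 < f a.
Proof.
move=> a0; apply: le_lt_trans (@f_ge0 _ (a + 1) _) _; first lra.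
by apply: f_dec => //; lra.
Qed.

Lemma f_le1 a : 0 <= a -> f a <= 1.
Proof. by move=> /(f_nonincr (lexx 0)); rewrite {2}/f eqxx. Qed.

(** Values below 1 / 2 are taken beyond 1. There s = y / x, with y the conjugate
of x, is a better parameter than x: ln s = y - x = - x (1 - s), so that x, y and
f x = s (1 - s x / 2) are explicit continuous functions of s. *)
Lemma f_surj (v : R) : 0 < v < 1 -> exists2 x, 0 < x & f x = v.
Proof.
move=> /andP[v0 v1]; have [v2|v2] := leP 2^-1 v.
  by exists (2 * (1 - v)); [lra | rewrite f_small; lra].
(* F s is the value of f at x = - ln s / (1 - s). Since -1 < s ln s / (1 - s)
   and ln s / (1 - s) < 0, it lies between s / 2 and s, whence the interval. *)
pose F (s : R) := s + s ^+ 2 / 2 * (ln s / (1 - s)).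
have s1 : v <= (1 + 2 * v) / 2 by lra.
have c : {within `[v, (1 + 2 * v) / 2], continuous F}.
  apply: continuous_in_subspaceT => s; rewrite inE /= in_itv /= => /andP[vs s1'].
  apply: cvgD; first exact: cvg_id.
  apply: cvgM; first by apply: cvgM; [exact: exprn_continuous|exact: cvg_cst].
  apply: cvgM; first by apply: continuous_ln; lra.
  by apply: cvgV; [lra | apply: cvgB; [exact: cvg_cst | exact: cvg_id]].
have key (s : R) : 0 < s < 1 -> [/\ expR (ln s) = s, ln s / (1 - s) < -1,
    - 1 < s * (ln s / (1 - s)) & (ln s / (1 - s)) * (1 - s) = ln s].
  move=> /andP[s0 s1']; have lE : expR (ln s) = s by rewrite lnK ?posrE.
  have l0 : ln s != 0 by rewrite lt_eqF // ln_lt0 // s0.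
  have d0 : 0 < 1 - s by rewrite subr_gt0.
  split => //; last by rewrite divfK ?gt_eqF.
    by rewrite ltr_pdivrMr // mulN1r opprB; have := expR_gt1Dx l0; rewrite lE; lra.
  rewrite mulrA ltr_pdivlMr // mulN1r opprB.
  have : 1 - ln s < s^-1.
    by rewrite -{2}lE -expRN; apply: expR_gt1Dx; rewrite oppr_eq0.
  rewrite -(ltr_pM2l s0) mulfV ?gt_eqF //; lra.
have bnd (s : R) : 0 < s < 1 -> s / 2 <= F s <= s.
  move=> s01; have [_ q1 sq _] := key _ s01; rewrite /F.
  by move: s01 => /andP[s0 s1']; apply/andP; split; nra.
have [|s] := IVT s1 c (v := v).
  have /andP[_ Fv] : v / 2 <= F v <= v by apply: bnd; lra.
  have /andP[Fs _] : (1 + 2 * v) / 2 / 2 <= F ((1 + 2 * v) / 2) <= (1 + 2 * v) / 2.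
    by apply: bnd; lra.
  by rewrite ge_min le_max Fv /=; apply/orP; right; lra.
rewrite in_itv /= => /andP[vs s1'] Fs.
have [|lE q1 sq qE] := key s; first lra.
set q := ln s / (1 - s) in q1 sq qE Fs.
exists (- q); first lra.
rewrite (@f_conj (- q) (- q * s)); first last.
- rewrite -mulrA; congr (_ * _); rewrite -{1}lE -expRD; congr expR.
  by rewrite -qE; ring.
- lra.
- lra.
have q0 : - q != 0 by rewrite gt_eqF //; lra.
rewrite -Fs /F -/q; field.
by move: q0; rewrite oppr_eq0.
Qed.

(** A monotone function that takes all intermediate values has no jump. *)
Lemma f_right_cvg a e : 0 <= a -> 0 < e ->
  exists2 b, a < b & forall x, a <= x <= b -> f a - e <= f x.
Proof.
move=> a0 e0; have fa := f_gt0 a0; have fa1 := f_le1 a0.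
have [|b b0 fb] := @f_surj (Num.max (f a - e) (f a / 2)).
  apply/andP; split; first by rewrite lt_max; apply/orP; right; lra.
  by rewrite gt_max; apply/andP; split; lra.
have fba : f b < f a.
  rewrite fb gt_max; clear -fa e0; move: (f a) fa => v v0.
  by apply/andP; split; lra.
exists b; first by rewrite ltNge; apply/negP => /(f_nonincr (ltW b0)); rewrite leNgt fba.
move=> x /andP[ax xb]; apply: (@le_trans _ _ (f b)); first by rewrite fb le_max lexx.
by apply: f_nonincr => //; exact: le_trans ax.
Qed.

End Shape.

(** * The integral of f over the half-line *)

Section Integral.
Variable R : realType.
Implicit Types (a b x y : R).
Local Notation mu := (@lebesgue_measure R).

Definition primF b : R := \int[mu]_(x in `[0, b]) f x.

(** Composed with x |-> max (x, 0), the function f is monotone on the whole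
line. *)
Lemma measurable_f (D : set R) : measurable D -> D `<=` `[0, +oo[ ->
  measurable_fun D (f : R -> R).
Proof.
move=> mD D0; pose g (x : R) : R := f (Num.max x 0).
apply: (eq_measurable_fun g).
  move=> x; rewrite inE => /D0 /=; rewrite in_itv /= andbT => x0.
  by rewrite /g max_l.
apply: measurable_realfun.nonincreasing_measurable => // x y xy.
apply: f_nonincr; first by rewrite le_max lexx orbT.
by rewrite ge_max !le_max xy lexx orbT.
Qed.

Lemma integrable_f a b : 0 <= a -> mu.-integrable `[a, b] (EFin \o (f : R -> R)).
Proof.
move=> a0; apply: measurable_bounded_integrable => //.
- by rewrite /= lebesgue_measure_itv /= lte_fin; case: ifP => _; rewrite ?ltry.
- apply: measurable_f => // x /=; rewrite !in_itv /= andbT => /andP[+ _].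
  exact: le_trans.
exists 1; split => // M M1 x /=; rewrite in_itv /= => /andP[ax _].
have x0 : 0 <= x by exact: le_trans ax.
by rewrite ger0_norm ?f_ge0 // (le_trans (f_le1 x0)) // ltW.
Qed.

Lemma primF_bounds a b : 0 <= a -> a <= b ->
  f b * (b - a) <= primF b - primF a <= f a * (b - a).
Proof.
move=> a0 ab; have b0 : 0 <= b by exact: le_trans ab.
rewrite /primF Rintegral_itvB ?bnd_simp //; last exact: integrable_f.
have iab : mu.-integrable `]a, b] (EFin \o (f : R -> R)).
  apply: (@integrableS _ _ _ mu `[a, b]) => //; last exact: integrable_f.
  by apply: subset_itv; rewrite bnd_simp.
have mab : mu `]a, b] = (b - a)%:E.
  rewrite /= lebesgue_measure_itv /= lte_fin.
  move: ab; rewrite le_eqVlt => /predU1P[->|->]; last by rewrite -EFinB.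
  by rewrite ltxx subrr.
have icst (r : R) : mu.-integrable `]a, b] (EFin \o (fun=> r)).
  apply: measurable_bounded_integrable => //; first by rewrite [X in (X < _)%E]mab ltry.
  exists `|r|; split => // M M1 x /= _; exact: ltW.
have cst (r : R) : r * (b - a) = \int[mu]_(x in `]a, b]) r.
  by rewrite Rintegral_cst //; rewrite [X in fine X]mab.
rewrite !cst; apply/andP; split.
  apply: (le_Rintegral _ (icst _) iab) => // x; rewrite /= in_itv /= => /andP[ax xb].
  by apply: f_nonincr => //; rewrite (le_trans a0) // ltW.
apply: (le_Rintegral _ iab (icst _)) => // x; rewrite /= in_itv /= => /andP[ax xb].
exact/f_nonincr/ltW.
Qed.

Lemma primF0 : primF 0 = 0.
Proof. by rewrite /primF set_itv1 Rintegral_set1. Qed.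

Lemma primF_homo a b : 0 <= a -> a <= b -> primF a <= primF b.
Proof.
move=> a0 ab; have /andP[+ _] := primF_bounds a0 ab.
have : 0 <= f b * (b - a) by rewrite mulr_ge0 ?subr_ge0 ?f_ge0 //; exact: le_trans ab.
by move=> h /(le_trans h); rewrite subr_ge0.
Qed.

(** The probability that a Poisson (y) variable is at most n. Its derivative is
minus the probability of the value n, and the terms of f are of this form. *)
Definition poisson_cdf n y : R := expR (- y) * \sum_(i < n.+1) y ^+ i / i`!%:R.

Lemma is_derive_poisson_cdf n y :
  is_derive y 1 (poisson_cdf n) (- (expR (- y) * (y ^+ n / n`!%:R))).
Proof.
have dE : is_derive y 1 (fun y : R => expR (- y)) (- expR (- y)).
  by apply: is_derive_eq; rewrite mulrN1.
elim: n => [|n IH].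
  have -> : poisson_cdf 0 = fun y => expR (- y).
    by apply/funext => z; rewrite /poisson_cdf big_ord1 expr0 fact0 divr1 mulr1.
  by rewrite expr0 fact0 divr1 mulr1.
have -> : poisson_cdf n.+1 =
    poisson_cdf n \+ (fun y => expR (- y) * (n.+1`!%:R^-1 * y ^+ n.+1)).
  apply/funext => z; rewrite /poisson_cdf big_ord_recr /= mulrDr; congr (_ + _).
  by rewrite [z ^+ _ / _]mulrC.
have dX : is_derive y 1 (fun y : R => n.+1`!%:R^-1 * y ^+ n.+1)
    (n.+1`!%:R^-1 * (n.+1%:R * y ^+ n)).
  have -> : (fun y : R => n.+1`!%:R^-1 * y ^+ n.+1) =
      n.+1`!%:R^-1 \*: (@idfun R) ^+ n.+1.
    by apply/funext => z; rewrite /= fctE.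
  by apply: is_derive_eq; rewrite /= /GRing.scale /= mulr1.
apply: is_derive_eq; rewrite /GRing.scale /= factS natrM.
have f0 : n`!%:R != 0 :> R by rewrite pnatr_eq0 -lt0n fact_gt0.
by field; rewrite f0 nat1r pnatr_eq0.
Qed.

Lemma poisson_cdf_le n y : 0 < y -> poisson_cdf n y <= n.+1%:R ^+ 2 / y.
Proof.
move=> y0; have -> : n.+1%:R ^+ 2 / y = \sum_(i < n.+1) n.+1%:R / y.
  by rewrite sumr_const card_ord -mulr_natr; ring.
rewrite /poisson_cdf mulr_sumr; apply: ler_sum => i _.
have f0 : 0 < i`!%:R :> R by rewrite ltr0n fact_gt0.
have h : y ^+ i.+1 / i.+1`!%:R <= expR y.
  by apply: le_trans (expR_ge1Dxn i (ltW y0)); rewrite lerDr.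
rewrite factS natrM exprS invfM in h.
rewrite expRN ler_pdivrMl ?expR_gt0 // [leRHS]mulrC.
have i1 : i.+1%:R <= n.+1%:R :> R by rewrite ler_nat.
apply: (@le_trans _ _ (i.+1%:R / y * expR y)); last first.
  by rewrite ler_wpM2r ?expR_ge0 // ler_wpM2r // invr_ge0 ltW.
rewrite -ler_pdivrMl ?divr_gt0 // invf_div.
by apply: le_trans h; rewrite le_eqVlt; apply/orP; left; apply/eqP; ring.
Qed.

Lemma continuous_f_term n : continuous (fun x : R => progeny x n.+1 1 / n.+1%:R).
Proof.
under eq_fun do rewrite progenyE //.
move=> x.
apply: cvgM; last exact: cvg_cst.
apply: cvgM; [apply: cvgM; first exact: cvg_cst|].
  apply: (continuous_comp (f := fun x : R => - x * n.+1%:R) (g := @expR R)).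
    by apply: cvgM; [exact: oppr_continuous|exact: cvg_cst].
  exact: continuous_expR.
apply: cvgM; last exact: cvg_cst.
apply: (continuous_comp (f := fun x : R => n.+1%:R * x)
  (g := fun y : R => y ^+ (n.+1 - 1))); last exact: exprn_continuous.
by apply: cvgM; [exact: cvg_cst|exact: cvg_id].
Qed.

(** After the scaling y = (n + 1) x, the term of index n + 1 is a Poisson
probability up to a power of n + 1, and these integrate to 1 over the
half-line. *)
Lemma integral_f_term n :
  (\int[mu]_(x in `[0%R, +oo[) (progeny x n.+1 1 / n.+1%:R)%:E = (n.+1%:R ^- 3)%:E)%E.
Proof.
set c : R := n.+1%:R.
have c0 : 0 < c by rewrite ltr0n.
pose G x := - (c ^- 3) * poisson_cdf n (c * x).
have dG x : is_derive x 1 G (progeny x n.+1 1 / n.+1%:R).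
  have dc : is_derive x 1 (fun x : R => c * x) c.
    by apply: is_derive_eq; rewrite /GRing.scale /= mulr1.
  have dp := @is_derive_poisson_cdf n (c * x).
  have dcomp := is_derive1_comp dp dc.
  have -> : G = (- c ^- 3) \*: (poisson_cdf n \o (fun x => c * x)) by [].
  apply: is_derive_eq; rewrite /GRing.scale /= progenyE // -/c subn1 /=.
  have -> : - x * c = - (c * x) by ring.
  have f0 : n`!%:R != 0 :> R by rewrite pnatr_eq0 -lt0n fact_gt0.
  by field; rewrite f0 nat1r pnatr_eq0.
have -> : (c ^- 3)%:E = (0%:E - (G 0)%:E)%E.
  rewrite /G mulr0 /poisson_cdf oppr0 expR0 mul1r big_ord_recl big1 ?addr0.
    by rewrite expr0 fact0 divr1 mulr1 -EFinB sub0r opprK.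
  by move=> i _; rewrite expr0n /= mul0r.
apply: ge0_continuous_FTC2y.
- by move=> x x0; rewrite divr_ge0 ?progeny_ge0.
- by apply: continuous_subspaceT; exact: continuous_f_term.
- apply/cvgrPdist_le => e e0; near=> x.
  have x0 : 0 < x by near: x; exact: nbhs_pinfty_gt.
  have cx : 0 < c * x by rewrite mulr_gt0.
  rewrite sub0r normrN /G mulNr normrN normrM.
  have c31 : `|c ^- 3| <= 1.
    by rewrite ger0_norm ?invr_ge0 ?exprn_ge0 ?(ltW c0) // invf_le1 ?exprn_gt0 // exprn_ege1 // ler1n.
  have p0 : 0 <= poisson_cdf n (c * x).
    rewrite mulr_ge0 ?expR_ge0 // sumr_ge0 // => i _.
    by rewrite divr_ge0 // exprn_ge0 // ltW.
  rewrite (ger0_norm p0) (le_trans (ler_piMl p0 c31)) //.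
  apply: (le_trans (poisson_cdf_le n cx)).
  rewrite ler_pdivrMr // expr2 mulrCA ler_wpM2l ?(ltW c0) //.
  rewrite -ler_pdivrMl // mulrC.
- by move=> x _; exact: (@ex_derive _ _ _ _ _ _ _ (dG x)).
- apply: cvg_at_right_filter.
  exact/differentiable_continuous/derivable1_diffP/(@ex_derive _ _ _ _ _ _ _ (dG 0)).
- by move=> x _; rewrite derive1E (@derive_val _ _ _ _ _ _ _ (dG x)).
Unshelve. all: by end_near. Qed.

Lemma f_ereal_series x : 0 <= x ->
  (\big[+%E/0%R]_(0 <= k <oo) (progeny x k.+1 1 / k.+1%:R)%:E = (f x)%:E)%E.
Proof.
move=> x0; have c : fsum x N.+1 @[N --> \oo] --> (f x : R).
  rewrite (cvg_shiftS (fsum x)).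
  exact: f_cvg.
rewrite -(cvg_lim (@Rhausdorff R) c) -EFin_lim; last exact: cvgP c.
congr (limn _); apply/funext => N /=.
by rewrite sumEFin /fsum big_add1.
Qed.

(** Telescoping: 1 / (k + 1) ^ 3 <= 1 / k - 1 / (k + 1). *)
Lemma sum_cube_le N : \sum_(1 <= k < N.+2) k%:R ^- 3 <= 2 - N.+1%:R^-1 :> R.
Proof.
elim: N => [|N IH]; first by rewrite big_nat1 !expr1n; lra.
rewrite big_nat_recr //=; apply: le_trans (lerD IH (lexx _)) _.
rewrite -[N.+2%:R]natr1; set c : R := N.+1%:R.
have c1 : 1 <= c by rewrite ler1n.
have h1 : c^-1 - (c + 1)^-1 = c^-1 * (c + 1)^-1 by field; lra.
have h2 : (c + 1) ^- 3 <= c^-1 * (c + 1)^-1.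
  have u0 : 0 <= (c + 1)^-1 by rewrite invr_ge0; lra.
  have u1 : (c + 1)^-1 <= 1 by rewrite invf_le1; lra.
  have uv : (c + 1)^-1 <= c^-1 by rewrite lef_pV2 ?posrE; lra.
  by rewrite -exprVn !exprSr expr0 mul1r ler_wpM2r // (le_trans _ uv) // ler_piMl.
rewrite -h1 in h2; move: h2; move: (c^-1) ((c + 1)^-1) ((c + 1) ^- 3) => u v w; lra.
Qed.

Lemma zeta3_cvg : \sum_(1 <= k < N) k%:R ^- 3 @[N --> \oo] --> (zeta3 R).
Proof.
apply: nondecreasing_is_cvgn.
  apply/nondecreasing_seqP => -[|N]; first by rewrite !big_geq.
  by rewrite [leRHS]big_nat_recr //= lerDl invr_ge0 exprn_ge0.
exists 2 => _ [N _ <-].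
case: N => [|[|N]]; [by rewrite big_geq|by rewrite big_geq|].
by apply: le_trans (sum_cube_le N) _; rewrite gerBl invr_ge0.
Qed.

(** The series of f has nonnegative terms, so it may be integrated term by
term. *)
Lemma integral_f : (\int[mu]_(x in `[0%R, +oo[) (f x)%:E = (zeta3 R)%:E)%E.
Proof.
under eq_integral => x xI.
  rewrite -f_ereal_series; last first.
    by move: xI; rewrite inE /= in_itv /= andbT.
  over.
rewrite integral_nneseries //=; first last.
- by move=> k x; rewrite /= in_itv /= andbT => x0; rewrite lee_fin divr_ge0 ?progeny_ge0.
- move=> k; apply/measurable_EFinP; apply: measurable_funTS.
  apply: continuous_measurable_fun; exact: continuous_f_term.
rewrite (eq_eseriesr (g := fun k => (k.+1%:R ^- 3)%:E)); last first.
  by move=> k _; exact: integral_f_term.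
rewrite -(cvg_lim (@Rhausdorff R) zeta3_cvg).
have c : \sum_(1 <= k < N.+1) k%:R ^- 3 @[N --> \oo] --> (zeta3 R).
  by rewrite (cvg_shiftS (fun N => \sum_(1 <= k < N) k%:R ^- 3 : R)); exact: zeta3_cvg.
rewrite (cvg_lim (@Rhausdorff R) zeta3_cvg) -(cvg_lim (@Rhausdorff R) c).
rewrite -EFin_lim; last exact: cvgP c.
by congr (limn _); apply/funext => N /=; rewrite sumEFin big_add1.
Qed.

Lemma primF_cvg : primF n%:R @[n --> \oo] --> zeta3 R.
Proof.
pose D (n : nat) : set R := `[0, n%:R]%classic.
have UD : \bigcup_i D i = `[0, +oo[%classic.
  apply/seteqP; split => x.
    by move=> [i _]; rewrite /D /= !in_itv /= andbT => /andP[].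
  rewrite /= in_itv /= andbT => x0; exists (Num.trunc x).+1 => //.
  rewrite /D /= in_itv /= x0 /= ltW //.
  by have := truncn_itv x0; rewrite -natr1 => /andP[].
have h : (\int[mu]_(x in D i) (f x)%:E @[i --> \oo] --> (zeta3 R)%:E)%E.
  rewrite -integral_f -UD; apply: ge0_nondecreasing_set_cvg_integral.
  - apply/nondecreasing_seqP => n; rewrite subsetEset => x.
    by rewrite /D /= !in_itv /= => /andP[-> /le_trans]; apply; rewrite ler_nat.
  - by move=> i; exact: measurable_itv.
  - move=> i; apply/measurable_EFinP; apply: measurable_f; [exact: measurable_itv|move=> x].
    by rewrite /D /= !in_itv /= andbT => /andP[].
  - by move=> i x; rewrite /D /= in_itv /= => /andP[x0 _]; rewrite lee_fin f_ge0.
exact: (fine_cvg h).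
Qed.

End Integral.

(** * Sums of f over a mesh *)

Section Riemann.
Variable R : realType.
Implicit Types (a b e psi u : R).

Lemma primF_lim e : 0 < e ->
  exists B, forall b, B <= b -> `|primF b - zeta3 R| <= e.
Proof.
move=> e0; have /cvgrPdist_le/(_ e e0)[N _ HN] := @primF_cvg R.
have le_zeta b : 0 <= b -> primF b <= zeta3 R.
  move=> b0; rewrite -(cvg_lim (@Rhausdorff R) (@primF_cvg R)).
  apply: limr_ge; first exact: cvgP (@primF_cvg R).
  near=> n; apply: primF_homo => //.
  by near: n; exact: nbhs_infty_ger.
exists N%:R => b Nb; have b0 : 0 <= b by exact: le_trans Nb.
have := HN N (leqnn N); rewrite /= distrC !ler0_norm ?subr_le0 ?le_zeta //.
by move=> h; apply: le_trans h; rewrite lerN2 lerD2r; exact: primF_homo.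
Unshelve. all: by end_near. Qed.

(** At the threshold u / n, a blue edge is light with probability u / n, and a red
one, penalised by 2 psi / n, with probability (u - 2 psi) / n if this is
positive. The average is this parameter divided by n. *)
Definition xpar psi u : R := Num.max (u / 2) (u - psi).
(** The complementary part of u: the two parameters coincide until u = 2 psi, and
then this one stops. *)
Definition zpar psi u : R := Num.min (u / 2) psi.
(** An antiderivative of u |-> f (xpar psi u): until u = 2 psi, both arguments
are u / 2, and afterwards only the first one moves, at unit speed. *)
Definition mesh_prim psi u : R := primF (xpar psi u) + primF (zpar psi u).

Lemma xpar_ge0 psi u : 0 <= u -> 0 <= xpar psi u.
Proof. by move=> u0; rewrite le_max divr_ge0. Qed.

Lemma xpar_homo psi a b : a <= b -> xpar psi a <= xpar psi b.
Proof.
by move=> ab; rewrite ge_max !le_max; apply/andP; split; apply/orP; [left|right]; lra.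
Qed.

Lemma mesh_prim_bounds psi a b : 0 <= psi -> 0 <= a -> a <= b ->
  f (xpar psi b) * (b - a) <= mesh_prim psi b - mesh_prim psi a <= f (xpar psi a) * (b - a).
Proof.
move=> p0 a0 ab; have b0 : 0 <= b by exact: le_trans ab.
have xz u : xpar psi u + zpar psi u = u.
  by rewrite /xpar /zpar; case: (leP (u / 2) psi); case: (leP (u / 2) (u - psi)) => ? ?; lra.
have zx u : zpar psi u <= xpar psi u.
  by rewrite /xpar /zpar; case: (leP (u / 2) psi); case: (leP (u / 2) (u - psi)) => ? ?; lra.
have z0 u : 0 <= u -> 0 <= zpar psi u by move=> u0; rewrite le_min p0 divr_ge0.
have zab : zpar psi a <= zpar psi b.
  by rewrite le_min !ge_min lexx orbT andbT; apply/orP; left; lra.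
(* At a, either the two parameters coincide or the second one has stopped. *)
have dich : xpar psi a = zpar psi a \/ zpar psi b = zpar psi a.
  have [ap|ap] := leP (a / 2) psi; [left|right].
    by have := xz a; rewrite /zpar min_l //; lra.
  by rewrite /zpar !min_r; lra.
have dich' : xpar psi a = zpar psi a \/ zpar psi b - zpar psi a = 0.
  by case: dich => [->|->]; [left|right; rewrite subrr].
have /andP[x1 x2] := primF_bounds (xpar_ge0 psi a0) (xpar_homo psi ab).
have /andP[z1 z2] := primF_bounds (z0 _ a0) zab.
have -> : b - a = (xpar psi b - xpar psi a) + (zpar psi b - zpar psi a).
  by rewrite -{1}(xz b) -{1}(xz a); ring.
have -> : mesh_prim psi b - mesh_prim psi a = (primF (xpar psi b) - primF (xpar psi a))
    + (primF (zpar psi b) - primF (zpar psi a)).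
  by rewrite /mesh_prim opprD addrACA.
have fxz : f (xpar psi b) <= f (zpar psi b) by apply: f_nonincr; [exact: z0|exact: zx].
move: (xpar psi b - _) x1 x2 => dx x1 x2.
have zb0 := z0 _ b0; have zxb := zx b.
have dz0 : 0 <= zpar psi b - zpar psi a by rewrite subr_ge0.
move: (zpar psi b - zpar psi a) dz0 z1 z2 dich' => dz dz0 z1 z2 {}dich.
have z2' : primF (zpar psi b) - primF (zpar psi a) <= f (xpar psi a) * dz.
  by case: dich => [->//|dzE]; move: z2; rewrite dzE !mulr0.
apply/andP; split.
  rewrite [leLHS]mulrDr; apply: (lerD x1); apply: le_trans z1.
  exact: ler_wpM2r.
rewrite [leRHS]mulrDr; exact: (lerD x2).
Qed.

Lemma mesh_prim0 psi : 0 <= psi -> mesh_prim psi 0 = 0.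
Proof.
move=> p0; rewrite /mesh_prim /xpar /zpar mul0r sub0r max_l ?oppr_le0 // min_l //.
by rewrite primF0 addr0.
Qed.

Lemma mesh_prim_lim psi e : 0 <= psi -> 0 < e ->
  exists B, forall u, B <= u -> `|mesh_prim psi u - (zeta3 R + primF psi)| <= e.
Proof.
move=> p0 e0; have [B HB] := primF_lim e0.
exists (Num.max (2 * psi) (B + psi)) => u; rewrite ge_max => /andP[u1 u2].
rewrite /mesh_prim /xpar /zpar max_r ?min_r; [|lra..].
by rewrite opprD addrACA subrr addr0; apply: HB; lra.
Qed.

Lemma riemann_bounds psi d I : 0 <= psi -> 0 < d ->
  mesh_prim psi (I%:R * d) - d <= \sum_(1 <= i < I.+1) d * f (xpar psi (i%:R * d))
    <= mesh_prim psi (I%:R * d).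
Proof.
move=> p0 d0; have dd i : i.+1%:R * d - i%:R * d = d by rewrite -natr1; ring.
have id0 i : 0 <= i%:R * d by rewrite mulr_ge0 // ltW.
have bd i : f (xpar psi (i.+1%:R * d)) * d <= mesh_prim psi (i.+1%:R * d) - mesh_prim psi (i%:R * d)
    <= f (xpar psi (i%:R * d)) * d.
  have := @mesh_prim_bounds psi (i%:R * d) (i.+1%:R * d) p0 (id0 i); rewrite dd; apply.
  by rewrite ler_pM2r // ler_nat.
have up J : \sum_(1 <= i < J.+1) d * f (xpar psi (i%:R * d)) <= mesh_prim psi (J%:R * d).
  elim: J => [|J IH]; first by rewrite big_geq // mul0r mesh_prim0.
  by rewrite big_nat_recr //=; have /andP[+ _] := bd J; rewrite mulrC; lra.
have lo J : mesh_prim psi (J.+1%:R * d) - d <= \sum_(1 <= i < J.+1) d * f (xpar psi (i%:R * d)).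
  elim: J => [|J IH].
    rewrite big_geq // subr_le0; have /andP[_] := bd 0; rewrite mul0r mesh_prim0 // subr0.
    by move/le_trans; apply; rewrite ger_pMl // f_le1 // xpar_ge0.
  by rewrite big_nat_recr //=; have /andP[_ +] := bd J.+1; rewrite mulrC; lra.
have /andP[h _] := bd I; have := lo I; have := up I.
have : 0 <= f (xpar psi (I.+1%:R * d)) * d.
  by rewrite mulr_ge0 ?f_ge0 ?xpar_ge0 // ltW.
by move=> h0 -> /=; lra.
Qed.

(** The integral of f (xpar psi u) over u >= 0 is twice the integral of f over
[0, psi] plus the integral beyond psi, hence zeta(3) plus the integral over
[0, psi]. *)
Lemma riemann_lim psi d e : 0 <= psi -> 0 < d -> 0 < e -> exists I0, forall I, (I0 <= I)%N ->
  `|\sum_(1 <= i < I.+1) d * f (xpar psi (i%:R * d)) - (zeta3 R + primF psi)| <= d + e.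
Proof.
move=> p0 d0 e0; have [B HB] := mesh_prim_lim p0 e0.
exists (Num.trunc (`|B| / d)).+1 => I II.
have BI : B <= I%:R * d.
  rewrite (le_trans (ler_norm _)) // -ler_pdivrMr // ltW //.
  have /truncn_itv/andP[_ h] : 0 <= `|B| / d by rewrite divr_ge0 // ltW.
  by apply: lt_le_trans h _; rewrite ler_nat.
have := HB _ BI; have /andP[] := riemann_bounds I p0 d0.
rewrite !ler_norml => l1 l2 /andP[h1 h2]; apply/andP; split; lra.
Qed.

End Riemann.

(** * Components of a graph and greedy forests *)

Section Graph.
Import mathcomp.boot.fintype mathcomp.boot.finset.
Local Open Scope set_scope.
Variable n : nat.
Implicit Types (S T F : {set edge n}) (x y a b v w : 'I_n) (e : edge n).

Lemma connect_ind (V : finType) (r : rel V) (Q : pred V) (x y : V) :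
  (forall u v : V, Q u -> r u v -> Q v) -> Q x -> connect r x y -> Q y.
Proof.
move=> H + /connectP[p + ->]; elim: p x => //= z p IH x Qx /andP[xz pz].
by apply: IH pz; exact: H xz.
Qed.

Lemma edge_ends e : exists2 ab : 'I_n * 'I_n, ab.1 != ab.2 & val e = [set ab.1; ab.2].
Proof. by case: e => A /= /cards2P[a [b [ab ->]]]; exists (a, b). Qed.

Lemma adjP S x y :
  reflect (exists2 e, e \in S & val e = [set x; y]) (adj S x y).
Proof.
apply: (iffP existsP) => [[e /andP[eS /eqP exy]]|[e eS exy]]; exists e => //.
by rewrite eS exy eqxx.
Qed.

Lemma adj_sym S : symmetric (adj S).
Proof. by move=> x y; rewrite /adj setUC. Qed.

Lemma connect_adj_sym S x y : connect (adj S) x y = connect (adj S) y x.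
Proof. exact: (sym_connect_sym (adj_sym S)). Qed.

Lemma adj_sub S T x y : S \subset T -> adj S x y -> adj T x y.
Proof. by move=> /subsetP ST /adjP[e /ST eT exy]; apply/adjP; exists e. Qed.

Lemma connect_adj_sub S T x y : S \subset T -> connect (adj S) x y -> connect (adj T) x y.
Proof.
by move=> ST; apply: connect_sub => u v uv; apply: connect1; exact: adj_sub uv.
Qed.

Lemma connect_adj_setU1 S e a b x y : val e = [set a; b] ->
  connect (adj (e |: S)) x y = [|| connect (adj S) x y,
    connect (adj S) x a && connect (adj S) b y |
    connect (adj S) x b && connect (adj S) a y].
Proof.
move=> eab; have sub := @connect_adj_sub S (e |: S) _ _ (subsetUr _ _).
have ab : connect (adj (e |: S)) a b.
  by apply: connect1; apply/adjP; exists e; rewrite ?setU11.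
apply/idP/idP.
  apply: (@connect_ind _ _ (fun y => [|| connect (adj S) x y,
    connect (adj S) x a && connect (adj S) b y |
    connect (adj S) x b && connect (adj S) a y])); last by rewrite connect0.
  move=> u v Qu /adjP[e' + e'uv].
  rewrite in_setU1 => /predU1P[e'e|e'S].
    have : v \in [set a; b] by rewrite -eab -e'e e'uv !inE eqxx orbT.
    have : u \in [set a; b] by rewrite -eab -e'e e'uv !inE eqxx.
    rewrite !inE => /orP[]/eqP uE /orP[]/eqP vE; rewrite uE in Qu; rewrite vE //.
      by case/or3P: Qu => [->|/andP[->]|/andP[->]]; rewrite connect0 ?orbT.
    by case/or3P: Qu => [->|/andP[->]|/andP[->]]; rewrite connect0 ?orbT.
  have uv : connect (adj S) u v by apply: connect1; apply/adjP; exists e'.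
  case/or3P: Qu => [xu|/andP[xa bu]|/andP[xb au]].
  - by rewrite (connect_trans xu uv).
  - by rewrite xa (connect_trans bu uv) orbT.
  - by rewrite xb (connect_trans au uv) !orbT.
case/or3P => [/sub //|/andP[/sub xa /sub bu]|/andP[/sub xb /sub au]].
  exact: connect_trans (connect_trans xa ab) bu.
by apply: connect_trans (connect_trans xb _) au; rewrite connect_adj_sym.
Qed.

Definition component_of S v : {set 'I_n} := [set w | connect (adj S) v w].

Lemma component_of_refl S v : v \in component_of S v.
Proof. by rewrite inE. Qed.

Lemma component_of_eq S v w : w \in component_of S v -> component_of S w = component_of S v.
Proof.
rewrite inE => vw; apply/setP => u; rewrite !inE.
by apply/idP/idP; apply: connect_trans => //; rewrite connect_adj_sym.
Qed.

Lemma component_of_gt0 S v : (0 < #|component_of S v|)%N.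
Proof. by apply/card_gt0P; exists v; exact: component_of_refl. Qed.

Variable R : realType.

(** The number of components, as every component receives a total of 1 from its
vertices. This form reduces its mean to the law of the component of one
vertex. *)
Definition kappa S : R := \sum_v (#|component_of S v|%:R)^-1.

Lemma sum_inv_card (V : finType) (A : {set V}) : (0 < #|A|)%N ->
  \sum_(w in A) (#|A|%:R)^-1 = 1 :> R.
Proof.
by move=> A0; rewrite sumr_const -[_ *+ _]mulr_natr mulVf // pnatr_eq0 -lt0n.
Qed.

Lemma sum_component_of S v : \sum_(w in component_of S v) (#|component_of S w|%:R)^-1 = 1 :> R.
Proof.
under eq_bigr => w wv do rewrite (component_of_eq wv).
by rewrite sum_inv_card // component_of_gt0.
Qed.

(** If the edge joins two components, their vertices together contribute 1
instead of 2; otherwise all components are unchanged. *)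
Lemma kappa_setU1 S e a b : val e = [set a; b] ->
  kappa (e |: S) = kappa S - (~~ connect (adj S) a b)%:R.
Proof.
move=> eab; have sub := @connect_adj_sub S (e |: S) _ _ (subsetUr _ _).
have [ab|ab] := boolP (connect (adj S) a b).
  rewrite subr0; apply: eq_bigr => v _; congr (_%:R^-1); apply: eq_card => w.
  rewrite !inE (connect_adj_setU1 _ _ _ eab); apply/idP/idP => [|->//].
  case/or3P => [//|/andP[va bw]|/andP[vb aw]].
    exact: connect_trans (connect_trans va ab) bw.
  by apply: connect_trans (connect_trans vb _) aw; rewrite connect_adj_sym.
set A := component_of S a; set B := component_of S b; set C := A :|: B.
have dAB : fintype.disjoint (mem A) (mem B).
  rewrite -setI_eq0; apply/eqP/setP => w; rewrite !inE; apply/negbTE/negP.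
  move=> /andP[aw bw]; move/negP: ab; apply; apply: connect_trans aw _.
  by rewrite connect_adj_sym.
have CE v : v \in C -> component_of (e |: S) v = C.
  move=> vC; have vC' : v \in component_of (e |: S) a.
    have ab' : connect (adj (e |: S)) a b.
      by apply: connect1; apply/adjP; exists e; rewrite ?setU11.
    move: vC; rewrite !inE => /orP[/sub //|/sub]; exact: connect_trans.
  rewrite (component_of_eq vC'); apply/setP => w; rewrite !inE (connect_adj_setU1 _ _ _ eab).
  by rewrite connect0 /= (negbTE ab) /= orbF.
have nC v : v \notin C -> component_of (e |: S) v = component_of S v.
  rewrite !inE negb_or => /andP[av bv]; apply/setP => w.
  by rewrite !inE (connect_adj_setU1 _ _ _ eab) [_ v a]connect_adj_sym [_ v b]connect_adj_sym (negbTE av) (negbTE bv) !orbF.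
rewrite /kappa (bigID (mem C)) [in RHS](bigID (mem C)) /=.
have -> : \sum_(v in C) (#|component_of (e |: S) v|%:R)^-1 = 1 :> R.
  under eq_bigr => v vC do rewrite (CE v vC).
  by rewrite sum_inv_card //; apply/card_gt0P; exists a; rewrite !inE connect0.
have -> : \sum_(v in C) (#|component_of S v|%:R)^-1 = 2 :> R.
  rewrite (eq_bigl [in [predU A & B]]); last by move=> v; rewrite !inE.
  by rewrite bigU //= !sum_component_of.
rewrite [X in 1 + X](eq_bigr (fun v => (#|component_of S v|%:R)^-1)); last by move=> v /nC ->.
ring.
Qed.

Lemma kappa_set0 : kappa set0 = n%:R.
Proof.
have cE v : component_of set0 v = [set v].
  apply/setP => w; rewrite !inE; apply/idP/eqP => [h|->]; last exact: connect0.
  apply/eqP; apply: (@connect_ind _ _ (pred1 v)) h => [u u' _ /adjP[e]|/=].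
    by rewrite inE.
  exact: eqxx.
rewrite /kappa; under eq_bigr => v _ do rewrite cE cards1 invr1.
by rewrite sumr_const card_ord.
Qed.

Lemma kappa_ge1 S : (0 < n)%N -> 1 <= kappa S.
Proof.
move=> n0; rewrite -(sum_component_of S (Ordinal n0)) /kappa.
by rewrite [leRHS](bigID (mem (component_of S (Ordinal n0)))) /= lerDl sumr_ge0.
Qed.

Lemma kappa_connected S : (0 < n)%N -> connected_graph S -> kappa S = 1.
Proof.
move=> n0 cS; rewrite -(sum_component_of S (Ordinal n0)) /kappa.
by apply: eq_bigl => v; rewrite inE cS.
Qed.

(** Two distinct components would contribute 1 each. *)
Lemma connected_kappa S : kappa S < 2 -> connected_graph S.
Proof.
move=> k2 x y; apply/negPn/negP => xy; move: k2; apply/negP; rewrite -leNgt.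
have dxy : fintype.disjoint (mem (component_of S x)) (mem (component_of S y)).
  rewrite -setI_eq0; apply/eqP/setP => w; rewrite !inE; apply/negbTE/negP.
  move=> /andP[xw yw]; move/negP: xy; apply; apply: connect_trans xw _.
  by rewrite connect_adj_sym.
rewrite /kappa (bigID (mem (component_of S x :|: component_of S y))) /=.
rewrite (eq_bigl [in [predU component_of S x & component_of S y]]); last by move=> v; rewrite !inE.
by rewrite bigU //= !sum_component_of lerDl sumr_ge0.
Qed.

Lemma kappa_setU S F : kappa S - #|F|%:R <= kappa (S :|: F) <= kappa S.
Proof.
move: {2}#|F| (leqnn #|F|) => m; elim: m F => [|m IH] F.
  by rewrite leqn0 cards_eq0 => /eqP ->; rewrite setU0 cards0 subr0 lexx.
case: (set_0Vmem F) => [->|[e eF] Fm]; first by rewrite setU0 cards0 subr0 lexx.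
have cF : #|F| = (#|F :\ e|).+1 by rewrite (cardsD1 e) eF.
have /andP[l u] : kappa S - #|F :\ e|%:R <= kappa (S :|: (F :\ e)) <= kappa S.
  by apply: IH; rewrite -ltnS -cF.
have -> : S :|: F = e |: (S :|: (F :\ e)).
  by rewrite setUCA setD1K.
have [[a b] /= ab eab] := edge_ends e.
rewrite (kappa_setU1 _ eab) cF -natr1.
by clear -l u; case: (connect _ a b) => /=; apply/andP; split; lra.
Qed.

Lemma kappa_le S T : S \subset T -> kappa T <= kappa S.
Proof. by move=> /setUidPr <-; case/andP: (kappa_setU S T). Qed.

Lemma kappa_le_vertices S : kappa S <= n%:R.
Proof. by rewrite -kappa_set0 kappa_le // sub0set. Qed.

(** Each edge that is added to S lowers kappa by at most 1, and once all of T
is there kappa is 1. *)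
Lemma connected_out S T : (0 < n)%N -> connected_graph T ->
  kappa S - 1 <= #|T :\: S|%:R.
Proof.
move=> n0 cT; have /andP[h _] := kappa_setU S (T :\: S).
have h1 : kappa (S :|: T :\: S) <= 1.
  rewrite -(kappa_connected n0 cT); apply: kappa_le.
  by apply/subsetP => e eT; rewrite !inE eT andbT orbN.
lra.
Qed.

Lemma connected_setT : connected_graph [set: edge n].
Proof.
move=> x y; have [->|xy] := eqVneq x y; first exact: connect0.
have exy : #|[set x; y]| == 2 by rewrite cards2 xy.
by apply: connect1; apply/adjP; exists (Sub [set x; y] exy : edge n); rewrite ?inE.
Qed.

(** All vertices before the last one of the walk differ from both ends of e, and
every edge of the walk has such a vertex. *)
Lemma path_avoid T e x y z s : val e = [set x; y] -> x \notin z :: s ->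
  y \notin z :: s -> path (adj T) z (rcons s x) -> path (adj (T :\ e)) z (rcons s x).
Proof.
move=> exy; elim: s z => [|w s IH] z; rewrite /= !inE ?negb_or.
  rewrite !andbT => xz yz /adjP[e' e'T e'E]; apply/adjP; exists e' => //.
  rewrite !inE e'T andbT; apply/eqP => ee; have : z \in val e by rewrite -ee e'E !inE eqxx.
  by rewrite exy !inE => /orP[]/eqP zE; move: xz yz; rewrite zE eqxx.
move=> /and3P[xz xw xs] /and3P[yz yw ys] /andP[/adjP[e' e'T e'E] p].
apply/andP; split; last by apply: IH; rewrite // !inE negb_or ?xw ?yw.
apply/adjP; exists e' => //.
rewrite !inE e'T andbT; apply/eqP => ee; have : z \in val e by rewrite -ee e'E !inE eqxx.
by rewrite exy !inE => /orP[]/eqP zE; move: xz yz; rewrite zE eqxx.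
Qed.

(** An edge of a cycle could be removed without disconnecting T, leaving a
connected graph with at most n - 2 edges. *)
Lemma acyclic_of_card T : (0 < n)%N -> connected_graph T ->
  (#|T| <= n.-1)%N -> acyclic_graph T.
Proof.
move=> n0 cT Tn [|x [|y [|z s]]] // _ /andP[] /=.
rewrite !inE !negb_or => /and3P[/adjP[e eT exy] yz p].
move=> /and4P[/and3P[xy xz xs] /andP[yz' ys] zs us].
have xy' : connect (adj (T :\ e)) y x.
  have : path (adj (T :\ e)) y (rcons (z :: s) x).
    rewrite /=; apply/andP; split; last first.
      by apply: path_avoid exy _ _ p; rewrite inE negb_or ?xz ?yz'.
    move/adjP: yz => [e' e'T e'E]; apply/adjP; exists e' => //.
    rewrite !inE e'T andbT; apply/eqP => ee; have : z \in val e by rewrite -ee e'E !inE eqxx orbT.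
    by rewrite exy !inE => /orP[]/eqP zE; move: xz yz'; rewrite zE eqxx.
  by move=> /path_connect; apply; rewrite inE mem_rcons inE eqxx orbT.
have k1 : kappa (T :\ e) = 1.
  rewrite -(kappa_connected n0 cT) -{2}(setD1K eT) (kappa_setU1 _ exy).
  by rewrite connect_adj_sym xy' subr0.
have /andP[+ _] := kappa_setU set0 (T :\ e).
rewrite set0U k1 kappa_set0 lerBlDr nat1r ler_nat.
move: Tn; rewrite (cardsD1 e) eT; move: #|T :\ e| n0; clear; lia.
Qed.

Section Greedy.
Variable W : edge n -> R.
Definition low t : {set edge n} := [set e | W e <= t].

(** Kruskal's algorithm. Take the heaviest edge e of S and a forest for
the other edges: e is added if and only if it joins two of their components.
Below the weight of e nothing changes but the last term; from that weight on,
both sides are 0. *)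
Lemma greedy_forest S : exists2 T : {set edge n}, T \subset S &
  (forall x y, connect (adj T) x y = connect (adj S) x y) /\
  (forall t, #|T :\: low t|%:R = kappa (S :&: low t) - kappa S).
Proof.
move: {2}#|S| (leqnn #|S|) => m; elim: m S => [|m IH] S.
  rewrite leqn0 cards_eq0 => /eqP ->; exists set0; rewrite ?sub0set //; split=> // t.
  by rewrite set0D set0I cards0 subrr.
case: (set_0Vmem S) => [-> _|[e0 e0S] Sm].
  by apply: IH; rewrite cards0.
have [e eS emax] : exists2 e, e \in S & forall e', e' \in S -> W e' <= W e.
  case: (@arg_maxP _ _ _ e0 (mem S) W e0S) => e eS h; exists e => // e' /h.
have cS : #|S| = (#|S :\ e|).+1 by rewrite (cardsD1 e) eS.
have [|T TS [Tc Tt]] := IH (S :\ e); first by rewrite -ltnS -cS.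
have [[a b] /= ab eab] := edge_ends e.
have SE : S = e |: (S :\ e) by rewrite setD1K.
have kS : kappa S = kappa (S :\ e) - (~~ connect (adj (S :\ e)) a b)%:R.
  by rewrite {1}SE (kappa_setU1 _ eab).
have eT : e \notin T by apply/negP => /(subsetP TS); rewrite !inE eqxx.
have TS' : T \subset S by apply: subset_trans TS (subD1set _ _).
have hi t T' : T' \subset S -> W e <= t -> #|T' :\: low t|%:R = kappa (S :&: low t) - kappa S.
  move=> T'S et; have Sl : S \subset low t.
    by apply/subsetP => e' /emax h; rewrite inE (le_trans h).
  rewrite (setIidPl Sl) subrr (_ : T' :\: low t = set0) ?cards0 //.
  by apply/eqP; rewrite setD_eq0 (subset_trans T'S).
have lo t : t < W e -> S :&: low t = (S :\ e) :&: low t.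
  move=> te; apply/setP => e'; rewrite !inE; case: eqP => //= ->.
  by rewrite leNgt te andbF.
have [cab|cab] := boolP (connect (adj (S :\ e)) a b).
  exists T => //; split => [x y|t].
    rewrite Tc {2}SE (connect_adj_setU1 _ _ _ eab); apply/idP/idP => [->//|].
    case/or3P => [//|/andP[xa by_]|/andP[xb ay]].
      exact: connect_trans (connect_trans xa cab) by_.
    by apply: connect_trans (connect_trans xb _) ay; rewrite connect_adj_sym.
  have [et|te] := leP (W e) t; first exact: hi.
  by rewrite lo // Tt kS cab subr0.
exists (e |: T); first by rewrite subUset sub1set eS.
split => [x y|t]; first by rewrite SE !(connect_adj_setU1 _ _ _ eab) !Tc.
have [et|te] := leP (W e) t; first by apply: hi => //; rewrite subUset sub1set eS.
rewrite lo // kS cab opprB addrA addrAC -Tt.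
rewrite (_ : (e |: T) :\: low t = e |: (T :\: low t)).
  by rewrite cardsU1 !inE (negbTE eT) andbF /= natrD addrC.
apply/setP => e'; rewrite !inE; case: eqP => [->|//] /=.
by rewrite -ltNge te.
Qed.

End Greedy.

End Graph.

(** * Tree weights as sums over thresholds *)

Section Mesh.
Import mathcomp.boot.fintype mathcomp.boot.finset.
Local Open Scope set_scope.
Local Open Scope ring_scope.
Variable R : realType.

(** A lower Riemann sum for the integral of the indicator function of t < w over
t >= 0, which is w. *)
Lemma mesh_le (w h : R) N : 0 < h -> 0 <= w ->
  \sum_(1 <= i < N.+1) h * (i%:R * h < w)%R%:R <= w.
Proof.
move=> h0 w0; have aux M : \sum_(1 <= i < M.+1) h * (i%:R * h < w)%R%:R <= M%:R * h.
  elim: M => [|M IH]; first by rewrite big_geq // mul0r.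
  rewrite big_nat_recr //= -natr1 mulrDl mul1r lerD //.
  by rewrite ler_piMr ?(ltW h0) // lern1 leq_b1.
elim: N => [|N IH]; first by rewrite big_geq.
rewrite big_nat_recr //=; have [lt|le] := ltP (N.+1%:R * h) w.
  rewrite mulr1; apply: le_trans (ltW lt).
  by rewrite -natr1 mulrDl mul1r lerD2r.
by rewrite mulr0 addr0.
Qed.

(** The same Riemann sum misses at most one step of the integral, if the mesh goes
beyond w. *)
Lemma mesh_ge (w h : R) N : 0 < h -> w <= N%:R * h ->
  w <= h + \sum_(1 <= i < N.+1) h * (i%:R * h < w)%R%:R.
Proof.
move=> h0; elim: N => [|N IH] wN.
  by rewrite big_geq // addr0 (le_trans wN) // mul0r ltW.
have [le|lt] := leP w (N%:R * h).
  rewrite big_nat_recr //= addrA ler_wpDr ?IH // mulr_ge0 // ltW //.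
apply: (le_trans wN); rewrite -natr1 mulrDl mul1r addrC lerD2l.
rewrite (le_trans _ (_ : \sum_(1 <= i < N.+1) h <= _)) //.
  by rewrite sumr_const_nat subSS subn0 mulr_natl.
rewrite [leRHS]big_nat_recr //= ler_wpDr ?mulr_ge0 ?(ltW h0) //.
rewrite big_nat_cond [leRHS]big_nat_cond; apply: ler_sum => i /andP[/andP[_ iN] _].
by rewrite (le_lt_trans _ lt) ?mulr1 // ler_pM2r // ler_nat.
Qed.

Variable n : nat.
Hypothesis n0 : (0 < n)%N.
Variable W : edge n -> R.
Implicit Types T : {set edge n}.

Lemma card_out T (t : R) :
  #|T :\: low W t|%:R = \sum_(e in T) (t < W e)%R%:R :> R.
Proof.
rewrite -sum1_card natr_sum big_mkcond [RHS]big_mkcond /=.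
apply: eq_bigr => e _; rewrite !inE -ltNge.
by case: (e \in T); case: ltP.
Qed.

(** Sum the weight of each edge over the thresholds below it; at each
threshold [connected_out] counts the edges above it. *)
Lemma connected_cost_ge T (h : R) N : connected_graph T -> 0 < h ->
  (forall e, 0 <= W e) ->
  \sum_(1 <= i < N.+1) h * (kappa R (low W (i%:R * h)) - 1) <= \sum_(e in T) W e.
Proof.
move=> cT h0 W0.
apply: (@le_trans _ _ (\sum_(1 <= i < N.+1) h * \sum_(e in T) (i%:R * h < W e)%R%:R)).
  apply: ler_sum => i _; rewrite ler_wpM2l ?(ltW h0) // -card_out.
  exact: connected_out.
under eq_bigr => i _ do rewrite mulr_sumr.
by rewrite exchange_big /=; apply: ler_sum => e _; exact: mesh_le.
Qed.

(** For the greedy tree, [connected_out] is an equality at every threshold,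
and the mesh costs at most h per edge. The last clause says that no edge is
heavier than a threshold at which the light edges already connect the graph. *)
Lemma exists_light_tree (h : R) N : 0 < h -> (forall e, 0 <= W e <= N%:R * h) ->
  exists T, [/\ spanning_tree T,
    \sum_(e in T) W e <=
      n%:R * h + \sum_(1 <= i < N.+1) h * (kappa R (low W (i%:R * h)) - 1) &
    forall t, kappa R (low W t) = 1 -> forall e, e \in T -> W e <= t].
Proof.
move=> h0 WN; have [T _ [Tc Tt]] := greedy_forest W [set: edge n].
have cT : connected_graph T.
  by move=> x y; rewrite Tc; exact: connected_setT.
have kT : kappa R [set: edge n] = 1 by apply: kappa_connected => //; exact: connected_setT.
have Tt' t : #|T :\: low W t|%:R = kappa R (low W t) - 1.
  by rewrite Tt setTI kT.
have Tn : #|T|%:R = n%:R - 1 :> R.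
  (* No edge has weight at most -1, so this threshold counts all edges of T. *)
  have := Tt' (-1); have -> : low W (-1) = set0.
    apply/setP => e; rewrite !inE; apply/negbTE; rewrite -ltNge.
    by have /andP[] := WN e; lra.
  by rewrite setD0 kappa_set0.
exists T; split.
- split=> //; apply: (acyclic_of_card R) => //.
  have : (#|T|%:R <= n.-1%:R :> R).
    by rewrite Tn -[in leLHS](prednK n0) -natr1 addrK.
  by rewrite ler_nat.
- apply: (@le_trans _ _ (\sum_(e in T) (h + \sum_(1 <= i < N.+1) h * (i%:R * h < W e)%R%:R))).
    by apply: ler_sum => e _; apply: mesh_ge => //; case/andP: (WN e).
  rewrite big_split /= sumr_const -[h *+ _]mulr_natl lerD //.
    by rewrite ler_wpM2r ?(ltW h0) // Tn; lra.
  rewrite exchange_big /=; apply: ler_sum => i _.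
  by rewrite -mulr_sumr -card_out Tt'.
- move=> t kt e eT; rewrite leNgt; apply/negP => te.
  have : #|T :\: low W t|%:R = 0 :> R by rewrite Tt' kt subrr.
  move/eqP; rewrite pnatr_eq0 cards_eq0 => /eqP/setP/(_ e).
  by rewrite !inE eT andbT leNgt te.
Qed.

End Mesh.

(** * Random subsets with independent elements *)

Section Bernoulli_sets.
Import mathcomp.boot.fintype mathcomp.boot.finset.
Local Open Scope set_scope.
Local Open Scope ring_scope.
Variables (R : realType) (E : finType) (p : R).
Implicit Types (s : seq E) (g h : {set E} -> R) (e : E) (S D : {set E}).

(** The mean of g over a random subset of s that contains each element with
probability p, independently. It is computed one coin at a time, so that every
property is an induction on s. *)
Fixpoint Ex s g : R :=
  if s is e :: s' then p * Ex s' (fun S => g (e |: S)) + (1 - p) * Ex s' g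
  else g set0.

Lemma eq_Ex_in s g h : (forall S, {subset S <= s} -> g S = h S) -> Ex s g = Ex s h.
Proof.
elim: s g h => [|e s IH] g h gh /=; first by apply: gh => e; rewrite inE.
congr (_ * _ + _ * _); apply: IH => S Ss; apply: gh => e'.
  by rewrite in_setU1 inE => /predU1P[->|/Ss ->]; rewrite ?eqxx ?orbT.
by move=> /Ss; rewrite inE => ->; rewrite orbT.
Qed.

Lemma eq_Ex s g h : g =1 h -> Ex s g = Ex s h.
Proof. by move=> gh; apply: eq_Ex_in => S _; exact: gh. Qed.

Lemma Ex_cst s (c : R) : Ex s (fun=> c) = c.
Proof. by elim: s => //= e s ->; ring. Qed.

Lemma ExD s g h : Ex s (fun S => g S + h S) = Ex s g + Ex s h.
Proof. by elim: s g h => //= e s IH g h; rewrite !IH; ring. Qed.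

Lemma ExZ s (c : R) g : Ex s (fun S => c * g S) = c * Ex s g.
Proof. by elim: s g => //= e s IH g; rewrite !IH; ring. Qed.

Lemma Ex_sum s (I : Type) (r : seq I) (Q : pred I) (G : I -> {set E} -> R) :
  Ex s (fun S => \sum_(i <- r | Q i) G i S) = \sum_(i <- r | Q i) Ex s (G i).
Proof.
elim: r => [|i r IH]; first by rewrite big_nil -[RHS](Ex_cst s); apply: eq_Ex => S; rewrite big_nil.
rewrite big_cons -IH; case: ifP => Qi; rewrite -?ExD; apply: eq_Ex => S; by rewrite big_cons Qi.
Qed.

Lemma Ex_cat s1 s2 g :
  Ex (s1 ++ s2) g = Ex s1 (fun S1 => Ex s2 (fun S2 => g (S1 :|: S2))).
Proof.
elim: s1 g => [|e s IH] g /=; first by apply: eq_Ex => S; rewrite set0U.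
by rewrite !IH; congr (_ * _ + _); apply: eq_Ex => S1; apply: eq_Ex => S2; rewrite setUA.
Qed.

Lemma Ex_exchange s1 s2 (g : {set E} -> {set E} -> R) :
  Ex s1 (fun S1 => Ex s2 (g S1)) = Ex s2 (fun S2 => Ex s1 (g^~ S2)).
Proof.
elim: s1 g => //= e s IH g.
by rewrite ExD !ExZ !IH.
Qed.

(** The order of the coins does not matter, which allows revealing first the
edges at a given vertex. *)
Lemma Ex_perm s1 s2 g : perm_eq s1 s2 -> Ex s1 g = Ex s2 g.
Proof.
move=> s12; apply: (@catCA_perm_ind _ (fun s => Ex s1 g = Ex s g)) s12 erefl.
move=> t1 t2 t3 ->.
transitivity (Ex t1 (fun S1 => Ex t2 (fun S2 => Ex t3 (fun S3 =>
    g (S1 :|: (S2 :|: S3)))))).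
  by rewrite Ex_cat; apply: eq_Ex => S1; rewrite Ex_cat.
rewrite Ex_exchange Ex_cat; apply: eq_Ex => S2; rewrite Ex_cat.
by apply: eq_Ex => S1; apply: eq_Ex => S3; rewrite setUCA.
Qed.

(** The mean of F under the binomial distribution with parameters u and p. *)
Fixpoint Bn u (F : nat -> R) : R :=
  if u is u'.+1 then p * Bn u' (fun m => F m.+1) + (1 - p) * Bn u' F else F 0%N.

Lemma eq_Bn u (F G : nat -> R) : (forall m, (m <= u)%N -> F m = G m) -> Bn u F = Bn u G.
Proof.
elim: u F G => /= [|u IH] F G FG; first exact: FG.
by congr (_ * _ + _ * _); apply: IH => m mu; apply: FG => //; exact: leqW.
Qed.

Lemma Ex_count s D (F : nat -> R) : uniq s -> {subset D <= s} ->
  Ex s (fun S => F #|S :&: D|) = Bn #|D| F.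
Proof.
elim: s D F => /= [|e s IH] D F.
  move=> _ D0; have -> : D = set0 by apply/setP => e; rewrite inE; apply/negP => /D0.
  by rewrite setI0 cards0.
move=> /andP[es us] Ds; have [eD|eD] := boolP (e \in D).
  have sub : {subset D :\ e <= s}.
    by move=> e'; rewrite !inE => /andP[+ /Ds]; rewrite inE => /negbTE ->.
  rewrite (cardsD1 e) eD /= -(IH _ _ us sub) -(IH _ _ us sub).
  congr (_ * _ + _ * _); apply: eq_Ex_in => S Ss.
    rewrite -{1}(setD1K eD) -setUIr cardsU1 in_setI (negbTE (contra (Ss e) es)) //=.
  congr F; apply: eq_card => e'; rewrite !inE; case: eqP => //= ->.
  by rewrite (negbTE (contra (Ss e) es)).
have sub : {subset D <= s}.
  move=> e' e'D; have := Ds _ e'D; rewrite inE => /predU1P[e'e|//].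
  by rewrite -e'e e'D in eD.
rewrite -!(IH _ _ us sub).
rewrite (@eq_Ex _ _ (fun S => F #|S :&: D|)); first by ring.
move=> S; congr F; apply: eq_card => e'; rewrite !inE; case: eqP => //= ->.
by rewrite (negbTE eD) !andbF.
Qed.

Lemma BnE u (F : nat -> R) :
  Bn u F = \sum_(m < u.+1) 'C(u, m)%:R * p ^+ m * (1 - p) ^+ (u - m) * F m.
Proof.
elim: u F => [|u IH] F /=; first by rewrite big_ord1 bin0 !expr0 !mul1r.
rewrite !IH [RHS]big_ord_recl.
have -> : \sum_(i < u.+1) 'C(u.+1, lift ord0 i)%:R * p ^+ lift ord0 i
      * (1 - p) ^+ (u.+1 - lift ord0 i) * F (lift ord0 i) =
    \sum_(i < u.+1) 'C(u, i.+1)%:R * p ^+ i.+1 * (1 - p) ^+ (u - i) * F i.+1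
    + p * \sum_(i < u.+1) 'C(u, i)%:R * p ^+ i * (1 - p) ^+ (u - i) * F i.+1.
  rewrite mulr_sumr -big_split /=; apply: eq_bigr => i _.
  by rewrite /bump /= add1n subSS binS natrD !exprS; ring.
rewrite addrA addrC; congr (_ + _).
rewrite big_ord_recl /= !bin0 !expr0 !subn0 big_ord_recr /= bin_small // !mul0r addr0.
rewrite mulrDr mulr_sumr exprS; congr (_ + _); first by ring.
apply: eq_bigr => i _; rewrite /bump /= add1n.
have -> : (u - i)%N = (u - i.+1).+1 by have := ltn_ord i; lia.
by rewrite [(1 - p) ^+ _.+1]exprS; ring.
Qed.

Lemma Bn_expr u (c t : R) : Bn u (fun m => c * t ^+ m) = c * (1 - p + p * t) ^+ u.
Proof.
elim: u c => /= [|u IH] c; first by rewrite !expr0.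
have -> : Bn u (fun m => c * t ^+ m.+1) = Bn u (fun m => (c * t) * t ^+ m).
  by apply: eq_Bn => m _; rewrite exprS mulrA.
by rewrite !IH exprS; ring.
Qed.

Lemma BnD u F G : Bn u (fun m => F m + G m) = Bn u F + Bn u G.
Proof. by elim: u F G => //= u IH F G; rewrite !IH; ring. Qed.

Hypothesis p01 : 0 <= p <= 1.
Let p0 : 0 <= p. Proof. by case/andP: p01. Qed.
Let q0 : 0 <= 1 - p. Proof. by case/andP: p01; lra. Qed.

Lemma le_Bn u F G : (forall m, (m <= u)%N -> F m <= G m) -> Bn u F <= Bn u G.
Proof.
elim: u F G => /= [|u IH] F G FG; first exact: FG.
rewrite lerD // ler_wpM2l // IH // => m mu; apply: FG => //; exact: leqW.
Qed.

Lemma le_Ex s g h : (forall S, g S <= h S) -> Ex s g <= Ex s h.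
Proof.
elim: s g h => [|e s IH] g h gh /=; first exact: gh.
by rewrite lerD // ler_wpM2l // IH.
Qed.

Lemma Ex_ge0 s g : (forall S, 0 <= g S) -> 0 <= Ex s g.
Proof. by move=> g0; rewrite -(Ex_cst s 0); exact: le_Ex. Qed.

Lemma ler_norm_Ex s g : `|Ex s g| <= Ex s (fun S => `|g S|).
Proof.
rewrite ler_norml -[X in X <= _ <= _]mulN1r -ExZ; apply/andP; split; apply: le_Ex => S.
  by rewrite mulN1r lerNl -normrN ler_norm.
exact: ler_norm.
Qed.

(** The Efron-Stein inequality, by induction on the coins: the variance is the
mean of the two conditional variances plus p (1 - p) times the square of the
difference of the conditional means. *)
Lemma Ex_variance s g : (forall e S, `|g (e |: S) - g S| <= 1) ->
  Ex s (fun S => g S ^+ 2) - Ex s g ^+ 2 <= (size s)%:R * (p * (1 - p)).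
Proof.
elim: s g => [|e s IH] g gL /=; first by rewrite mul0r subrr.
set g1 := fun S => g (e |: S).
have g1L e' S : `|g1 (e' |: S) - g1 S| <= 1 by rewrite /g1 setUCA.
have h1 := IH _ g1L; have h2 := IH _ gL.
have d : `|Ex s g1 - Ex s g| <= 1.
  have -> : Ex s g1 - Ex s g = Ex s (fun S => g1 S + (-1) * g S).
    by rewrite ExD ExZ mulN1r.
  apply: le_trans (ler_norm_Ex _ _) _; rewrite -[leRHS](Ex_cst s).
  by apply: le_Ex => S; rewrite mulN1r; exact: gL.
rewrite -/g1 -natr1 [leRHS]mulrDl [1 * _ in leRHS]mul1r.
set A1 := Ex s (fun S => g (e |: S) ^+ 2); set A0 := Ex s (fun S => g S ^+ 2).
rewrite -/A1 in h1; rewrite -/A0 in h2.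
have d2 : (Ex s g1 - Ex s g) ^+ 2 <= 1 by rewrite -[leLHS]real_normK ?num_real // expr_le1.
have -> : p * A1 + (1 - p) * A0 - (p * Ex s g1 + (1 - p) * Ex s g) ^+ 2 =
  p * (A1 - Ex s g1 ^+ 2) + (1 - p) * (A0 - Ex s g ^+ 2)
   + p * (1 - p) * (Ex s g1 - Ex s g) ^+ 2 by ring.
apply: lerD; last by rewrite ler_piMr // mulr_ge0.
rewrite [leRHS](_ : _ = p * ((size s)%:R * (p * (1 - p))) + (1 - p) * ((size s)%:R * (p * (1 - p)))); last by ring.
by apply: lerD; apply: ler_wpM2l.
Qed.

End Bernoulli_sets.

(** * Exploration of a component *)

Section Exploration.
Import mathcomp.boot.fintype mathcomp.boot.finset.
Local Open Scope set_scope.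
Local Open Scope ring_scope.
Variables (R : realType) (n : nat).
Implicit Types (S : {set edge n}) (A W N : {set 'I_n}) (a v w x y : 'I_n).

Definition radj S W : rel 'I_n := fun x y => [&& adj S x y, x \in W & y \in W].

Definition reach S A W : {set 'I_n} :=
  [set w | [exists x in A, connect (radj S W) x w]].

Lemma reachP S A W w :
  reflect (exists2 x, x \in A & connect (radj S W) x w) (w \in reach S A W).
Proof. by rewrite inE; exact: exists_inP. Qed.

Lemma sub_reach S A W : A \subset reach S A W.
Proof. by apply/subsetP => x xA; apply/reachP; exists x. Qed.

Lemma reach_sub S A W : A \subset W -> reach S A W \subset W.
Proof.
move=> /subsetP AW; apply/subsetP => w /reachP[x /AW xW].
by apply: (@connect_ind _ _ (mem W)) => // u v _ /and3P[].
Qed.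

Lemma reach_setT S v : reach S [set v] [set: 'I_n] = component_of S v.
Proof.
apply/setP => w; rewrite [in RHS]inE; apply/reachP/idP => [[x]|vw].
  rewrite inE => /eqP ->; apply: connect_sub => u u' /and3P[uu' _ _].
  exact: connect1.
exists v; rewrite ?inE //; apply: connect_sub vw => u u' uu'.
by apply: connect1; rewrite /radj uu' !inE.
Qed.

Definition nbrs S a (U : {set 'I_n}) := [set u in U | adj S a u].

(** One step of the exploration from the active vertices A, when W is the set of
the vertices not yet processed. The active vertex a is processed: S1 contains
the revealed edges, all at a, and S2 the edges that avoid a. Then a leaves, and
its neighbours among the untouched vertices become active. *)
Lemma reach_step S1 S2 A W a : a \in A -> A \subset W ->
  (forall e, e \in S1 -> a \in val e) -> (forall e, e \in S2 -> a \notin val e) ->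
  reach (S1 :|: S2) A W =
    a |: reach S2 ((A :\ a) :|: nbrs S1 a (W :\: A)) (W :\ a).
Proof.
move=> aA AW H1 H2; set A' := _ :|: nbrs _ _ _; set W' := W :\ a.
have A'W' : A' \subset W'.
  apply/subsetP => x; rewrite !inE => /orP[/andP[-> /(subsetP AW)]//|].
  move=> /andP[/andP[xA ->] _]; rewrite andbT; apply: contra xA => /eqP ->//.
have r2 x y : radj S2 W' x y -> radj (S1 :|: S2) W x y.
  move=> /and3P[xy]; rewrite !inE => /andP[_ xW] /andP[_ yW].
  by rewrite /radj xW yW !andbT; apply: adj_sub xy; exact: subsetUr.
have ra y : a \in reach (S1 :|: S2) A W by apply: (subsetP (sub_reach _ _ _)).
apply/eqP; rewrite eqEsubset; apply/andP; split.
  apply/subsetP => w /reachP[x xA].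
  apply: (@connect_ind _ _ (mem (a |: reach S2 A' W'))); last first.
    have [->|xa] := eqVneq x a; first by rewrite inE setU11.
    rewrite inE in_setU1; apply/orP; right.
    by apply: (subsetP (sub_reach _ _ _)); rewrite !inE xa xA.
  move=> y z /= Qy /and3P[/adjP[e eS exy] yW zW].
  rewrite in_setU1; have [//|za /=] := eqVneq z a.
  have := eS; rewrite in_setU => /orP[/H1|] eS'.
    have /eqP ay : a == y.
      by move: eS'; rewrite exy !inE [a == z]eq_sym (negbTE za) orbF.
    apply: (subsetP (sub_reach _ _ _)); rewrite !inE za /= zW andbT.
    case: (boolP (z \in A)) => //= zA.
    apply/adjP; exists e; last by rewrite exy ay.
    move: eS; rewrite in_setU => /orP[//|/H2].
    by rewrite exy ay !inE eqxx.
  have ya : y != a.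
    by apply: contra (H2 _ eS') => /eqP <-; rewrite exy !inE eqxx.
  move: Qy; rewrite in_setU1 (negbTE ya) /= => /reachP[x' x'A xy'].
  apply/reachP; exists x' => //; apply: connect_trans xy' _; apply: connect1.
  by rewrite /radj !inE ya za yW zW !andbT; apply/adjP; exists e.
apply/subsetP => w; rewrite in_setU1 => /predU1P[->|]; first exact: ra.
move=> /reachP[x xA' /(connect_sub (fun u v uv => connect1 (r2 u v uv))) xw].
move: xA'; rewrite !inE => /orP[/andP[_ xA]|/andP[/andP[xA xW] ax]].
  by apply/existsP; exists x; rewrite xA.
apply/existsP; exists a; rewrite aA /=; apply: connect_trans xw; apply: connect1.
rewrite /radj (subsetP AW) //= xW andbT; apply: adj_sub ax; exact: subsetUl.
Qed.

Lemma card_reach_step S1 S2 A W a : a \in A -> A \subset W ->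
  (forall e, e \in S1 -> a \in val e) -> (forall e, e \in S2 -> a \notin val e) ->
  #|reach (S1 :|: S2) A W| =
    #|reach S2 ((A :\ a) :|: nbrs S1 a (W :\: A)) (W :\ a)|.+1.
Proof.
move=> aA AW H1 H2; rewrite (reach_step aA AW H1 H2) cardsU1.
suff -> : a \notin reach S2 ((A :\ a) :|: nbrs S1 a (W :\: A)) (W :\ a) by [].
apply/negP => /(subsetP (reach_sub _ _)); rewrite !inE eqxx => h; apply: notF; apply: h.
apply/subsetP => x; rewrite !inE => /orP[/andP[-> /(subsetP AW)]//|].
by move=> /andP[/andP[xA ->] _]; rewrite andbT; apply: contra xA => /eqP ->.
Qed.

Definition star a (U : {set 'I_n}) : {set edge n} :=
  [set e | [exists u in U, val e == [set a; u]]].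

Lemma card_nbrs S a (U : {set 'I_n}) : a \notin U ->
  #|S :&: star a U| = #|nbrs S a U|.
Proof.
move=> aU; rewrite -(card_imset _ val_inj).
have inj : {in nbrs S a U &, injective (fun u => [set a; u])}.
  move=> u u'; rewrite !inE => /andP[uU _] /andP[u'U _] /setP/(_ u).
  by rewrite !inE eqxx orbT => /esym/orP[/eqP ua|/eqP//]; rewrite -ua uU in aU.
rewrite -(card_in_imset inj); apply: eq_card => X; apply/imsetP/imsetP.
  move=> [e]; rewrite !inE => /andP[eS /exists_inP[u uU /eqP eau]] ->.
  by exists u => //; rewrite !inE uU; apply/adjP; exists e.
move=> [u]; rewrite !inE => /andP[uU /adjP[e eS eau]] ->.
by exists e => //; rewrite !inE eS; apply/exists_inP; exists u => //; rewrite eau.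
Qed.

Lemma card_star a (U : {set 'I_n}) : a \notin U -> #|star a U| = #|U|.
Proof.
move=> aU; rewrite -[star a U]setTI card_nbrs //; apply: eq_card => u.
rewrite !inE; case: (boolP (u \in U)) => //= uU.
have au : a != u by apply: contra aU => /eqP ->.
have ex : #|[set a; u]| == 2 by rewrite cards2 au.
by apply/adjP; exists (Sub [set a; u] ex : edge n); rewrite ?inE.
Qed.

Variable p : R.

(** The probability that the exploration reaches exactly k vertices from j active
ones when u vertices are untouched. This is the recursion of [progeny] with
binomial offspring. *)
Fixpoint expl k j u {struct k} : R :=
  match k, j with
  | 0%N, 0%N => 1
  | 0%N, _.+1 => 0
  | _.+1, 0%N => 0
  | k'.+1, j'.+1 => Bn p u (fun m => expl k' (j' + m)%N (u - m)%N)
  end.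

(** Deferred decisions: the edges at the processed vertex are independent of the
others, and the number of those that lead to untouched vertices is binomial. The
hypothesis on s only asks for the edges inside W, so that it passes to the
next step. *)
Lemma Ex_reach k A W (s : seq (edge n)) : uniq s -> A \subset W ->
  (forall e : edge n, val e \subset W -> e \in s) ->
  Ex p s (fun S => (#|reach S A W| == k)%:R) = expl k #|A| (#|W| - #|A|)%N.
Proof.
elim: k A W s => [|k IH] A W s us AW sW.
  have [->|[a aA]] := set_0Vmem A.
    rewrite cards0 /= -[RHS](Ex_cst p s); apply: eq_Ex => S.
    rewrite (_ : reach _ _ _ = set0) ?cards0 //.
    by apply/setP => w; rewrite !inE; apply/existsP => -[x]; rewrite inE.
  rewrite (cardsD1 a A) aA /= -[RHS](Ex_cst p s); apply: eq_Ex => S.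
  rewrite cards_eq0; case: eqP => // /setP/(_ a).
  by rewrite (subsetP (sub_reach _ _ _) _ aA) inE.
have [->|[a aA]] := set_0Vmem A.
  rewrite cards0 /= -[RHS](Ex_cst p s); apply: eq_Ex => S.
  rewrite (_ : reach _ _ _ = set0) ?cards0 //.
  by apply/setP => w; rewrite !inE; apply/existsP => -[x]; rewrite inE.
pose P (e : edge n) := a \in val e.
have ps : perm_eq s (seq.filter P s ++ seq.filter (predC P) s).
  by rewrite perm_sym; apply/permPl; exact: perm_filterC.
rewrite (Ex_perm _ _ ps) Ex_cat.
have aWA : a \notin W :\: A by rewrite inE aA.
transitivity (Ex p (seq.filter P s) (fun S1 => (fun m => expl k (#|A|.-1 + m)%N (#|W :\: A| - m)%N)
    #|S1 :&: star a (W :\: A)|)).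
  apply: eq_Ex_in => S1 S1s.
  have S1P e : e \in S1 -> a \in val e by move=> /S1s; rewrite mem_filter => /andP[].
  set N := nbrs S1 a (W :\: A).
  transitivity (Ex p (seq.filter (predC P) s) (fun S2 => (#|reach S2 ((A :\ a) :|: N) (W :\ a)| == k)%:R : R)).
    apply: eq_Ex_in => S2 S2s; rewrite (@card_reach_step _ _ _ _ a) //.
    by move=> e /S2s; rewrite mem_filter => /andP[].
  have A'W' : (A :\ a) :|: N \subset W :\ a.
    apply/subsetP => x; rewrite !inE => /orP[/andP[-> /(subsetP AW)]//|].
    by move=> /andP[/andP[xA ->] _]; rewrite andbT; apply: contra xA => /eqP ->.
  rewrite IH ?filter_uniq //; last first.
    move=> e eW; rewrite mem_filter /= sW.
      by rewrite andbT; apply/negP => /(subsetP eW); rewrite !inE eqxx.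
    by apply: subset_trans eW _; exact: subD1set.
  have NN : #|(A :\ a) :|: N| = (#|A|.-1 + #|N|)%N.
    rewrite cardsU (_ : _ :&: _ = set0) ?cards0 ?subn0.
      by rewrite (cardsD1 a A) aA.
    apply/setP => x; rewrite !inE; case: (x \in A); rewrite ?andbF //.
  rewrite NN card_nbrs // -/N (cardsD W A) (setIidPr AW).
  congr expl; have := cardsD1 a W; rewrite (subsetP AW _ aA) => ->.
  have : (0 < #|A|)%N by apply/card_gt0P; exists a.
  by lia.
rewrite (Ex_count p (D := star a (W :\: A)) (fun m => expl k (#|A|.-1 + m)%N (#|W :\: A| - m)%N)) ?filter_uniq //.
  rewrite card_star // (cardsD W A) (setIidPr AW).
  have : (0 < #|A|)%N by apply/card_gt0P; exists a.
  by case: #|A|.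
move=> e; rewrite inE => /exists_inP[u]; rewrite inE => /andP[uA uW] /eqP eau.
rewrite mem_filter /P eau !inE eqxx /=; apply: sW; rewrite eau.
by apply/subsetP => x; rewrite !inE => /orP[]/eqP-> //; exact: (subsetP AW).
Qed.

Lemma Ex_component_of k v : Ex p (enum {: edge n}) (fun S => (#|component_of S v| == k)%:R) =
  expl k 1 n.-1.
Proof.
under eq_Ex do rewrite -reach_setT.
rewrite Ex_reach ?enum_uniq ?subsetT //; last by move=> e _; rewrite mem_enum.
by rewrite cards1 cardsT card_ord subn1.
Qed.

End Exploration.

(** * Poisson limit of the exploration *)

Section Poisson_limit.
Variable R : realType.
Implicit Types (x : R) (k j c m n u : nat).

Lemma near_prob_divn x : \forall n \near \oo, 0 <= x -> 0 <= x / n%:R <= 1.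
Proof.
near=> n => x0; rewrite divr_ge0 //=.
have n0 : 0 < n%:R :> R by rewrite ltr0n; near: n; exact: nbhs_infty_gt.
by rewrite ler_pdivrMr // mul1r; near: n; exact: nbhs_infty_ger.
Unshelve. all: by end_near. Qed.

Lemma cvg_divn x : x / n%:R @[n --> \oo] --> 0.
Proof.
rewrite -[X in _ --> X](mulr0 x); apply: cvgMr.
rewrite -cvg_shiftS; exact: cvg_harmonic.
Qed.

(** With y = x / n, exp (- y / (1 - y)) <= 1 - y <= exp (- y). *)
Lemma cvg_expR_pow x : 0 <= x -> (1 - x / n%:R) ^+ n @[n --> \oo] --> expR (- x).
Proof.
move=> x0.
have c : expR (- (x / (1 - x / n%:R))) @[n --> \oo] --> expR (- (x / (1 - 0))).
  apply: (@cvg_comp _ _ _ _ (@expR R) _ _ _ _ (@continuous_expR R _)).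
  apply: cvgN; apply: cvgMr; apply: cvgV; first by rewrite subr0 oner_neq0.
  by apply: cvgB; [exact: cvg_cst|exact: cvg_divn].
rewrite subr0 divr1 in c.
apply: (squeeze_cvgr _ c (cvg_cst (expR (- x)))); near=> n.
have n0 : 0 < n%:R :> R by rewrite ltr0n; near: n; exact: nbhs_infty_gt.
have xn : x < n%:R by near: n; exact: nbhs_infty_gtr.
have y1 : x / n%:R < 1 by rewrite ltr_pdivrMr // mul1r.
have y0 : 0 <= x / n%:R by rewrite divr_ge0 // ltW.
have xE : x = (x / n%:R) * n%:R by rewrite divfK // gt_eqF.
set y := x / n%:R in y0 y1 xE *; rewrite xE.
have -> : - (y * n%:R / (1 - y)) = (- (y / (1 - y))) * n%:R by ring.
have -> : - (y * n%:R) = (- y) * n%:R by ring.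
rewrite !expRM_natr; apply/andP; split; rewrite lerXn2r ?nnegrE ?expR_ge0 //; try lra.
  rewrite expRN -[leRHS]invrK lef_pV2 ?posrE ?expR_gt0 ?invr_gt0 ?subr_gt0 //.
  apply: le_trans (expR_ge1Dx _); rewrite le_eqVlt; apply/orP; left; apply/eqP.
  by field; lra.
by apply: le_trans (expR_ge1Dx _); lra.
Unshelve. all: by end_near. Qed.

Lemma cvg_bin_pow c m : 'C(n - c, m)%:R / n%:R ^+ m @[n --> \oo] --> (m`!%:R^-1 : R).
Proof.
have key : ((n - c) ^_ m)%:R / n%:R ^+ m @[n --> \oo] --> (1 : R).
  elim: m => [|m IH].
    rewrite (_ : (fun n => _) = (fun=> 1)); first exact: cvg_cst.
    by apply/funext => n; rewrite ffactn0 expr0 divr1.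
  rewrite (_ : (fun n => _) = (fun n => ((n - c) ^_ m)%:R / n%:R ^+ m *
     ((n - c - m)%N%:R / n%:R))); last first.
    by apply/funext => n; rewrite ffactnSr natrM exprSr invfM mulrACA.
  rewrite -[X in _ --> X]mulr1; apply: cvgM IH _.
  have h : 1 - (c + m)%:R / n%:R @[n --> \oo] --> (1 - 0 : R).
    by apply: cvgB; [exact: cvg_cst|exact: cvg_divn].
  rewrite subr0 in h; apply: cvg_trans h; apply: near_eq_cvg; near=> n.
  have n0 : 0 < n%:R :> R by rewrite ltr0n; near: n; exact: nbhs_infty_gt.
  have cn : (c + m <= n)%N by near: n; exact: nbhs_infty_ge.
  rewrite -subnDA natrB // mulrBl divff // gt_eqF //.
rewrite -[X in _ --> X]mul1r.
rewrite (_ : (fun n => _) = (fun n => ((n - c) ^_ m)%:R / n%:R ^+ m * m`!%:R^-1)).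
  by apply: cvgM key _; exact: cvg_cst.
apply/funext => n; rewrite -bin_ffact natrM mulrAC; congr (_ / _).
by rewrite mulfK // pnatr_eq0 -lt0n fact_gt0.
Unshelve. all: by end_near. Qed.

Lemma expl_small (p : R) k j u : (k < j)%N -> expl p k j u = 0.
Proof.
elim: k j u => [|k IH] [|j] //= u kj.
rewrite BnE big1 // => m _; rewrite IH ?mulr0 //; lia.
Qed.

Lemma explS (p : R) k j u : expl p k.+1 j.+1 u =
  \sum_(m < k.+1) 'C(u, m)%:R * p ^+ m * (1 - p) ^+ (u - m) * expl p k (j + m) (u - m).
Proof.
pose F m := 'C(u, m)%:R * p ^+ m * (1 - p) ^+ (u - m) * expl p k (j + m) (u - m).
rewrite /= BnE -/(F _).
rewrite -(@sum_ord_stable _ F k.+1 (k.+1 + u.+1)) ?leq_addr //; last first.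
  by move=> m km; rewrite /F expl_small ?mulr0 //; lia.
rewrite -(@sum_ord_stable _ F u.+1 (k.+1 + u.+1)) ?leq_addl // => m Mm.
by rewrite /F bin_small ?mul0r.
Qed.

(** Each step replaces a binomial probability by its Poisson limit. Shifting n by
c makes the statement stable under the loss of untouched vertices. *)
Lemma expl_cvg x k j c : 0 <= x ->
  expl (x / n%:R) k j (n - c) @[n --> \oo] --> progeny x k j.
Proof.
move=> x0; elim: k j c => [|k IH] [|j] c; try exact: cvg_cst.
rewrite (@progenyS _ _ _ _ k.+1) ?ltn_addl //.
under eq_fun do rewrite explS.
apply: cvg_sumr => m _; apply: cvgM; last first.
  by under eq_fun do rewrite -subnDA; exact: IH.
have e1 : ('C(n - c, m)%:R / n%:R ^+ m) * (x ^+ m) * ((1 - x / n%:R) ^+ n / (1 - x / n%:R) ^+ (c + m))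
   @[n --> \oo] --> m`!%:R^-1 * x ^+ m * (expR (- x) / (1 - 0) ^+ (c + m)).
  apply: cvgM; first by apply: cvgM; [exact: cvg_bin_pow|exact: cvg_cst].
  apply: cvgM; first exact: cvg_expR_pow.
  apply: cvgV; first by rewrite subr0 expr1n oner_neq0.
  apply: cvg_exprn_fun.
  by apply: cvgB; [exact: cvg_cst|exact: cvg_divn].
rewrite subr0 expr1n divr1 in e1.
have -> : pois x m = m`!%:R^-1 * x ^+ m * expR (- x) by rewrite /pois; ring.
apply: cvg_trans e1; apply: near_eq_cvg; near=> n.
have n0 : 0 < n%:R :> R by rewrite ltr0n; near: n; exact: nbhs_infty_gt.
have cn : (c + m <= n)%N by near: n; exact: nbhs_infty_ge.
have xn : x < n%:R by near: n; exact: nbhs_infty_gtr.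
have y1 : x / n%:R < 1 by rewrite ltr_pdivrMr // mul1r.
have -> : (n - c - m)%N = (n - (c + m))%N by rewrite subnDA.
rewrite expfB_cond //.
  by rewrite expr_div_n; ring.
by rewrite gt_eqF ?add0n //; lra.
Unshelve. all: by end_near. Qed.

End Poisson_limit.

(** * Number of components of a binomial random graph *)

Section Component_count.
Variable R : realType.
Implicit Types (x p e t : R) (n k K N : nat).

(** The mean over the binomial random graph on n vertices. *)
Definition ExG p n (g : {set edge n} -> R) : R := Ex p (enum {: edge n}) g.
Arguments ExG : clear implicits.

(** Truncation of 1 / c costs at most 1 / (K + 1), uniformly in c. *)
Lemma inv_approx c K : (0 < c)%N ->
  `|c%:R^-1 - \sum_(1 <= k < K.+1) (c == k)%:R / k%:R| <= K.+1%:R^-1 :> R.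
Proof.
move=> c0; have [cK|cK] := leqP c K.
  rewrite (bigD1_seq c) ?iota_uniq //=; last by rewrite mem_index_iota c0.
  rewrite eqxx mul1r big1 ?addr0 ?subrr ?normr0 ?invr_ge0 // => k kc.
  by rewrite eq_sym (negbTE kc) mul0r.
rewrite big_nat_cond big1 ?subr0 => [|k /andP[/andP[_ kK] _]].
  by rewrite ger0_norm ?invr_ge0 // lef_pV2 ?posrE ?ltr0n // ler_nat.
by rewrite gtn_eqF ?mul0r // (leq_trans kK).
Qed.

Lemma Ex_kappa_approx p n K : 0 <= p <= 1 -> (0 < n)%N ->
  `|ExG p n (kappa R (n:=n)) / n%:R - \sum_(1 <= k < K.+1) expl p k 1 n.-1 / k%:R|
    <= K.+1%:R^-1.
Proof.
move=> p01 n0; have nR : n%:R != 0 :> R by rewrite pnatr_eq0 -lt0n.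
pose g v (S : {set edge n}) : R := (#|component_of S v|%:R)^-1
  - \sum_(1 <= k < K.+1) (#|component_of S v| == k)%:R / k%:R.
have -> : ExG p n (kappa R (n:=n)) / n%:R - \sum_(1 <= k < K.+1) expl p k 1 n.-1 / k%:R
    = n%:R^-1 * \sum_v ExG p n (g v).
  have gE v : ExG p n (g v) = ExG p n (fun S => (#|component_of S v|%:R)^-1)
      - \sum_(1 <= k < K.+1) expl p k 1 n.-1 / k%:R.
    rewrite /ExG /g.
    rewrite (@eq_Ex _ _ _ _ _ (fun S => (#|component_of S v|%:R)^-1 + (-1) *
       \sum_(1 <= k < K.+1) (k%:R^-1 * (#|component_of S v| == k)%:R))).
      rewrite ExD ExZ mulN1r Ex_sum; congr (_ - _); apply: eq_bigr => k _.
      by rewrite ExZ Ex_component_of mulrC.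
    move=> S; rewrite mulN1r; congr (_ - _); apply: eq_bigr => k _; exact: mulrC.
  rewrite (eq_bigr _ (fun v _ => gE v)).
  rewrite big_split /= -Ex_sum sumr_const card_ord mulrDr.
  congr (_ + _); [by rewrite mulrC|by rewrite -(mulr_natl (- _)) mulKf].
rewrite normrM ger0_norm ?invr_ge0 // -ler_pdivlMl ?invr_gt0 ?ltr0n // invrK.
apply: le_trans (ler_norm_sum _ _ _) _.
have -> : n%:R * K.+1%:R^-1 = \sum_(v < n) K.+1%:R^-1 :> R.
  by rewrite sumr_const card_ord mulr_natl.
apply: ler_sum => v _; apply: le_trans (ler_norm_Ex p01 _ _) _.
rewrite -[leRHS](Ex_cst p (enum {: edge n})); apply: le_Ex => // S.
by apply: inv_approx; exact: component_of_gt0.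
Qed.

(** After truncation at K only finitely many probabilities are left, and these
converge; the truncation errors are at most 1 / (K + 1), uniformly in n. *)
Lemma Ex_kappa_cvg x : 0 <= x ->
  ExG (x / n%:R) n (kappa R (n:=n)) / n%:R @[n --> \oo] --> (f x : R).
Proof.
move=> x0; apply/cvgrPdist_le => e e0.
pose K := Num.trunc (3 / e).
have Ke : K.+1%:R^-1 <= e / 3.
  have /truncn_itv/andP[_ h] : 0 <= 3 / e by rewrite divr_ge0 // ltW.
  by rewrite -[leRHS]invrK invf_div lef_pV2 ?posrE ?divr_gt0 ?ltr0n // ltW.
have c : \sum_(1 <= k < K.+1) expl (x / n%:R) k 1 (n - 1) / k%:R @[n --> \oo] --> fsum x K.+1.
  by apply: cvg_sumr => k _; apply: cvgM; [exact: expl_cvg|exact: cvg_cst].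
have e3 : 0 < e / 3 by rewrite divr_gt0.
have /cvgrPdist_le/(_ _ e3) c' := c.
near=> n.
have n0 : (0 < n)%N by near: n; exact: nbhs_infty_gt.
have p01 : 0 <= x / n%:R <= 1.
  have : 0 <= x -> 0 <= x / n%:R <= 1 by near: n; exact: near_prob_divn.
  exact.
have h1 := Ex_kappa_approx K p01 n0.
have h2 := f_fsum K x0.
have h3 : `|fsum x K.+1 - \sum_(1 <= k < K.+1) expl (x / n%:R) k 1 n.-1 / k%:R| <= e / 3.
  by rewrite -subn1; near: n.
move: h1 h2 h3; rewrite !ler_norml.
move: (\sum_(_ <= _ < _) _) (fsum _ _) (f x) (ExG _ _ _ / _) => a b c1 d1.
move: (K.+1%:R^-1) Ke => k1 Ke /andP[? ?] /andP[? ?] /andP[? ?].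
apply/andP; split; lra.
Unshelve. all: by end_near. Qed.

Lemma card_edge n : (#|{: edge n}| <= n ^ 2)%N.
Proof.
rewrite card_sub (_ : #|_| = 'C(n, 2)).
  have h : (n * n.-1 <= n ^ 2)%N by rewrite -mulnn leq_mul // leq_pred.
  rewrite bin2 (leq_trans _ h) // -[leqRHS]odd_double_half -addnn; lia.
by rewrite -[in RHS](card_ord n) -card_draws; apply: eq_card => A; rewrite !inE.
Qed.

(** An edge changes kappa by at most 1, and there are at most n ^ 2 edges. *)
Lemma kappa_variance p n : 0 <= p <= 1 ->
  ExG p n (fun S => kappa R S ^+ 2) - ExG p n (kappa R (n:=n)) ^+ 2
    <= n%:R ^+ 2 * p.
Proof.
move=> p01; have /andP[p0 p1] := p01.
apply: le_trans (Ex_variance p01 _ _) _.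
  move=> e S; have [[a b] /= ab eab] := edge_ends e.
  rewrite (kappa_setU1 _ _ eab) addrC addKr normrN.
  by case: connect; rewrite ?normr0 ?normr1.
rewrite -cardE -natrX; apply: ler_pM => //.
- by rewrite mulr_ge0 // subr_ge0.
- by rewrite ler_nat card_edge.
- by rewrite ler_piMr // gerBl.
Qed.

(** With p = x / n, the variance of kappa is at most n x, negligible with respect
to n ^ 2. *)
Lemma kappa_LLN x e : 0 <= x -> 0 < e -> exists N, forall n, (N <= n)%N ->
  ExG (x / n%:R) n (fun S => `|kappa R S / n%:R - f x|) <= e.
Proof.
move=> x0 e0; have e3 : 0 < e / 3 by rewrite divr_gt0.
have /cvgrPdist_le/(_ _ e3) c := Ex_kappa_cvg x0.
suff [N _ HN] : \forall n \near \oo,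
    ExG (x / n%:R) n (fun S => `|kappa R S / n%:R - f x|) <= e.
  by exists N => n Nn; exact: HN.
near=> n.
have n0 : (0 < n)%N by near: n; exact: nbhs_infty_gt.
have nR : 0 < n%:R :> R by rewrite ltr0n.
have p01 : 0 <= x / n%:R <= 1.
  have : 0 <= x -> 0 <= x / n%:R <= 1 by near: n; exact: near_prob_divn.
  exact.
set p := x / n%:R in p01 *; set m := ExG p n (kappa R (n:=n)).
have mf : `|m / n%:R - f x| <= e / 3.
  by rewrite distrC /m /p; near: n; exact: c.
(* The variance enters through |y| <= a + y ^ 2 / a, which replaces the
   Cauchy-Schwarz inequality. *)
pose a := e / 3; have a0 : 0 < a by [].
apply: (@le_trans _ _ (ExG p n (fun S => (a + `|m / n%:R - f x|) +
    (a^-1 / n%:R ^+ 2) * (kappa R S ^+ 2 + ((- (2 * m)) * kappa R S + m ^+ 2))))).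
  apply: le_Ex => // S.
  have -> : kappa R S / n%:R - f x = (kappa R S - m) / n%:R + (m / n%:R - f x).
    by rewrite mulrBl addrA subrK.
  apply: le_trans (ler_normD _ _) _; rewrite addrAC lerD2r.
  have -> : a^-1 / n%:R ^+ 2 * (kappa R S ^+ 2 + ((- (2 * m)) * kappa R S + m ^+ 2))
     = ((kappa R S - m) / n%:R) ^+ 2 / a.
    by rewrite expr_div_n; ring.
  move: ((kappa R S - m) / n%:R) => y.
  rewrite -[y ^+ 2]real_normK ?num_real //; move: `|y| (normr_ge0 y) => z z0.
  have [za|az] := leP z a; first by rewrite ler_wpDr // mulr_ge0 ?exprn_ge0 ?invr_ge0 // ltW.
  apply: ler_wpDl; first exact: ltW.
  by rewrite ler_pdivlMr // expr2 ler_wpM2l // ltW.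
rewrite /ExG !(ExD, ExZ, Ex_cst) -/(ExG p n _) -/(ExG p n (kappa R (n:=n))) -/m.
have v := @kappa_variance p n p01; rewrite -/m in v.
set M2 := ExG p n _ in v *.
have w : a^-1 / n%:R ^+ 2 * (M2 + (- (2 * m) * m + m ^+ 2)) <= a^-1 * p.
  rewrite -mulrA ler_wpM2l ?invr_ge0 ?(ltW a0) // ler_pdivrMl ?exprn_gt0 //.
  by apply: le_trans v; rewrite le_eqVlt; apply/orP; left; apply/eqP; ring.
have pn : p <= a * (e / 3).
  by rewrite /p ler_pdivrMr // -ler_pdivrMl ?mulr_gt0 //; near: n; exact: nbhs_infty_ger.
have w2 : a^-1 * p <= e / 3 by rewrite ler_pdivrMl.
apply: le_trans (lerD (lerD (lexx a) mf) w) _.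
have : a = e / 3 by []. move: (a^-1 * p) w2 => z ? ->; lra.
Unshelve. all: by end_near. Qed.

(** As long as at least m vertices are untouched, the mean of t ^ (number of new
active vertices) is at most t, so that t ^ (number of active vertices) is a
supermartingale. It is 1 when the exploration stops, hence a stop within the
first K steps has probability at most t ^ j. *)
Lemma expl_sum_le p t m K j u : 0 <= p <= 1 -> 0 <= t ->
  (1 - p + p * t) ^+ m <= t -> t <= 1 -> (m + K <= j + u)%N ->
  \sum_(k < K.+1) expl p k j u <= t ^+ j.
Proof.
move=> p01 t0 pt t1; have /andP[p0 p1] := p01; elim: K j u => [|K IH] [|j] u mK.
- by rewrite big_ord1 expr0.
- by rewrite big_ord1 exprn_ge0.
- by rewrite big_ord_recl /= big1 ?addr0 ?expr0.
rewrite big_ord_recl /= add0r.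
have [jK|Kj] := leqP j K; last first.
  rewrite big1 ?exprn_ge0 // => k _.
  by apply: (@expl_small _ p (lift ord0 k) j.+1 u); rewrite /= /bump /=; have := ltn_ord k; lia.
have -> : \sum_(i < K.+1) Bn p u (fun m0 => expl p i (j + m0) (u - m0)) =
   Bn p u (fun m0 => \sum_(i < K.+1) expl p i (j + m0) (u - m0)).
  move: K.+1 (fun i m0 : nat => expl p i (j + m0)%N (u - m0)%N) => M G.
  elim: M => [|M IHM].
    rewrite big_ord0 -[LHS](mul0r ((1 - p + p * 1) ^+ u)) -Bn_expr.
    by apply: eq_Bn => m0 _; rewrite big_ord0 mul0r.
  rewrite big_ord_recr IHM [LHS]/= -BnD; apply: eq_Bn => m0 _.
  by rewrite big_ord_recr.
apply: (@le_trans _ _ (Bn p u (fun m0 => t ^+ j * t ^+ m0))).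
  by apply: le_Bn => // m0 mu; rewrite -exprD IH //; lia.
rewrite Bn_expr exprSr ler_wpM2l ?exprn_ge0 // (le_trans _ pt) //.
have um : (m <= u)%N by lia.
by rewrite ler_wiXn2l //; nra.
Qed.

(** At most one component has more than n / 2 vertices, and it contributes at
most 1 to kappa. Every other component contributes at most its number of
vertices. *)
Lemma kappa_small n (S : {set edge n}) : (0 < n)%N -> kappa R S - 1 <=
  \sum_v \sum_(k < n./2.+1) (#|component_of S v| == k)%:R.
Proof.
move=> n0.
have -> : \sum_v \sum_(k < n./2.+1) (#|component_of S v| == k)%:R =
    \sum_v ((#|component_of S v| <= n./2)%N%:R : R).
  apply: eq_bigr => v _; rewrite -natr_sum; congr (_%:R).
  have [cs|cb] := leqP _ n./2; last first.
    by rewrite big1 // => k _; rewrite gtn_eqF // (leq_trans _ cb).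
  rewrite (bigD1 (Ordinal (cs : (#|component_of S v| < n./2.+1)%N))) //= eqxx big1 // => k.
  by move=> /eqP kc; case: eqP => // h; case: kc; apply/val_inj.
pose big (v : 'I_n) := (n./2 < #|component_of S v|)%N.
have bigle : \sum_(v | big v) (#|component_of S v|%:R)^-1 <= 1 :> R.
  case: (pickP big) => [v0 bv0|nb]; last by rewrite big_pred0.
  apply: (@le_trans _ _ (\sum_(w in component_of S v0) (#|component_of S w|%:R)^-1));
    last by rewrite sum_component_of.
  rewrite big_mkcond [leRHS]big_mkcond; apply: ler_sum => v _ /=.
  case: (boolP (big v)) => [bv|_]; last by case: ifP.
  rewrite (_ : v \in component_of S v0) //; apply/negPn/negP => vv0.
  have d : fintype.disjoint (mem (component_of S v0)) (mem (component_of S v)).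
    apply/pred0P => w /=; apply/negbTE/negP => /andP[w0 wv]; move/negP: vv0; apply.
    by rewrite -(component_of_eq w0) (component_of_eq wv) component_of_refl.
  have le_n : (#|component_of S v0| + #|component_of S v| <= n)%N.
    rewrite -[leqRHS](card_ord n) -cardUI (eqP d) addn0; exact: max_card.
  rewrite /big in bv0 bv; have := odd_double_half n; rewrite -addnn; lia.
rewrite /kappa (bigID big) /= lerBlDl; apply: lerD => //.
rewrite big_mkcond; apply: ler_sum => v _ /=.
rewrite /big -leqNgt; case: leqP => // _.
by rewrite invf_le1 ?ler1n ?ltr0n component_of_gt0.
Qed.

(** While at most n / 2 vertices have been reached, the other half is untouched, so
[expl_sum_le] applies with t = exp (- n p / 4) provided t <= 1 / 2. Otherwise the
bound is trivial, because kappa is at most n. *)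
Lemma kappa_tail p n : 0 <= p <= 1 -> (0 < n)%N ->
  ExG p n (fun S => kappa R S - 1) <= n%:R * (2 * expR (- (n%:R * p / 4))).
Proof.
move=> p01 n0; have /andP[p0 p1] := p01.
set t := expR _; have t0 : 0 <= t := expR_ge0 _.
have tE : t = expR (- (n%:R * p / 4)) by [].
have [th|th] := leP t 2^-1; last first.
  rewrite -[leRHS](Ex_cst p (enum {: edge n})); apply: le_Ex => // S.
  rewrite (le_trans (_ : _ <= n%:R)) ?ler_peMr //; last lra.
  by have := kappa_le_vertices R S; lra.
apply: (@le_trans _ _ (\sum_(v < n) \sum_(k < n./2.+1) expl p k 1 n.-1)).
  under eq_bigr => v _ do under eq_bigr => k _ do rewrite -(Ex_component_of p k v).
  under eq_bigr => v _ do rewrite -Ex_sum.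
  by rewrite -Ex_sum; apply: le_Ex => // S; exact: kappa_small.
rewrite sumr_const card_ord -[leLHS]mulr_natl ler_wpM2l //.
apply: (@le_trans _ _ (t ^+ 1)); last by rewrite expr1; lra.
apply: (@expl_sum_le _ _ (n - n./2)%N) => //.
- have e1 : 1 - p + p * t <= expR (- (p * (1 - t))).
    by apply: le_trans (expR_ge1Dx _); rewrite le_eqVlt; apply/orP; left; apply/eqP; ring.
  apply: (@le_trans _ _ (expR (- (p * (1 - t))) ^+ (n - n./2))).
    by rewrite lerXn2r ?nnegrE ?expR_ge0 // addr_ge0 ?mulr_ge0 // subr_ge0.
  rewrite -expRM_natr [leRHS]tE ler_expR.
  have h : n%:R / 2 <= (n - n./2)%N%:R :> R.
    rewrite ler_pdivrMr // -natrM ler_nat.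
    by have := odd_double_half n; rewrite -addnn; lia.
  have h2 : 2^-1 * (n%:R / 2) <= (1 - t) * (n - n./2)%N%:R.
    by apply: ler_pM => //; lra.
  rewrite mulNr lerN2 -[leRHS]mulrA; apply: (le_trans _ (ler_wpM2l p0 h2)).
  by rewrite le_eqVlt; apply/orP; left; apply/eqP; field.
- by lra.
- by have := odd_double_half n; rewrite -addnn; lia.
Qed.

End Component_count.

(** * Law of the light edges in the coloured model *)

Section Finite_valued.
Context {R : realType} {d : measure_display} {Om : measurableType d}.
Variable P : probability Om R.
Context {T : finType} (Y : Om -> T).
Hypothesis mY : forall y, measurable (Y @^-1` [set y]).

Lemma measurable_fin_valued (Q : T -> Prop) : measurable [set w | Q (Y w)].
Proof.
have -> : [set w | Q (Y w)] = \bigcup_(y in Q) (Y @^-1` [set y]).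
  apply/seteqP; split=> w /=; first by move=> Qw; exists (Y w).
  by move=> [y Qy /= ->].
by apply: fin_bigcup_measurable => // ; exact: finite_finset.
Qed.

Lemma measurable_fun_fin_valued (D : set Om) (g : T -> R) :
  measurable D -> measurable_fun D (g \o Y).
Proof.
move=> mD _ B mB; apply: measurableI => //.
exact: (measurable_fin_valued (fun y => B (g y))).
Qed.

Lemma ge0_integral_fin_valued (D : set Om) (g : T -> R) : measurable D ->
  (forall y, 0 <= g y) ->
  (\int[P]_(w in D) (g (Y w))%:E = \sum_y (g y)%:E * P (Y @^-1` [set y] `&` D))%E.
Proof.
move=> mD g0.
under eq_integral => w _.
  rewrite (_ : (g (Y w))%:E = (\sum_y (g y * \1_(Y @^-1` [set y]) w)%:E)%E); last first.
    rewrite sumEFin (bigD1 (Y w)) //= big1 ?addr0 => [|y yY].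
      by rewrite indicE mem_set // mulr1.
    by rewrite indicE memNset ?mulr0 //= => /esym; exact/eqP.
  over.
rewrite ge0_integral_sum //; first last.
- by move=> y w _; rewrite lee_fin mulr_ge0.
- by move=> y; apply/measurable_EFinP/measurable_funM => //; exact: measurable_indic.
apply: eq_bigr => y _.
under eq_integral do rewrite EFinM.
rewrite ge0_integralZl //.
- by rewrite integral_indic.
- by apply/measurable_EFinP; exact: measurable_indic.
- by rewrite lee_fin.
Qed.

Lemma prob_fin_partition (D : set Om) : measurable D ->
  (P D = \sum_y P (Y @^-1` [set y] `&` D))%E.
Proof.
move=> mD; have := ge0_integral_fin_valued mD (fun=> ler01 : 0 <= (1 : R)).
rewrite integral_cst // mul1e => ->.
by apply: eq_bigr => y _; rewrite mul1e.
Qed.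

End Finite_valued.

Section Model_law.
Context {R : realType} {n : nat} {d : measure_display} {Om : measurableType d}.
Variable P : probability Om R.
Variables (X : edge n -> {RV P >-> R}) (red : edge n -> {RV P >-> bool}).
Hypothesis model : randomly_coloured_costs X red.
Implicit Types (t lam : R) (e : edge n).

(** The distribution function of the uniform law on [0, 1]. *)
Definition clamp t : R := Num.min (Num.max t 0) 1.

Lemma uniform_prob_le t : uniform_prob (@ltr01 R) `]-oo, t] = (clamp t)%:E.
Proof.
rewrite /uniform_prob integral_uniform_pdf.
rewrite (eq_integral (cst 1%E)); last first.
  move=> x; rewrite inE => -[_]; rewrite /= in_itv /= /uniform_pdf => ->.
  by rewrite subr0 invr1.
rewrite integral_cst ?mul1e; last exact: measurableI.
have -> : `]-oo, t]%classic `&` `[0, 1]%classic = `[0, Num.min t 1]%classic :> set R.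
  apply/seteqP; split=> x /=; rewrite !in_itv /= le_min.
    by move=> [-> /andP[-> ->]].
  by move=> /and3P[-> -> ->].
rewrite [LHS]lebesgue_measure_itv /= lte_fin /clamp.
have [t0|t0] := leP t 0.
  have t1 : t <= 1 by rewrite (le_trans t0).
  by rewrite (min_l t1) ltNge t0 /= min_l.
have [t1|t1] := leP t 1.
  by rewrite t0 sube0.
by rewrite ltr01 sube0.
Qed.

Lemma prob_X_le e t : P (X e @^-1` `]-oo, t]) = (clamp t)%:E.
Proof. by case: model => m1 _ _; rewrite -uniform_prob_le -(m1 e). Qed.

Lemma measurable_X e (A : set R) : measurable A -> measurable (X e @^-1` A).
Proof. by move=> mA; rewrite -[_ @^-1` A]setTI; exact: (@measurable_funPT _ _ _ _ (X e)). Qed.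

Lemma measurable_red e (A : set bool) : measurable (red e @^-1` A).
Proof. by rewrite -[_ @^-1` A]setTI; exact: (@measurable_funPT _ _ _ _ (red e)). Qed.

Lemma prob_X_gt e t : P (X e @^-1` (~` `]-oo, t])) = (1 - clamp t)%:E.
Proof.
rewrite preimage_setC probability_setC; last exact: (@measurable_X e `]-oo, t]%classic (measurable_itv _)).
by rewrite prob_X_le EFinB.
Qed.

Lemma prob_red e b : P (red e @^-1` [set b]) = (2^-1)%:E.
Proof.
case: model => _ m2 _.
have h : P (red e @^-1` [set true]) = (2^-1)%:E by exact: m2.
case: b => //; have -> : red e @^-1` [set false] = ~` (red e @^-1` [set true]).
  by apply/seteqP; split=> w /=; case: (red e w).
rewrite probability_setC; last exact: measurable_red.
by rewrite h -EFinB; congr (_%:E); lra.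
Qed.

Definition weight lam (w : Om) e : R := X e w + lam * (red e w)%:R.

(** The probability that an edge has penalised weight at most t. *)
Definition edge_prob lam t : R := (clamp t + clamp (t - lam)) / 2.

Lemma clamp01 t : 0 <= clamp t <= 1.
Proof. by rewrite /clamp le_min ge_min le_max !lexx ler01 !orbT. Qed.

Lemma edge_prob01 lam t : 0 <= edge_prob lam t <= 1.
Proof.
by have /andP[? ?] := clamp01 t; have /andP[? ?] := clamp01 (t - lam); rewrite /edge_prob; apply/andP; split; lra.
Qed.

Definition colours (w : Om) : {ffun edge n -> bool} := [ffun e => red e w].

Lemma measurable_colours (c : {ffun edge n -> bool}) :
  measurable (colours @^-1` [set c]).
Proof.
have -> : colours @^-1` [set c] = \bigcap_(e in setT) (red e @^-1` [set c e]).
  apply/seteqP; split=> w /=.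
    by move=> <- e _ /=; rewrite ffunE.
  by move=> h; apply/ffunP => e; rewrite ffunE; exact: h.
apply: fin_bigcap_measurable; first exact: finite_finset.
by move=> e _; exact: measurable_red.
Qed.

Definition low_event lam t (S : {set edge n}) (c : {ffun edge n -> bool}) e : set R :=
  if e \in S then `]-oo, t - lam * (c e)%:R]%classic else ~` `]-oo, t - lam * (c e)%:R].

(** For a given colouring, the light edges are described by one condition on
each cost, and independence applies to such events. *)
Lemma low_colours lam t S c :
  colours @^-1` [set c] `&` [set w | low (weight lam w) t = S] =
  \bigcap_(e in setT) (X e @^-1` low_event lam t S c e `&` red e @^-1` [set c e]).
Proof.
apply/seteqP; split=> w /=.
  move=> [cw <-] e _; have ce : red e w = c e by rewrite -cw ffunE.
  split=> //; rewrite /= /low_event inE /weight ce -lerBrDr.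
  by case: ifP => h; rewrite /= in_itv /= h.
move=> h; have cE : colours w = c by apply/ffunP => e; rewrite ffunE; case: (h e I).
split=> //; apply/setP => e; have [/= + ce] := h e I.
rewrite !inE /low_event /weight ce -lerBrDr.
by case: ifP => eS /=; rewrite in_itv /= ?eS // => /negP/negbTE.
Qed.

Lemma measurable_low_event lam t S c e : measurable (low_event lam t S c e).
Proof. by rewrite /low_event; case: ifP => _ //; exact: measurableC. Qed.

Lemma measurable_low lam t S : measurable [set w | low (weight lam w) t = S].
Proof.
have -> : [set w | low (weight lam w) t = S] =
    \bigcup_(c in setT) (colours @^-1` [set c] `&` [set w | low (weight lam w) t = S]).
  apply/seteqP; split=> w /=; first by move=> h; exists (colours w).
  by move=> [c _ []].
apply: fin_bigcup_measurable; first exact: finite_finset.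
move=> c _; rewrite low_colours; apply: fin_bigcap_measurable; first exact: finite_finset.
move=> e _; apply: measurableI; last exact: measurable_red.
exact: (@measurable_X e _ (measurable_low_event lam t S c e)).
Qed.

(** The light edges form a binomial random graph: summing the product of the
probabilities over all colourings is the same as averaging each factor over the
two colours. *)
Lemma prob_low lam t S : P [set w | low (weight lam w) t = S] =
  (\prod_e (if e \in S then edge_prob lam t else 1 - edge_prob lam t))%:E.
Proof.
rewrite (prob_fin_partition P measurable_colours (measurable_low lam t S)).
have PE c : P (colours @^-1` [set c] `&` [set w | low (weight lam w) t = S]) =
    (\prod_e (2^-1 * (if e \in S then clamp (t - lam * (c e)%:R)
                      else 1 - clamp (t - lam * (c e)%:R))))%:E.
  case: model => _ _ m3; rewrite low_colours m3;
    [|by move=> e; exact: measurable_low_event|by []].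
  rewrite -prodEFin; apply: eq_bigr => e _.
  rewrite prob_red /low_event EFinM [LHS]muleC; congr (_ * _)%E.
    by case: ifP => _; rewrite ?prob_X_le ?prob_X_gt.
rewrite (eq_bigr _ (fun c _ => PE c)).
rewrite sumEFin; congr (_%:E).
rewrite -(bigA_distr_bigA (fun e (b : bool) => 2^-1 * (if e \in S then clamp (t - lam * b%:R)
                      else 1 - clamp (t - lam * b%:R)))).
apply: eq_bigr => e _; rewrite big_bool /= /edge_prob mulr1 mulr0 subr0.
by case: ifP => _; lra.
Qed.

End Model_law.

(** * Expectations over the coloured model *)

Section Ex_as_sum.
Import mathcomp.boot.fintype mathcomp.boot.finset.
Local Open Scope set_scope.
Local Open Scope ring_scope.
Variables (R : realType) (E : finType) (p : R).

Lemma Ex_sum_sets (s : seq E) (g : {set E} -> R) : uniq s -> Ex p s g =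
  \sum_(S : {set E} | S \subset s) (\prod_(e <- s) (if e \in S then p else 1 - p)) * g S.
Proof.
elim: s g => [|e s IH] g /=.
  move=> _; rewrite (bigD1 set0) /=; last by apply/subsetP => e; rewrite inE.
  rewrite big_nil mul1r big1 ?addr0 // => S /andP[/subsetP S0 /eqP]; case.
  by apply/setP => e; rewrite inE; apply/negP => /S0.
move=> /andP[es us]; rewrite !IH // [RHS](bigID (fun S : {set E} => e \in S)) /=.
congr (_ + _).
  rewrite [RHS](reindex_onto (fun S : {set E} => e |: S) (fun S => S :\ e)) /=; last first.
    by move=> S /andP[_ eS]; rewrite setD1K.
  rewrite mulr_sumr; apply: eq_big => [S|S Ss].
    apply/idP/idP => [/subsetP Ss|].
      rewrite setU11 andbT; apply/andP; split.
        by apply/subsetP => x; rewrite in_setU1 inE => /predU1P[->|/Ss ->]; rewrite ?eqxx ?orbT.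
      by rewrite setU1K //; apply: contra es => /Ss.
    move=> /andP[/andP[/subsetP Ss _] /eqP SE]; apply/subsetP => x xS.
    have := Ss x; rewrite in_setU1 xS orbT inE => /(_ isT) /predU1P[xe|//].
    by move: xS; rewrite -SE xe !inE eqxx.
  rewrite big_cons setU11 mulrA; congr (_ * _ * _).
  rewrite big_seq [RHS]big_seq; apply: eq_bigr => x xs.
  rewrite in_setU1; case: eqP => // xe; by rewrite xe (negbTE es) in xs.
rewrite mulr_sumr; apply: eq_big => [S|S Ss].
  apply/idP/idP => [/subsetP Ss|/andP[/subsetP Ss eS]].
    apply/andP; split; last by apply: contra es => /Ss.
    by apply/subsetP => x /Ss xs; rewrite inE xs orbT.
  apply/subsetP => x xS; have := Ss x xS; rewrite inE => /predU1P[xe|//].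
  by rewrite -xe xS in eS.
rewrite big_cons (_ : e \in S = false) ?mulrA //.
by apply/negbTE; apply: contra es => /(subsetP Ss).
Qed.

End Ex_as_sum.

Section Model_expectation.
Context {R : realType} {n : nat} {d : measure_display} {Om : measurableType d}.
Variable P : probability Om R.
Variables (X : edge n -> {RV P >-> R}) (red : edge n -> {RV P >-> bool}).
Hypothesis model : randomly_coloured_costs X red.
Implicit Types (t lam : R) (e : edge n).
Local Notation G lam t := (fun w => low (weight X red lam w) t).

Lemma measurable_low_preimage lam t S : measurable (G lam t @^-1` [set S]).
Proof. exact: measurable_low. Qed.

Lemma measurable_fun_low (D : set Om) lam t (g : {set edge n} -> R) : measurable D ->
  measurable_fun D (fun w => g (G lam t w)).
Proof. exact: (measurable_fun_fin_valued (measurable_low_preimage lam t)). Qed.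

Lemma integral_low lam t (g : {set edge n} -> R) : (forall S, 0 <= g S) ->
  (\int[P]_w (g (G lam t w))%:E = (ExG (edge_prob lam t) g)%:E)%E.
Proof.
move=> g0; rewrite (ge0_integral_fin_valued P (measurable_low_preimage lam t)) //.
rewrite /ExG Ex_sum_sets ?enum_uniq // -sumEFin.
rewrite [RHS]big_mkcond; apply: eq_bigr => S _.
rewrite setIT (_ : _ @^-1` [set S] = [set w | G lam t w = S]) // prob_low //.
rewrite (_ : (S \subset _) = true); last by apply/fintype.subsetP => e _; rewrite mem_enum.
by rewrite -EFinM mulrC big_enum.
Qed.

Lemma integral_sum_low (r : seq nat) lam (t : nat -> R) (g : nat -> {set edge n} -> R) :
  (forall i S, 0 <= g i S) ->
  (\int[P]_w (\sum_(i <- r) g i (G lam (t i) w))%:E =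
    (\sum_(i <- r) ExG (edge_prob lam (t i)) (g i))%:E)%E.
Proof.
move=> g0; under eq_integral do rewrite -sumEFin.
rewrite ge0_integral_sum //; first last.
- by move=> i w _; rewrite lee_fin.
- by move=> i; apply/measurable_EFinP; exact: measurable_fun_low.
by rewrite -sumEFin; apply: eq_bigr => i _; exact: integral_low.
Qed.

Lemma measurable_sum_low (D : set Om) (r : seq nat) lam (t : nat -> R)
    (g : nat -> {set edge n} -> R) : measurable D ->
  measurable_fun D (fun w => \sum_(i <- r) g i (G lam (t i) w)).
Proof. by move=> mD; apply: measurable_sum => i; exact: measurable_fun_low. Qed.

(** Markov's inequality for a sum over several thresholds. Its terms are
dependent, but only their means are used, and each of these is a mean over a
binomial random graph. *)
Lemma markov_sum_low (r : seq nat) lam (t : nat -> R) (g : nat -> {set edge n} -> R) (a : R) :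
  (forall i S, 0 <= g i S) -> 0 < a ->
  measurable [set w | a <= \sum_(i <- r) g i (G lam (t i) w)] /\
  (P [set w | (a <= \sum_(i <- r) g i (G lam (t i) w))%R] <=
    ((\sum_(i <- r) ExG (edge_prob lam (t i)) (g i)) / a)%:E)%E.
Proof.
move=> g0 a0; set A := [set w | _].
have mA : measurable A.
  have := @measurable_sum_low setT r lam t g measurableT measurableT `[a, +oo[%classic (measurable_itv _).
  by rewrite setTI (_ : _ @^-1` _ = A) //; apply/seteqP; split=> w; rewrite /A /= in_itv /= andbT.
split=> //; rewrite EFinM lee_pdivlMr //.
rewrite -integral_sum_low // muleC.
rewrite -(integral_cst P mA a%:E).
apply: (@le_trans _ _ (\int[P]_(w in A) (\sum_(i <- r) g i (G lam (t i) w))%:E)%E).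
  apply: ge0_le_integral => //.
  - by move=> w _; rewrite lee_fin ltW.
  - by apply/measurable_EFinP; exact: measurable_sum_low.
apply: ge0_subset_integral => //.
- by apply/measurable_EFinP; exact: measurable_sum_low.
- by move=> w _; rewrite lee_fin sumr_ge0.
Qed.

Lemma costs_in_unit_interval : measurable [set w | forall e, 0 <= X e w <= 1] /\
  P [set w | forall e, 0 <= X e w <= 1] = 1%E.
Proof.
have E : [set w | forall e, 0 <= X e w <= 1] =
   \bigcap_(e in setT) (X e @^-1` `[0, 1] `&` red e @^-1` setT).
  apply/seteqP; split=> w /=.
    by move=> h e _; rewrite /= in_itv; split=> //; exact: h.
  by move=> h e; have [/=] := h e I; rewrite in_itv.
rewrite E; split.
  apply: fin_bigcap_measurable; first exact: finite_finset.
  by move=> e _; apply: measurableI; [exact: (@measurable_X _ _ _ _ _ X e `[0, 1]%classic (measurable_itv _))|exact: measurable_red].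
case: model => m1 _ m3; rewrite m3 //.
rewrite big1 // => e _; rewrite preimage_setT probability_setT mule1.
have := m1 e `[0, 1]%classic (measurable_itv _); rewrite /distribution /= /pushforward => ->.
rewrite /uniform_prob integral_uniform_pdf1 //.
Qed.

End Model_expectation.

(** * Mean error over a mesh of thresholds *)

Section Tail_sums.
Variable R : realType.
Implicit Types (r p psi lam t u : R).

Lemma geometric_tail r m N : 0 <= r < 1 ->
  \sum_(m <= i < N) r ^+ i <= r ^+ m / (1 - r).
Proof.
move=> /andP[r0 r1]; rewrite ler_pdivlMr ?subr_gt0 //.
have [Nm|mN] := leqP N m; first by rewrite big_geq // mul0r exprn_ge0.
suff -> : (\sum_(m <= i < N) r ^+ i) * (1 - r) = r ^+ m - r ^+ N.
  by rewrite gerBl exprn_ge0.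
rewrite mulr_suml (eq_bigr (fun i => (- r ^+ i.+1) - (- r ^+ i))) => [|i _].
  by rewrite telescope_sumr ?(ltnW mN) //; ring.
by rewrite exprS; ring.
Qed.

(** If n p_i grows linearly in i, [kappa_tail] bounds the terms by a geometric
series, and the cutoff I depends on neither n nor N. *)
Lemma kappa_tail_sum (dl eta : R) : 0 < dl -> 0 < eta -> exists I : nat,
  forall (n N : nat) (p : nat -> R), (0 < n)%N ->
  (forall i, 0 <= p i <= 1) ->
  (forall i, (i < N.+1)%N -> i%:R * dl / 8 <= n%:R * p i) ->
  \sum_(I.+1 <= i < N.+1) ExG (p i) (fun S : {set edge n} => dl / n%:R * (kappa R S - 1)) <= eta.
Proof.
move=> dl0 eta0; pose r := expR (- (dl / 32)).
have r01 : 0 <= r < 1 by rewrite expR_ge0 expR_lt1 oppr_lt0 divr_gt0.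
have r1 : 0 < 1 - r by rewrite subr_gt0; case/andP: r01.
have := @cvg_expr R r; rewrite ger0_norm ?expR_ge0 // => /(_ _)/cvgrPdist_le.
have eta' : 0 < eta * (1 - r) / (2 * dl) by rewrite divr_gt0 // mulr_gt0.
case/andP: (r01) => _ r_lt1 /(_ r_lt1 _ eta')[I _ HI].
exists I => n N p n0 p01 pN; have nR : 0 < n%:R :> R by rewrite ltr0n.
apply: (@le_trans _ _ (\sum_(I.+1 <= i < N.+1) (2 * dl) * r ^+ i)).
  rewrite big_nat_cond [leRHS]big_nat_cond; apply: ler_sum => i /andP[/andP[_ iN] _].
  rewrite /ExG ExZ; apply: le_trans (ler_wpM2l _ (kappa_tail (p01 i) n0)) _.
    by rewrite divr_ge0 // ltW.
  have -> : dl / n%:R * (n%:R * (2 * expR (- (n%:R * p i / 4)))) =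
      2 * dl * expR (- (n%:R * p i / 4)).
    by field; rewrite gt_eqF.
  rewrite ler_pM2l ?mulr_gt0 // /r -expRM_natr ler_expR mulNr lerN2.
  by have := pN i iN; lra.
rewrite -mulr_sumr; apply: le_trans (ler_wpM2l _ (geometric_tail _ _ r01)) _.
  by rewrite mulr_ge0 // ltW.
have := HI I.+1 (leqnSn I); rewrite /= sub0r normrN ger0_norm ?exprn_ge0 ?expR_ge0 //.
rewrite ler_pdivlMr ?mulr_gt0 // => h.
by rewrite mulrA ler_pdivrMr // mulrC.
Qed.

Lemma edge_prob_small n psi u : (0 < n)%N -> 0 <= psi -> 0 <= u <= n%:R ->
  edge_prob (2 * psi / n%:R) (u / n%:R) = xpar psi u / n%:R.
Proof.
move=> n0 p0 /andP[u0 un]; have nR : 0 < n%:R :> R by rewrite ltr0n.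
have cl : clamp (u / n%:R) = u / n%:R.
  rewrite /clamp max_l ?divr_ge0 // min_l // ler_pdivrMr // mul1r //.
rewrite /edge_prob cl; have [up|up] := leP (u - 2 * psi) 0.
  have -> : clamp (u / n%:R - 2 * psi / n%:R) = 0.
    by rewrite -mulrBl /clamp max_r ?min_l // pmulr_lle0 ?invr_gt0.
  rewrite addr0 /xpar max_l; last lra.
  by ring.
have -> : clamp (u / n%:R - 2 * psi / n%:R) = (u - 2 * psi) / n%:R.
  rewrite -mulrBl /clamp max_l ?divr_ge0 ?(ltW up) // min_l // ler_pdivrMr // mul1r; lra.
rewrite /xpar max_r; last lra.
by field; rewrite gt_eqF.
Qed.

(** The blue edges suffice. The range up to 4 covers all thresholds of the
mesh, which goes slightly beyond the largest possible weight 2. *)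
Lemma edge_prob_ge lam t : 0 <= t <= 4 -> t / 8 <= edge_prob lam t.
Proof.
move=> /andP[t0 t4]; have /andP[c0 _] := clamp01 (t - lam).
suff : t / 4 <= clamp t by rewrite /edge_prob; lra.
by rewrite /clamp max_l // le_min; apply/andP; split; lra.
Qed.

End Tail_sums.

Section Minimum_tree.
Variable R : realType.
Implicit Types (psi dl e tau : R).

(** The limit of the least weight of a spanning tree when red edges are penalised
by 2 psi / n. *)
Definition mst_limit psi : R := zeta3 R + primF psi.

(** The bound N of the mesh is such that all weights, at most 2, are covered. Up to
the cutoff I there are finitely many thresholds, with one law of large numbers
for each; beyond it [kappa_tail_sum] applies. Both kinds of errors are put in
a single mean, to be used in a single Markov inequality. *)
Lemma mesh_mean psi dl e tau : 0 <= psi -> 0 < dl <= 1 -> 0 < e -> 0 < tau ->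
  exists I N0 : nat, forall n, (N0 <= n)%N ->
  let N := (Num.trunc (2 * n%:R / dl)).+1 in
  [/\ (0 < n)%N, 2 * psi <= n%:R, (I <= N)%N, I%:R * dl <= e * n%:R &
   `|\sum_(1 <= i < I.+1) dl * f (xpar psi (i%:R * dl)) - mst_limit psi| <= dl + e /\
   \sum_(1 <= i < N.+1) ExG (edge_prob (2 * psi / n%:R) (i%:R * (dl / n%:R)))
     (fun S : {set edge n} => if (i <= I)%N
       then dl * `|kappa R S / n%:R - f (xpar psi (i%:R * dl))|
       else dl / n%:R * (kappa R S - 1)) <= tau].
Proof.
move=> p0 /andP[d0 d1] e0 t0; have t2 : 0 < tau / 2 by rewrite divr_gt0.
have [I1 HI1] := riemann_lim p0 d0 e0.
have [I2 HI2] := kappa_tail_sum d0 t2.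
pose I := maxn I1 I2.
have /choice[K HK] : forall i : nat, exists N, forall n, (N <= n)%N ->
    ExG (xpar psi (i%:R * dl) / n%:R) (fun S : {set edge n} =>
      `|kappa R S / n%:R - f (xpar psi (i%:R * dl))|) <= tau / 2 / (dl * I.+1%:R).
  move=> i; apply: kappa_LLN; last by rewrite divr_gt0 // mulr_gt0.
  by rewrite xpar_ge0 // mulr_ge0 // ltW.
have [a1 a1E] : exists a, a = (Num.trunc (I%:R * dl / e)).+1 by eexists.
have [a2 a2E] : exists a, a = (Num.trunc (2 * psi)).+1 by eexists.
have [a3 a3E] : exists a, a = (\max_(i < I.+1) K i)%N by eexists.
pose N0 := (a3 + a1 + a2 + I.+1)%N.
have trunc_lt (a : R) m : 0 <= a -> ((Num.trunc a).+1 <= m)%N -> a <= m%:R.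
  move=> a0 am; have /truncn_itv/andP[_ h] := a0.
  by rewrite (le_trans (ltW h)) // ler_nat.
exists I, N0 => n N0n N.
have n0 : (0 < n)%N by rewrite /N0 in N0n; lia.
have nR : 0 < n%:R :> R by rewrite ltr0n.
have psin : 2 * psi <= n%:R.
  by apply: trunc_lt; [rewrite mulr_ge0|rewrite -a2E; rewrite /N0 in N0n; lia].
have In : I%:R * dl <= e * n%:R.
  rewrite -ler_pdivrMl // mulrC; apply: trunc_lt.
    by rewrite divr_ge0 ?mulr_ge0 // ltW.
  by rewrite -a1E; rewrite /N0 in N0n; lia.
have In1 : (I <= n)%N by rewrite /N0 in N0n; lia.
have IN : (I <= N)%N.
  apply: (leq_trans In1); rewrite /N leqW // truncn_ge_nat ?divr_ge0 ?mulr_ge0 // ?(ltW d0) //.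
  by rewrite ler_pdivlMr //; nra.
split=> //; split; first by apply: HI1; rewrite leq_maxl.
rewrite (@big_cat_nat _ _ _ I.+1) //= [leRHS]splitr; apply: lerD.
  apply: (@le_trans _ _ (\sum_(1 <= i < I.+1) dl * (tau / 2 / (dl * I.+1%:R)))).
    rewrite big_nat_cond [leRHS]big_nat_cond; apply: ler_sum => i /andP[/andP[_ iI] _].
    rewrite -ltnS iI /ExG ExZ ler_pM2l // mulrA edge_prob_small //; last first.
      rewrite mulr_ge0 ?(ltW d0) //=.
      have : i%:R <= n%:R :> R by rewrite ler_nat (leq_trans _ In1).
      by have := ler0n R i; nra.
    apply: HK; apply: leq_trans N0n; rewrite /N0 -!addnA; apply: (leq_trans _ (leq_addr _ _)).
    rewrite a3E; exact: (@leq_bigmax _ (fun i : 'I_I.+1 => K i) (Ordinal iI)).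
  rewrite sumr_const_nat subSS subn0 -[_ *+ I]mulr_natr.
  have -> : dl * (tau / 2 / (dl * I.+1%:R)) * I%:R = tau / 2 * (I%:R / I.+1%:R).
    by field; rewrite nat1r pnatr_eq0 /= gt_eqF.
  by rewrite ler_piMr ?(ltW t2) // ler_pdivrMr ?ltr0n // mul1r ler_nat.
pose p i := edge_prob (2 * psi / n%:R) (i%:R * (dl / n%:R)).
apply: (@le_trans _ _ (\sum_(I2.+1 <= i < N.+1) ExG (p i) (fun S : {set edge n} => dl / n%:R * (kappa R S - 1)))).
  have II2 : (I2.+1 <= I.+1)%N by rewrite ltnS leq_maxr.
  have pos i : 0 <= ExG (p i) (fun S : {set edge n} => dl / n%:R * (kappa R S - 1)).
    apply: Ex_ge0 => [|S]; first exact: edge_prob01.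
    by rewrite mulr_ge0 ?divr_ge0 ?(ltW d0) // subr_ge0 kappa_ge1.
  rewrite [leRHS](@big_cat_nat _ _ _ I.+1) //= ler_wpDl ?sumr_ge0 //.
  rewrite big_nat_cond [leRHS]big_nat_cond; apply: ler_sum => i /andP[/andP[Ii _] _].
  by rewrite leqNgt Ii.
apply: HI2 => // [i|i iN]; first exact: edge_prob01.
have h : (i%:R * (dl / n%:R)) / 8 <= p i.
  apply: edge_prob_ge; rewrite mulr_ge0 ?divr_ge0 ?(ltW d0) //= mulrA ler_pdivrMr //.
  have : i%:R <= N%:R :> R by rewrite ler_nat.
  have /truncn_itv/andP[h _] : 0 <= 2 * n%:R / dl by rewrite divr_ge0 ?mulr_ge0 ?(ltW d0).
  have n1 : 1 <= n%:R :> R by rewrite ler1n.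
  rewrite /N -natr1 => iN'; move: h; rewrite ler_pdivlMr // => h; nra.
rewrite -ler_pdivrMl //; apply: le_trans h.
by rewrite le_eqVlt; apply/orP; left; apply/eqP; field; rewrite gt_eqF.
Qed.

End Minimum_tree.

(** * Weight of a minimum spanning tree *)

Section Tree_events.
Variable R : realType.
Implicit Types (psi dl e tau : R).

(** The deterministic part of the estimate of the mesh sum. Replacing kap i - 1 by
kap i below the cutoff costs dl / n for each of the I terms, at most e in
all. *)
Lemma mesh_close n (kap phi : nat -> R) (L dl e : R) (I N : nat) :
  (0 < n)%N -> 0 < dl -> (I <= N)%N -> (forall i, 1 <= kap i) ->
  I%:R * dl <= e * n%:R ->
  `|\sum_(1 <= i < I.+1) dl * phi i - L| <= dl + e ->
  `|\sum_(1 <= i < N.+1) dl / n%:R * (kap i - 1) - L| <=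
  \sum_(1 <= i < N.+1) (if (i <= I)%N then dl * `|kap i / n%:R - phi i|
                        else dl / n%:R * (kap i - 1)) + e + (dl + e).
Proof.
move=> n0 d0 IN k1 In HL; have nR : 0 < n%:R :> R by rewrite ltr0n.
have -> : \sum_(1 <= i < N.+1) dl / n%:R * (kap i - 1) - L =
   (\sum_(1 <= i < N.+1) dl / n%:R * (kap i - 1) - \sum_(1 <= i < I.+1) dl * phi i)
   + (\sum_(1 <= i < I.+1) dl * phi i - L) by rewrite addrA subrK.
apply: le_trans (ler_normD _ _) _; apply: lerD => //.
rewrite !(@big_cat_nat _ _ _ I.+1 1 N.+1) //= addrAC -sumrB addrAC.
apply: le_trans (ler_normD _ _) _; apply: lerD; last first.
  rewrite ger0_norm; last first.
    by apply: sumr_ge0 => i _; rewrite mulr_ge0 ?divr_ge0 ?subr_ge0 // ltW.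
  rewrite big_nat_cond [leRHS]big_nat_cond; apply: ler_sum => i /andP[/andP[Ii _] _].
  by rewrite leqNgt Ii.
apply: le_trans (ler_norm_sum _ _ _) _.
apply: (@le_trans _ _ (\sum_(1 <= i < I.+1) (dl * `|kap i / n%:R - phi i| + dl / n%:R))).
  apply: ler_sum => i _.
  have -> : dl / n%:R * (kap i - 1) - dl * phi i = dl * (kap i / n%:R - phi i) - dl / n%:R by ring.
  apply: le_trans (ler_normB _ _) _.
  by rewrite normrM (gtr0_norm d0) (gtr0_norm (divr_gt0 d0 nR)).
rewrite big_split /=; apply: lerD; last first.
  rewrite sumr_const_nat subSS subn0 -[_ *+ I]mulr_natl mulrA ler_pdivrMr //.
rewrite big_nat_cond [leRHS]big_nat_cond; apply: ler_sum => i /andP[/andP[_ iI] _].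
by rewrite -ltnS iI.
Qed.

(** The exceptional event B is that the sum of errors of [mesh_mean] is
large. Outside it the mesh sum is close to [mst_limit], and it bounds the weights
of all connected graphs from below and that of the greedy tree from above. *)
Lemma mst_event psi e tau : 0 <= psi -> 0 < e -> 0 < tau ->
  exists N0 : nat, forall n, (N0 <= n)%N ->
  forall (d : measure_display) (Om : measurableType d) (P : probability Om R)
    (X : edge n -> {RV P >-> R}) (red : edge n -> {RV P >-> bool}),
  randomly_coloured_costs X red ->
  exists B : set Om, [/\ measurable B, (P B <= tau%:E)%E &
    forall w, (forall u : edge n, 0 <= X u w <= 1) -> ~ B w ->
    (forall T, connected_graph T ->
       mst_limit psi - e <= \sum_(u in T) weight X red (2 * psi / n%:R) w u) /\
    (exists2 T, spanning_tree T &
       \sum_(u in T) weight X red (2 * psi / n%:R) w u <= mst_limit psi + e)].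
Proof.
move=> p0 e0 t0; pose dl := Num.min 1 (e / 8); pose a := e / 8.
have a0 : 0 < a by rewrite divr_gt0.
have d01 : 0 < dl <= 1 by rewrite /dl lt_min ltr01 divr_gt0 //= ge_min lexx.
have d0 : 0 < dl by case/andP: d01.
have da : dl <= a by rewrite /dl ge_min lexx orbT.
have at0 : 0 < tau * a by rewrite mulr_gt0.
have [I [N0 HN0]] := mesh_mean p0 d01 a0 at0.
exists N0 => n Nn d Om P X red model.
have [n0 pn IN In [HL HE]] := HN0 n Nn.
set N := (Num.trunc (2 * n%:R / dl)).+1 in IN HE *.
set lam := 2 * psi / n%:R in HE *; pose h := dl / n%:R.
have nR : 0 < n%:R :> R by rewrite ltr0n.
have h0 : 0 < h by rewrite divr_gt0.
pose g i (S : {set edge n}) := if (i <= I)%N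
       then dl * `|kappa R S / n%:R - f (xpar psi (i%:R * dl))|
       else dl / n%:R * (kappa R S - 1).
have g0 i S : 0 <= g i S.
  rewrite /g; case: ifP => _; first by rewrite mulr_ge0 // ltW.
  by rewrite mulr_ge0 ?(ltW h0) // subr_ge0 kappa_ge1.
have [mB PB] := markov_sum_low model (index_iota 1 N.+1) lam (fun i => i%:R * h) g0 a0.
exists [set w | a <= \sum_(1 <= i < N.+1) g i (low (weight X red lam w) (i%:R * h))].
split=> //.
  apply: le_trans PB _; rewrite lee_fin ler_pdivrMr //.
move=> w X01w /negP; rewrite -ltNge => Bw.
have W0 : forall u, 0 <= weight X red lam w u.
  move=> e'; rewrite /weight addr_ge0 ?mulr_ge0 ?divr_ge0 ?mulr_ge0 //.
  by case/andP: (X01w e').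
have WN : forall u, 0 <= weight X red lam w u <= N%:R * h.
  move=> e'; rewrite W0 /=; apply: (@le_trans _ _ 2).
    have /andP[_ X1] := X01w e'.
    have l1 : lam <= 1 by rewrite /lam ler_pdivrMr // mul1r.
    have l0 : 0 <= lam by rewrite /lam divr_ge0 ?mulr_ge0.
    rewrite /weight; case: (red e' w) => /=; lra.
  have /truncn_itv/andP[_ hN] : 0 <= 2 * n%:R / dl by rewrite divr_ge0 ?mulr_ge0 ?(ltW d0).
  by rewrite /h mulrA ler_pdivlMr // -ler_pdivrMr // ltW.
have close := mesh_close (kap := fun i => kappa R (low (weight X red lam w) (i%:R * h)))
   (phi := fun i => f (xpar psi (i%:R * dl))) n0 d0 IN (fun i => kappa_ge1 _ _ n0) In HL.
have {}close : `|\sum_(1 <= i < N.+1) h * (kappa R (low (weight X red lam w) (i%:R * h)) - 1)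
    - mst_limit psi| <= 4 * a.
  apply: le_trans close _.
  have -> : 4 * a = a + a + (a + a) by ring.
  by rewrite !lerD // ltW.
move: close; rewrite ler_norml.
set D := \sum_(_ <= _ < _) _ => /andP[D1 D2].
have ae : e = 8 * a by rewrite /a; field.
split.
  move=> T cT; apply: (@le_trans _ _ D).
    move: (mst_limit psi) D1 => L; lra.
  exact: connected_cost_ge.
have [T [sT cT _]] := exists_light_tree n0 h0 WN.
exists T => //; apply: le_trans cT _; rewrite -/D.
have -> : n%:R * h = dl by rewrite /h mulrC divfK // gt_eqF.
move: (mst_limit psi) D2 => L; lra.
Qed.

End Tree_events.

(** * The constrained optimum as a random variable *)

Section Optimum_facts.
Variables (R : realType) (alpha : R) (n : nat).
Variables (cost : edge n -> R) (red : edge n -> bool) (z0 : R).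

Lemma min_tree_costP :
  ((forall T, ~ feasible alpha red T) /\ min_tree_cost alpha cost red z0 = z0) \/
  exists2 T, feasible alpha red T & min_tree_cost alpha cost red z0 = tree_cost cost T /\
    forall T', feasible alpha red T' -> min_tree_cost alpha cost red z0 <= tree_cost cost T'.
Proof.
rewrite /min_tree_cost; case: pickP => [T0 fT0|nf]; [right|left].
  case: arg_minP => // T /asboolP fT minT; exists T => //; split=> // T' /asboolP fT'.
  exact: minT.
by split=> // T /asboolP fT; have := nf T; rewrite /= fT.
Qed.

Lemma le_min_tree_cost (r : R) : r <= min_tree_cost alpha cost red z0 <->
  (forall T, feasible alpha red T -> r <= tree_cost cost T) /\
  ((exists T, feasible alpha red T) \/ r <= z0).
Proof.
case: min_tree_costP => [[nf ->]|[T fT [-> minT]]].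
  split=> [rz|[_ [[T /nf]|]]//]; split; [by move=> T /nf|by right].
split=> [rT|[h _]]; last exact: h.
by split; [move=> T' /minT; exact: le_trans|left; exists T].
Qed.

Lemma sum_weightE (lam : R) (T : {set edge n}) :
  \sum_(e in T) (cost e + lam * (red e)%:R) =
  tree_cost cost T + lam * #|[set e in T | red e]%SET|%:R.
Proof.
rewrite big_split /= -mulr_sumr /tree_cost; congr (_ + _ * _).
rewrite -sum1_card natr_sum big_mkcond [RHS]big_mkcond /=; apply: eq_bigr => e _.
by rewrite inE; case: (e \in T); case: (red e).
Qed.

End Optimum_facts.

Section Optimum_measurable.
Context {R : realType} {n : nat} {d : measure_display} {Om : measurableType d}.
Variable P : probability Om R.
Variables (X : edge n -> {RV P >-> R}) (red : edge n -> {RV P >-> bool}).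
Variables (alpha z0 : R).

(** There are finitely many colourings, and for each of them Z >= r is a finite
conjunction of inequalities on the costs of trees. *)
Lemma measurable_Zalpha : measurable_fun setT (Zalpha X red alpha z0).
Proof.
apply: (measurability (@RGenCInfty.G R)) => [|/= _ [_] [r] -> <-].
  exact: RGenCInfty.measurableE.
rewrite setTI.
pose cond (c : {ffun edge n -> bool}) := (exists T, feasible alpha c T) \/ r <= z0.
have -> : Zalpha X red alpha z0 @^-1` `[r, +oo[ =
   \bigcup_(c in cond) (colours red @^-1` [set c] `&`
     \bigcap_(T in feasible alpha c) [set w | r <= tree_cost (fun e => X e w) T]).
  have cE w : (fun e => red e w) = (colours red w : edge n -> bool).
    by apply/funext => e; rewrite ffunE.
  apply/seteqP; split=> w /=.
    rewrite in_itv /= andbT /Zalpha => /le_min_tree_cost; rewrite cE => -[h1 h2].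
    by exists (colours red w) => //; split.
  move=> [c cc [/= wc h]]; rewrite in_itv /= andbT; apply/le_min_tree_cost.
  by rewrite cE wc; split=> // T fT; exact: h.
apply: fin_bigcup_measurable; first exact: finite_finset.
move=> c _; apply: measurableI; first exact: measurable_colours.
apply: fin_bigcap_measurable; first exact: finite_finset.
move=> T _; have mT : measurable_fun setT (fun w => tree_cost (fun e => X e w) T).
  rewrite /tree_cost; under eq_fun do rewrite big_mkcond.
  apply: measurable_sum => e; case: (e \in T); last exact: measurable_cst.
  exact: measurable_funPT.
have := mT measurableT `[r, +oo[%classic (measurable_itv _); rewrite setTI.
rewrite (_ : _ @^-1` _ = [set w | r <= tree_cost (fun e => X e w) T]) //.
by apply/seteqP; split=> w; rewrite /= in_itv /= andbT.
Qed.

End Optimum_measurable.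

Section Blue_tree.
Context {R : realType} {n : nat} {d : measure_display} {Om : measurableType d}.
Variable P : probability Om R.
Variables (X : edge n -> {RV P >-> R}) (red : edge n -> {RV P >-> bool}).
Variables (alpha z0 : R).
Hypotheses (n0 : (0 < n)%N) (alpha0 : 0 <= alpha) (z0n : 0 <= z0 <= n%:R).

Lemma Zalpha_bounds w : (forall e, 0 <= X e w <= 1) ->
  0 <= Zalpha X red alpha z0 w <= n%:R ^+ 2.
Proof.
move=> X01w; have n1 : 1 <= n%:R :> R by rewrite ler1n.
rewrite /Zalpha; have [[_ ->]|[T _ [-> _]]] := @min_tree_costP _ alpha n (fun e => X e w) (fun e => red e w) z0.
  by have /andP[-> z1] := z0n; rewrite (le_trans z1) // expr2 ler_peMr.
rewrite sumr_ge0 => [/=|e _]; last by case/andP: (X01w e).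
apply: (@le_trans _ _ (\sum_(e in T) 1)).
  by apply: ler_sum => e _; case/andP: (X01w e).
rewrite sumr_const -natrX ler_nat (leq_trans (max_card _)) //; exact: card_edge.
Qed.

(** With penalty 1 a red edge has weight at least 1. If the edges of weight at
most 1 / 2 connect the graph, the greedy tree only uses such edges, so it is
entirely blue and feasible. If they do not, kappa is at least 2 at the threshold
1 / 2 and the last term exceeds the trivial bound n ^ 2. *)
Lemma Zalpha_le_blue w : (forall e, 0 <= X e w <= 1) ->
  Zalpha X red alpha z0 w <= 1 +
    \sum_(1 <= i < (2 * n).+1) 1 / n%:R * (kappa R (low (weight X red 1 w) (i%:R * (1 / n%:R))) - 1)
    + n%:R ^+ 2 * (kappa R (low (weight X red 1 w) 2^-1) - 1).
Proof.
move=> X01w; have nR : 0 < n%:R :> R by rewrite ltr0n.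
have k0 S : 0 <= kappa R (S : {set edge n}) - 1 by rewrite subr_ge0 kappa_ge1.
set D := \sum_(_ <= _ < _) _.
have D0 : 0 <= D by apply: sumr_ge0 => i _; rewrite mulr_ge0 ?divr_ge0.
have [k2|k2] := leP 2 (kappa R (low (weight X red 1 w) 2^-1)).
  have /andP[_ zn] := Zalpha_bounds X01w.
  rewrite (le_trans zn) // ler_wpDl ?addr_ge0 // ler_peMr ?exprn_ge0 //; lra.
have k1 : kappa R (low (weight X red 1 w) 2^-1) = 1.
  by apply: kappa_connected => //; exact: connected_kappa k2.
have W01 e : 0 <= weight X red 1 w e <= (2 * n)%:R * (1 / n%:R).
  rewrite natrM mul1r mulfK ?gt_eqF // /weight mul1r; have /andP[? ?] := X01w e.
  by case: (red e w) => /=; apply/andP; split; lra.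
have h0 : 0 < 1 / n%:R :> R by rewrite divr_gt0.
have [T [sT cT lT]] := exists_light_tree n0 h0 W01.
have blue e : e \in T -> red e w = false.
  move=> /(lT _ k1); rewrite /weight mul1r; have /andP[? ?] := X01w e.
  by case: (red e w) => //=; lra.
have fT : feasible alpha (fun e => red e w) T.
  split=> //; rewrite (_ : [set e in T | red e w]%SET = finset.set0); last first.
    by apply/setP => e; rewrite !inE; apply/negbTE/negP => /andP[/blue ->].
  by rewrite cards0 mulr_ge0.
rewrite k1 subrr mulr0 addr0; apply: (@le_trans _ _ (tree_cost (fun e => X e w) T)).
  rewrite /Zalpha; have [[nf _]|[_ _ [_ h]]] := @min_tree_costP _ alpha n (fun e => X e w) (fun e => red e w) z0; last exact: h.
  by case: (nf T).
have <- : n%:R * (1 / n%:R) = 1 :> R by rewrite mul1r divff ?gt_eqF.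
apply: le_trans cT; apply: ler_sum => e _; rewrite /weight mul1r lerDl; exact: ler0n.
Qed.

End Blue_tree.

(** * Contribution of events of small probability *)

Section Bad_events.
Context {R : realType}.

Lemma ae_costs_in_unit_interval {n : nat} {d : measure_display} {Om : measurableType d}
    (P : probability Om R) (X : edge n -> {RV P >-> R}) (red : edge n -> {RV P >-> bool}) :
  randomly_coloured_costs X red -> {ae P, forall w, forall u, 0 <= X u w <= 1}.
Proof.
move=> model; have [mA PA] := costs_in_unit_interval model.
exists (~` [set w | forall u, 0 <= X u w <= 1]); split=> //.
- exact: measurableC.
- by rewrite probability_setC // PA subee.
Qed.

(** By the term of degree 4 of the exponential series. *)
Lemma cube_exp_small (e : R) : 0 < e -> exists N0 : nat, forall n, (N0 <= n)%N ->
  n%:R ^+ 2 * (n%:R * (2 * expR (- (n%:R * 4^-1 / 4)))) <= e.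
Proof.
move=> e0; pose C : R := 2 * 24 * 16 ^+ 4.
exists (Num.trunc (C / e)).+1 => n nC.
have C0 : 0 < C by rewrite /C !mulr_gt0 // exprn_gt0.
have nCR : C / e <= n%:R.
  have /truncn_itv/andP[_ h] : 0 <= C / e by rewrite divr_ge0 // ltW.
  by rewrite (le_trans (ltW h)) // ler_nat.
have n0 : 0 < n%:R :> R by apply: lt_le_trans nCR; rewrite divr_gt0.
have y0 : 0 <= n%:R / 16 :> R by rewrite divr_ge0.
have := expR_ge1Dxn 3 y0; rewrite (_ : (4`! = 24)%N) // => h.
have h' : (n%:R / 16 : R) ^+ 4 / 24 <= expR (n%:R / 16) by lra.
have -> : n%:R * 4^-1 / 4 = n%:R / 16 :> R by field.
rewrite expRN; set E := expR _ in h' *.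
have E0 : 0 < E by rewrite expR_gt0.
have -> : n%:R ^+ 2 * (n%:R * (2 * E^-1)) = 2 * n%:R ^+ 3 / E by field; rewrite gt_eqF.
rewrite ler_pdivrMr //; apply: (le_trans _ (ler_wpM2l (ltW e0) h')).
have -> : e * ((n%:R / 16) ^+ 4 / 24) = n%:R ^+ 3 * (e * n%:R / (24 * 16 ^+ 4)) by field.
rewrite mulrC ler_pM2l ?exprn_gt0 // ler_pdivlMr ?mulr_gt0 ?exprn_gt0 //.
by move: nCR; rewrite ler_pdivrMr // /C; lra.
Qed.

(** Uniform integrability of Z. In the bound of [Zalpha_le_blue], the first I
terms of the mesh sum are at most 1 each, and the mean of all the others is at
most 2 e / 3; so only the bounded part needs a small event. *)
Lemma integral_bad (e : R) : 0 < e -> exists2 tau : R, 0 < tau &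
  exists N0 : nat, forall n, (N0 <= n)%N ->
  forall (d : measure_display) (Om : measurableType d) (P : probability Om R)
    (X : edge n -> {RV P >-> R}) (red : edge n -> {RV P >-> bool}) (alpha z0 : R),
  randomly_coloured_costs X red -> 0 <= alpha -> 0 <= z0 <= n%:R ->
  forall B : set Om, measurable B -> (P B <= tau%:E)%E ->
  (\int[P]_(w in B) `|Zalpha X red alpha z0 w|%:E <= e%:E)%E.
Proof.
move=> e0; have e3 : 0 < e / 3 by rewrite divr_gt0.
have [I HI] := @kappa_tail_sum R 1 (e / 3) ltr01 e3.
have [N1 HN1] := cube_exp_small e3.
pose tau := e / 3 / I.+1%:R.
have tau0 : 0 < tau by rewrite divr_gt0.
exists tau => //; exists (N1 + I + 1)%N => n Nn d Om P X red alpha z0 model a0 z0n B mB PB.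
have n0 : (0 < n)%N by lia.
have nR : 0 < n%:R :> R by rewrite ltr0n.
have k0 S : 0 <= kappa R (S : {set edge n}) - 1 by rewrite subr_ge0 kappa_ge1.
(* Index 0 carries the connectivity term at the threshold 1 / 2, the other
   indices the mesh of step 1 / n. *)
pose t (i : nat) : R := if i == 0%N then 2^-1 else i%:R * (1 / n%:R).
pose g (i : nat) (S : {set edge n}) : R :=
  if i == 0%N then n%:R ^+ 2 * (kappa R S - 1) else 1 / n%:R * (kappa R S - 1).
have g0 i S : 0 <= g i S.
  by rewrite /g; case: ifP => _; rewrite mulr_ge0 ?exprn_ge0 ?divr_ge0.
pose r := 0%N :: index_iota I.+1 (2 * n).+1.
pose G i w := low (weight X red 1 w) (t i).
have Zle w : (forall u, 0 <= X u w <= 1) ->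
    `|Zalpha X red alpha z0 w| <= I.+1%:R + \sum_(i <- r) g i (G i w).
  move=> X01w; have /andP[Z0 _] := Zalpha_bounds red alpha n0 z0n X01w.
  rewrite ger0_norm //; apply: le_trans (Zalpha_le_blue red n0 a0 z0n X01w) _.
  pose A i := 1 / n%:R * (kappa R (low (weight X red 1 w) (i%:R * (1 / n%:R))) - 1).
  have le1 : \sum_(1 <= i < I.+1) A i <= I%:R.
    apply: (@le_trans _ _ (\sum_(1 <= i < I.+1) 1)); last by rewrite sumr_const_nat subSS subn0.
    apply: ler_sum => i _; rewrite /A.
    have := kappa_le_vertices R (low (weight X red 1 w) (i%:R * (1 / n%:R))).
    move: (kappa R _) => k kn; rewrite mulrAC mul1r ler_pdivrMr // mul1r; lra.
  have tE : \sum_(i <- index_iota I.+1 (2 * n).+1) g i (G i w) =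
      \sum_(I.+1 <= i < (2 * n).+1) A i.
    rewrite big_nat_cond [RHS]big_nat_cond; apply: eq_bigr => i /andP[/andP[Ii _] _].
    by rewrite /g /G /t (gtn_eqF (leq_ltn_trans (leq0n I) Ii)).
  have IE : (I.+1 <= (2 * n).+1)%N by clear -Nn; lia.
  have g0E : g 0%N (G 0%N w) = n%:R ^+ 2 * (kappa R (low (weight X red 1 w) 2^-1) - 1) by [].
  rewrite /r big_cons tE g0E (@big_cat_nat _ _ _ I.+1 1 (2 * n).+1) //=.
  rewrite -[I.+1%:R]natr1 -/(A _).
  move: (\sum_(1 <= i < I.+1) _) le1 (\sum_(I.+1 <= i < (2 * n).+1) _) (n%:R ^+ 2 * _) => a1 le1 a2 a3.
  lra.
have Eg : \sum_(i <- r) ExG (edge_prob 1 (t i)) (g i) <= e / 3 + e / 3.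
  rewrite /r big_cons; apply: lerD.
    rewrite /ExG [X in Ex _ _ X](_ : _ = fun S => n%:R ^+ 2 * (kappa R S - 1)) // ExZ.
    have -> : edge_prob 1 (t 0%N) = 4^-1 :> R.
      rewrite /edge_prob /t /clamp /=.
      rewrite (@max_l _ _ 2^-1) ?invr_ge0 // (@min_l _ _ 2^-1); last lra.
      rewrite max_r; last lra.
      by rewrite min_l // addr0; field.
    apply: le_trans (HN1 n _); last by lia.
    rewrite ler_pM2l ?exprn_gt0 //; apply: kappa_tail => //; lra.
  pose p i : R := edge_prob 1 (i%:R * (1 / n%:R)).
  have p01 i : 0 <= p i <= 1 by exact: edge_prob01.
  have pn i : (i < (2 * n).+1)%N -> i%:R * 1 / 8 <= n%:R * p i.
    move=> i2; have h : i%:R * (1 / n%:R) / 8 <= p i.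
      apply: edge_prob_ge; rewrite mulr_ge0 ?divr_ge0 //= mulrA mulr1 ler_pdivrMr //.
      by rewrite -natrM ler_nat; lia.
    rewrite -ler_pdivrMl //; apply: le_trans h.
    by rewrite le_eqVlt; apply/orP; left; apply/eqP; field; rewrite gt_eqF.
  apply: le_trans (HI n (2 * n)%N p n0 p01 pn).
  rewrite big_nat_cond [leRHS]big_nat_cond; apply: ler_sum => i /andP[/andP[Ii _] _].
  by rewrite /p /t /g (gtn_eqF (leq_ltn_trans (leq0n I) Ii)).
have mZ : measurable_fun B (fun w => `|Zalpha X red alpha z0 w|%:E).
  apply/measurable_EFinP/measurableT_comp => //.
  exact/measurable_funTS/measurable_Zalpha.
have mS : measurable_fun B (fun w => (\sum_(i <- r) g i (G i w))%:E).
  by apply/measurable_EFinP; exact: measurable_sum_low.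
apply: (@le_trans _ _ (\int[P]_(w in B) (I.+1%:R%:E + (\sum_(i <- r) g i (G i w))%:E))%E).
  apply: ae_ge0_le_integral => //.
  - by move=> w _; rewrite adde_ge0 ?lee_fin // sumr_ge0.
  - by apply: emeasurable_funD => //; exact: measurable_cst.
  - apply: filterS (ae_costs_in_unit_interval model) => w X01w _.
    by rewrite -EFinD lee_fin; exact: Zle.
rewrite ge0_integralD //; last by move=> w _; rewrite lee_fin sumr_ge0.
rewrite integral_cst //.
have -> : e%:E = (e / 3 + (e / 3 + e / 3))%:E by congr (_%:E); field.
rewrite EFinD; apply: leeD.
  apply: (@le_trans _ _ (I.+1%:R%:E * tau%:E)%E); first by rewrite lee_wpmul2l // lee_fin.
  rewrite -EFinM lee_fin /tau mulrC divfK // pnatr_eq0 //.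
apply: (@le_trans _ _ (\int[P]_w (\sum_(i <- r) g i (G i w))%:E)%E).
  apply: ge0_subset_integral => //.
    by apply/measurable_EFinP; exact: measurable_sum_low.
  by move=> w _; rewrite lee_fin sumr_ge0.
by rewrite (integral_sum_low model) // lee_fin.
Qed.

End Bad_events.

(** * Duality and perturbation of the penalty *)

Section Duality.
Variables (R : realType) (n : nat).
Hypothesis n0 : (0 < n)%N.
Variables (cost : edge n -> R) (red : edge n -> bool) (alpha z0 : R).
Local Notation penalised psi T :=
  (\sum_(e in T) (cost e + 2 * psi / n%:R * (red e)%:R)).
Local Notation Z := (min_tree_cost alpha cost red z0).

Let nR : 0 < n%:R :> R. Proof. by rewrite ltr0n. Qed.

(** Weak duality: a feasible tree pays a penalty of at most 2 alpha psi. *)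
Lemma optimum_ge (psi m : R) : 0 <= psi ->
  (forall T, connected_graph T -> m <= penalised psi T) ->
  (exists T, feasible alpha red T) -> m - 2 * alpha * psi <= Z.
Proof.
move=> p0 H [T0 fT0].
have [[nf _]|[T [[cT _] rT] [-> _]]] := @min_tree_costP _ alpha n cost red z0.
  by case: (nf T0).
have := H T cT; rewrite sum_weightE; set r := #|_|%:R => h.
have : 2 * psi / n%:R * r <= 2 * alpha * psi.
  rewrite mulrAC ler_pdivrMr //.
  have -> : 2 * alpha * psi * n%:R = 2 * psi * (alpha * n%:R) by ring.
  by rewrite ler_wpM2l ?mulr_ge0.
lra.
Qed.

(** Let q be the number of red edges, divided by n, of a tree T that is nearly
optimal for the penalty psi + eta. Its weight is affine in the penalty with slope
2 q, and it is bounded below at psi and at psi + 2 eta. The first bound gives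
2 q eta <= L2 - L1 + 2 e, hence the feasibility of T, and the second one
L3 - L2 - 2 e <= 2 q eta, which bounds from below the penalty contained in the
weight of T. *)
Lemma optimum_le (psi eta e L1 L2 L3 : R) : 0 <= psi -> 0 < eta ->
  (forall T, connected_graph T -> L1 - e <= penalised psi T) ->
  (exists2 T, spanning_tree T & penalised (psi + eta) T <= L2 + e) ->
  (forall T, connected_graph T -> L3 - e <= penalised (psi + 2 * eta) T) ->
  L2 - L1 + 2 * e <= 2 * eta * alpha ->
  (exists T, feasible alpha red T) /\
  Z <= L2 + e - (psi + eta) * ((L3 - L2 - 2 * e) / eta).
Proof.
move=> p0 eta0 H1 [T sT] + H3 La; have [cT _] := sT.
have := H1 T cT; have := H3 T cT; rewrite !sum_weightE.
set r := #|_|%:R; set c := tree_cost cost T => h3 h1 h2.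
pose q : R := r / n%:R.
have rE x : 2 * x / n%:R * r = 2 * x * q by rewrite /q; ring.
rewrite rE in h1; rewrite rE in h2; rewrite rE in h3.
have fT : feasible alpha red T.
  split=> //; rewrite -/r -ler_pdivrMr // -/q.
  have : 2 * eta * q <= 2 * eta * alpha by lra.
  by rewrite ler_pM2l // mulr_gt0.
split; first by exists T.
have zc : Z <= c.
  have [[nf _]|[_ _ [_ h]]] := @min_tree_costP _ alpha n cost red z0; last exact: h.
  by case: (nf T).
have hq : (L3 - L2 - 2 * e) / eta <= 2 * q.
  by rewrite ler_pdivrMr //; lra.
have : (psi + eta) * ((L3 - L2 - 2 * e) / eta) <= (psi + eta) * (2 * q).
  by rewrite ler_wpM2l //; lra.
lra.
Qed.

End Duality.

Section Perturbation.
Variable R : realType.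

Lemma mst_limitB (a b : R) : 0 <= a -> a <= b ->
  f b * (b - a) <= mst_limit b - mst_limit a <= f a * (b - a).
Proof.
move=> a0 ab; have -> : mst_limit b - mst_limit a = primF b - primF a.
  by rewrite /mst_limit opprD addrACA subrr add0r.
exact: primF_bounds.
Qed.

Lemma zeta3_ge1 : 1 <= zeta3 R.
Proof.
rewrite -(cvg_lim (@Rhausdorff R) (@zeta3_cvg R)).
apply: limr_ge; first exact: cvgP (@zeta3_cvg R).
near=> N; have N2 : (2 <= N)%N by near: N; exact: nbhs_infty_ge.
rewrite (@big_cat_nat _ _ _ 2) //= big_nat1 expr1n invr1 lerDl.
by apply: sumr_ge0 => k _; rewrite invr_ge0 exprn_ge0.
Unshelve. all: by end_near. Qed.

Definition optimum_limit (alpha psi : R) := mst_limit psi - 2 * alpha * psi.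

(** On [0, psi] the function f is at least f psi = 2 alpha, so the integral of f
over this interval is at least 2 alpha psi. *)
Lemma optimum_limit_ge1 (alpha psi : R) : 0 <= psi -> f psi = 2 * alpha ->
  1 <= optimum_limit alpha psi.
Proof.
move=> p0 fp; have /andP[+ _] := primF_bounds (lexx 0) p0.
rewrite primF0 !subr0 fp /optimum_limit /mst_limit => h.
have := zeta3_ge1; move: (zeta3 R) (primF psi) h => z F h; lra.
Qed.

(** The numerical conditions of [optimum_le] for the penalties psi + eta,
psi + 2 eta and psi + 3 eta. Feasibility holds for small e because f (psi + eta)
is strictly less than f psi = 2 alpha; starting at psi + eta makes this gap
available. The upper bound holds because f is right continuous at psi. *)
Lemma perturbation (alpha psi eps : R) : 0 <= psi -> f psi = 2 * alpha -> 0 < eps ->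
  exists eta e : R, [/\ 0 < eta, 0 < e, e <= eps / 2,
    mst_limit (psi + eta + eta) - mst_limit (psi + eta) + 2 * e <= 2 * eta * alpha &
    mst_limit (psi + eta + eta) + e - (psi + eta + eta) *
      ((mst_limit (psi + eta + 2 * eta) - mst_limit (psi + eta + eta) - 2 * e) / eta)
    <= optimum_limit alpha psi + eps / 2].
Proof.
move=> p0 fp e0; have p2 : 0 < psi + 2 by lra.
pose rho := eps / (8 * (psi + 2)).
have rho0 : 0 < rho by rewrite divr_gt0 // mulr_gt0.
have rhoE : rho * (psi + 2) = eps / 8 by rewrite /rho; field; rewrite gt_eqF.
have [b pb Hb] := f_right_cvg p0 rho0.
pose eta := Num.min (Num.min (eps / 16) ((b - psi) / 3)) 1.
have eta0 : 0 < eta by rewrite !lt_min ltr01 !divr_gt0 // subr_gt0.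
have eta1 : eta <= eps / 16 by rewrite /eta !ge_min lexx.
have eta2 : eta <= (b - psi) / 3 by rewrite /eta !ge_min lexx orbT.
have eta3 : eta <= 1 by rewrite /eta !ge_min lexx !orbT.
have f1 : f (psi + eta) < f psi by apply: f_dec => //; lra.
pose e := Num.min (Num.min (eps / 8) (eta * (eps / (16 * (psi + 2)))))
  (eta * ((f psi - f (psi + eta)) / 2)).
have e_gt0 : 0 < e.
  rewrite !lt_min divr_gt0 //=; apply/andP; split; apply: mulr_gt0 => //.
    by rewrite divr_gt0 // mulr_gt0.
  by rewrite divr_gt0 // subr_gt0.
have e1 : e <= eps / 8 by rewrite /e !ge_min lexx.
have e2 : e <= eta * (eps / (16 * (psi + 2))) by rewrite /e !ge_min lexx orbT.
have e3 : e <= eta * ((f psi - f (psi + eta)) / 2) by rewrite /e !ge_min lexx !orbT.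
have f3 : f psi - rho <= f (psi + eta + 2 * eta).
  by apply: Hb; clear -eta0 eta2; clearbody eta; apply/andP; split; lra.
exists eta, e; clear Hb; clearbody rho eta e.
have [s0 s1 s2] : [/\ 0 <= psi + eta, 0 <= psi + eta + eta & psi <= psi + eta + eta].
  by clear -p0 eta0; split; lra.
have [s3 s4] : psi + eta <= psi + eta + eta /\ psi + eta + eta <= psi + eta + 2 * eta.
  by clear -eta0; split; lra.
have fle1 : f psi <= 1 by exact: f_le1.
have fpos : 0 <= f psi by exact: f_ge0.
have /andP[_ L21] : f (psi + eta + eta) * (psi + eta + eta - (psi + eta)) <=
   mst_limit (psi + eta + eta) - mst_limit (psi + eta) <=
   f (psi + eta) * (psi + eta + eta - (psi + eta)) by exact: mst_limitB.
have /andP[L32 _] : f (psi + eta + 2 * eta) * (psi + eta + 2 * eta - (psi + eta + eta)) <=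
   mst_limit (psi + eta + 2 * eta) - mst_limit (psi + eta + eta) <=
   f (psi + eta + eta) * (psi + eta + 2 * eta - (psi + eta + eta)) by exact: mst_limitB.
have /andP[_ L20] : f (psi + eta + eta) * (psi + eta + eta - psi) <=
   mst_limit (psi + eta + eta) - mst_limit psi <=
   f psi * (psi + eta + eta - psi) by exact: mst_limitB.
rewrite /optimum_limit.
have e2' : e / eta <= eps / (16 * (psi + 2)) by rewrite ler_pdivrMr // mulrC.
have e2E : eps / (16 * (psi + 2)) * (psi + 2) = eps / 16 by field; rewrite gt_eqF.
move: (mst_limit (psi + eta + 2 * eta)) (mst_limit (psi + eta + eta))
  (mst_limit (psi + eta)) (mst_limit psi) L21 L32 L20 => L3 L2 L1 L0 L21 L32 L20.
move: (f (psi + eta + 2 * eta)) (f (psi + eta)) (f psi) f3 f1 fle1 fpos fp L21 L32 L20 e3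
  => v3 v1 v0 f3 f1 fle1 fpos fp L21 L32 L20 e3.
split=> //; first lra.
  nra.
have hq : v0 - rho - 2 * (e / eta) <= (L3 - L2 - 2 * e) / eta.
  rewrite ler_pdivlMr //.
  have : e / eta * eta = e by rewrite divfK // gt_eqF.
  nra.
have key : (psi + eta + eta) * (v0 - rho - 2 * (e / eta)) <=
   (psi + eta + eta) * ((L3 - L2 - 2 * e) / eta).
  by rewrite ler_wpM2l //; lra.
move: ((L3 - L2 - 2 * e) / eta) key => q key.
have ee0 : 0 <= e / eta by rewrite divr_ge0 // ltW.
move: (e / eta) e2' key ee0 {hq} => y e2' key y0.
move: (eps / (16 * (psi + 2))) e2E e2' => z zE yz.
have k1 : (psi + eta + eta) * rho <= eps / 8 by rewrite -rhoE mulrC ler_wpM2l ?(ltW rho0) //; lra.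
have k2 : (psi + eta + eta) * y <= eps / 16 by rewrite -zE mulrC; apply: ler_pM => //; lra.
have k3 : psi * v0 <= (psi + eta + eta) * v0.
  by rewrite ler_wpM2r //; lra.
nra.
Qed.

End Perturbation.

(** * Mean deviation of the optimum *)

Section Mean_deviation.
Variable R : realType.

(** Outside the union of four exceptional events, the bounds at psi give the
lower estimate and those at psi + eta, psi + 2 eta and psi + 3 eta the upper
one. On this union, Z is controlled by uniform integrability. *)
Lemma mean_deviation (alpha psi eps : R) :
  0 <= alpha -> 0 <= psi -> f psi = 2 * alpha -> 0 < eps ->
  exists N0 : nat, forall n, (N0 <= n)%N ->
  forall (d : measure_display) (Om : measurableType d) (P : probability Om R)
    (X : edge n -> {RV P >-> R}) (red : edge n -> {RV P >-> bool}) (z0 : R),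
  randomly_coloured_costs X red -> 0 <= z0 <= n%:R ->
  (\int[P]_w `|Zalpha X red alpha z0 w - optimum_limit alpha psi|%:E <= eps%:E)%E.
Proof.
move=> a0 p0 fp eps0.
have L1 := optimum_limit_ge1 p0 fp.
have [eta [e [eta0 e0 e_eps cond upper]]] := perturbation p0 fp eps0.
have eps4 : 0 < eps / 4 by rewrite divr_gt0.
have [tau0 tau0_gt0 [M0 HM0]] := integral_bad eps4.
set Ls := optimum_limit alpha psi in L1 upper *.
have Ls0 : 0 < Ls by exact: lt_le_trans L1.
pose tau := Num.min tau0 (eps / 4 / Ls).
have tau_gt0 : 0 < tau by rewrite lt_min tau0_gt0 divr_gt0.
have tau4 : 0 < tau / 4 by rewrite divr_gt0.
have p1 : 0 <= psi + eta by lra.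
have p2 : 0 <= psi + eta + eta by lra.
have p3 : 0 <= psi + eta + 2 * eta by lra.
have [M1 HM1] := mst_event p0 e0 tau4.
have [M2 HM2] := mst_event p1 e0 tau4.
have [M3 HM3] := mst_event p2 e0 tau4.
have [M4 HM4] := mst_event p3 e0 tau4.
exists (M0 + M1 + M2 + M3 + M4).+1 => n Nn d Om P X red z0 model z0n.
have [n0 nM0 nM1 nM2 [nM3 nM4]] :
    [/\ (0 < n)%N, (M0 <= n)%N, (M1 <= n)%N, (M2 <= n)%N & (M3 <= n)%N /\ (M4 <= n)%N].
  by clear -Nn; split; lia.
have [B1 [mB1 PB1 HB1]] := HM1 n nM1 d Om P X red model.
have [B2 [mB2 PB2 HB2]] := HM2 n nM2 d Om P X red model.
have [B3 [mB3 PB3 HB3]] := HM3 n nM3 d Om P X red model.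
have [B4 [mB4 PB4 HB4]] := HM4 n nM4 d Om P X red model.
pose B := B1 `|` B2 `|` (B3 `|` B4).
have mB : measurable B by apply: measurableU; apply: measurableU.
have PB : (P B <= tau%:E)%E.
  have -> : tau%:E = ((tau / 4 + tau / 4) + (tau / 4 + tau / 4))%:E by congr (_%:E); field.
  rewrite !EFinD /B.
  apply: le_trans (measureU2 _ _ _) _; [exact: measurableU|exact: measurableU|].
  by apply: leeD; apply: le_trans (measureU2 _ _ _) _ => //; apply: leeD.
pose Z := Zalpha X red alpha z0.
have close w : (forall u, 0 <= X u w <= 1) -> ~ B w -> `|Z w - Ls| <= eps / 2.
  move=> X01w nB.
  have [low1 _] := HB1 w X01w (fun h => nB (or_introl (or_introl h))).
  have [low2 _] := HB2 w X01w (fun h => nB (or_introl (or_intror h))).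
  have [_ up3] := HB3 w X01w (fun h => nB (or_intror (or_introl h))).
  have [low4 _] := HB4 w X01w (fun h => nB (or_intror (or_intror h))).
  have [ex Zu] := optimum_le n0 z0 p1 eta0 low2 up3 low4 cond.
  have Zl := optimum_ge n0 z0 p0 low1 ex.
  have ZE : Z w = min_tree_cost alpha (fun u => X u w) (fun u => red u w) z0 by [].
  rewrite -ZE in Zu Zl.
  have Zl' : Ls - e <= Z w.
    by apply: (le_trans _ Zl); rewrite /Ls /optimum_limit addrAC.
  have Zu' : Z w <= Ls + eps / 2 by exact: le_trans Zu upper.
  rewrite ler_norml lerBlDl Zu' andbT lerBrDl; apply: le_trans Zl'.
  by rewrite lerD2l lerN2.
have mZ D : measurable D -> measurable_fun D Z.
  by move=> mD; exact/measurable_funTS/measurable_Zalpha.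
have mdev D : measurable D -> measurable_fun D (fun w => `|Z w - Ls|%:E).
  move=> mD; apply/measurable_EFinP/measurableT_comp => //.
  by apply: measurable_funB; [exact: mZ|exact: measurable_cst].
rewrite -(setUv B) ge0_integral_setU //; first last.
- exact/disj_setPCl.
- by apply: mdev; rewrite setUv.
- exact: measurableC.
have -> : eps%:E = ((eps / 4 + eps / 4) + eps / 2)%:E by congr (_%:E); field.
rewrite [X in (_ <= X)%E]EFinD; apply: leeD; last first.
  apply: (@le_trans _ _ (\int[P]_(w in ~` B) (cst (eps / 2)%:E w))%E).
    apply: ae_ge0_le_integral => //.
    - exact: measurableC.
    - by apply: mdev; exact: measurableC.
    - by move=> w _; rewrite lee_fin divr_ge0 // ltW.
    - by apply: filterS (ae_costs_in_unit_interval model) => w X01w nB; rewrite lee_fin; exact: close.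
  rewrite integral_cst; last exact: measurableC.
  rewrite -[leRHS]mule1 lee_wpmul2l ?lee_fin ?divr_ge0 ?(ltW eps0) //.
  by apply: probability_le1; exact: measurableC.
apply: (@le_trans _ _ (\int[P]_(w in B) (`|Z w|%:E + cst Ls%:E w))%E).
  apply: ge0_le_integral => //.
  - exact: mdev.
  - apply: emeasurable_funD; last exact: measurable_cst.
    by apply/measurable_EFinP/measurableT_comp => //; exact: mZ.
  - move=> w _; rewrite /cst -EFinD lee_fin (le_trans (ler_normB _ _)) //.
    by rewrite (gtr0_norm Ls0).
rewrite ge0_integralD //; first last.
- by move=> w _; rewrite lee_fin ltW.
- by apply/measurable_EFinP/measurableT_comp => //; exact: mZ.
rewrite [X in (_ <= X)%E]EFinD; apply: leeD.
  apply: (HM0 n nM0 d Om P X red alpha z0 model a0 z0n B mB).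
  by apply: le_trans PB _; rewrite lee_fin ge_min lexx.
rewrite integral_cst //.
apply: (@le_trans _ _ (Ls%:E * tau%:E)%E); first by rewrite lee_wpmul2l // lee_fin ltW.
rewrite -EFinM lee_fin mulrC -ler_pdivlMr //.
by rewrite ge_min lexx orbT.
Qed.

End Mean_deviation.

(** * Expectation and concentration *)

Section Mean_and_concentration.
Context {R : realType} {d : measure_display} {Om : measurableType d}.
Variables (P : probability Om R) (Z : Om -> R) (L e : R).
Hypotheses (mZ : measurable_fun setT Z)
  (ZL : (\int[P]_w `|Z w - L|%:E <= e%:E)%E).

Let mdev : measurable_fun setT (fun w => (Z w - L)%:E).
Proof.
by apply/measurable_EFinP; apply: measurable_funB => //; exact: measurable_cst.
Qed.

Lemma expectation_close : `|fine 'E_P[Z] - L| <= e.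
Proof.
have idev : P.-integrable setT (EFin \o (fun w => Z w - L)).
  apply/integrableP; split=> //; apply: le_lt_trans (ltry e); exact: ZL.
have icst : P.-integrable setT (EFin \o (fun=> L)).
  by apply: finite_measure_integrable_cst.
have -> : ('E_P[Z] = (\int[P]_w (Z w - L)%:E) + L%:E)%E.
  rewrite unlock.
  have -> : (\int[P]_w (Z w)%:E = \int[P]_w ((Z w - L)%:E + L%:E))%E.
    by apply: eq_integral => w _; rewrite -EFinD subrK.
  rewrite integralD_EFin //; congr (_ + _)%E.
  by rewrite -[LHS]/(\int[P]_w (cst L%:E w))%E (integral_cst P measurableT L%:E) -[X in (_ * X)%E]/(P setT) probability_setT mule1.
have fin := integrable_fin_num measurableT idev.
rewrite fineD // addrK -lee_fin -fine_abse // fineK ?abse_fin_num //.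
exact: le_trans (le_abse_integral P measurableT mdev) ZL.
Qed.

Lemma measurable_deviation (c b : R) : measurable [set w | `|Z w - c| <= b].
Proof.
have mabs : measurable_fun setT (fun w => `|Z w - c|).
  by apply: measurableT_comp => //; apply: measurable_funB => //; exact: measurable_cst.
have := mabs measurableT `]-oo, b]%classic (measurable_itv _); rewrite setTI.
by rewrite (_ : _ @^-1` _ = [set w | `|Z w - c| <= b]).
Qed.

Lemma markov_deviation (a : R) : 0 < a ->
  ((1 - e / a)%:E <= P [set w | (`|Z w - L| <= a)%R])%E.
Proof.
move=> a0; set S := [set w | _].
have mS : measurable S := measurable_deviation L a.
have mA : measurable (~` S) by exact: measurableC.
rewrite -[S]setCK probability_setC // EFinB leeB //.
rewrite EFinM lee_pdivlMr // muleC -(integral_cst P mA a%:E).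
apply: le_trans ZL.
apply: (@le_trans _ _ (\int[P]_(w in ~` S) `|Z w - L|%:E)%E).
  apply: ge0_le_integral => //.
  - by move=> w _; rewrite lee_fin ltW.
  - apply/measurable_EFinP/measurable_funTS/measurableT_comp => //.
    exact/measurable_EFinP.
  - by move=> w /negP; rewrite -ltNge lee_fin => /ltW.
apply: ge0_subset_integral => //.
by apply/measurable_EFinP/measurableT_comp => //; exact/measurable_EFinP.
Qed.

End Mean_and_concentration.

Lemma primF_small (R : realType) (p : R) : 0 < p -> p <= 1 -> primF p = p - p ^+ 2 / 4.
Proof.
move=> p0 p1; pose G (x : R) := x - x ^+ 2 / 4.
have dG (x : R) : is_derive x 1 G (1 - x / 2).
  have -> : G = idfun \- (4^-1 \*: (@idfun R) ^+ 2).
    by apply/funext => z; rewrite /G /= fctE /= /GRing.scale /= mulrC.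
  by apply: is_derive_eq; rewrite /GRing.scale /= expr1 mulr1; field.
have cG (x : R) : {for x, continuous G}.
  exact/differentiable_continuous/derivable1_diffP/(@ex_derive _ _ _ _ _ _ _ (dG x)).
rewrite /primF /Rintegral.
have -> : (\int[lebesgue_measure]_(x in `[0%R, p]) (f x)%:E =
    \int[lebesgue_measure]_(x in `[0%R, p]) (1 - x / 2)%:E)%E.
  apply: eq_integral.
  move=> x; rewrite inE /= in_itv /= => /andP[x0 xp].
  by rewrite f_small // x0 (le_trans xp).
rewrite (continuous_FTC2 (F := G)) //=.
- by rewrite /G expr0n /= mul0r subr0 subr0.
- apply: continuous_subspaceT => x; apply: cvgB; first exact: cvg_cst.
  by apply: cvgM; [exact: cvg_id|exact: cvg_cst].
- split=> [x _||].
  + exact: (@ex_derive _ _ _ _ _ _ _ (dG x)).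
  + apply: cvg_at_right_filter; exact: cG.
  + apply: cvg_at_left_filter; exact: cG.
- by move=> x _; rewrite derive1E (@derive_val _ _ _ _ _ _ _ (dG x)).
Qed.

Unset Implicit Arguments.

Theorem theorem1 (R : realType) (alpha : R)
    (d : nat -> measure_display) (Om : forall n, measurableType (d n))
    (P : forall n, probability (Om n) R)
    (X : forall n, edge n -> {RV (P n) >-> R})
    (red : forall n, edge n -> {RV (P n) >-> bool})
    (z0 : nat -> R)
    (alpha_bounds : 0 < alpha < 2^-1)
    (model : forall n, randomly_coloured_costs (X n) (red n))
    (z0_bounds : forall n, 0 <= z0 n <= n%:R) :
  let Z := fun n => Zalpha (X n) (red n) alpha (z0 n) in
  let EZ : nat -> R := fun n => EZalpha (X n) (red n) alpha (z0 n) in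
  [/\ (4^-1 < alpha ->
         EZ ~_(integral_oo alpha) (fun=> zeta3 R + (1 - 2 * alpha) ^+ 2)),
      [/\ forall x : R, 0 <= x <= 1 -> f x = 1 - x / 2,
          forall x : R, 1 < x ->
            (exists! y : R, y < 1 /\ y * expR (- y) = x * expR (- x)) /\
            (forall y : R, y < 1 -> y * expR (- y) = x * expR (- x) ->
               f x = y / x * (1 - y / 2)),
          (exists! psi : R, 0 <= psi /\ f psi = 2 * alpha) &
          forall psi : R, 0 <= psi -> f psi = 2 * alpha ->
            EZ ~_(integral_oo alpha) (fun=> limit_cost alpha psi)] &
      forall eps : R, 0 < eps ->
        P n [set w | `|Z n w - EZ n| <= eps * EZ n]
          @[n --> integral_oo alpha] --> 1%E].
Proof.
move=> Z EZ; have /andP[a0 a2] := alpha_bounds.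
have [psi0 psi0_gt0 fpsi0] : exists2 x : R, 0 < x & f x = 2 * alpha.
  by apply: f_surj; apply/andP; split; lra.
have mZ n : measurable_fun setT (Z n) by exact: measurable_Zalpha.
have dev psi eps : 0 <= psi -> f psi = 2 * alpha -> 0 < eps ->
    exists N0 : nat, forall n, (N0 <= n)%N ->
    (\int[P n]_w `|Z n w - optimum_limit alpha psi|%:E <= eps%:E)%E.
  move=> p0 fp eps0; have [N0 HN0] := mean_deviation (ltW a0) p0 fp eps0.
  by exists N0 => n Nn; exact: (HN0 n Nn _ _ (P n) (X n) (red n) (z0 n) (model n) (z0_bounds n)).
have equiv psi (c : R) : 0 <= psi -> f psi = 2 * alpha -> c = optimum_limit alpha psi ->
    EZ ~_(integral_oo alpha) (fun=> c).
  move=> p0 fp ->; have L1 := optimum_limit_ge1 p0 fp.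
  apply/eqaddoP => e e0; have [N0 HN0] := dev psi e p0 fp e0.
  apply: (filterS (P := fun n => (N0 <= n)%N)).
    move=> n Nn; rewrite /= (le_trans (expectation_close (mZ n) (HN0 n Nn))) //.
    by rewrite ler_peMr ?(ltW e0) // (le_trans L1) // ler_norm.
  by exists N0 => //= n Nn _.
have limE psi : limit_cost alpha psi = optimum_limit alpha psi by [].
split.
- move=> a4.
  have p0 : 0 <= 2 * (1 - 2 * alpha) by lra.
  have p1 : 2 * (1 - 2 * alpha) <= 1 by lra.
  have fp : f (2 * (1 - 2 * alpha)) = 2 * alpha by rewrite f_small ?p0 //; lra.
  apply: (equiv _ _ p0 fp); rewrite /optimum_limit /mst_limit primF_small //; last by lra.
  by move: (zeta3 R) => z; field.
- split.
  + exact: f_small.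
  + move=> x x1; split; last by move=> y; exact: f_conj.
    have [y /andP[_ y1] yx] := conj_exists x1.
    exists y; split=> // y' [y'1 y'x]; exact: (conj_unique y1 y'1 yx y'x).
  + exists psi0; split; first by split=> //; exact: ltW.
    move=> psi [p0 fp]; apply/eqP; rewrite eq_le !leNgt; apply/andP; split.
      by apply/negP => /(f_dec p0); rewrite fpsi0 fp ltxx.
    by apply/negP => /(f_dec (ltW psi0_gt0)); rewrite fpsi0 fp ltxx.
  + by move=> psi p0 fp; apply: equiv p0 fp _; exact: limE.
move=> eps eps0.
pose L := optimum_limit alpha psi0.
have L1 : 1 <= L := optimum_limit_ge1 (ltW psi0_gt0) fpsi0.
apply/fine_cvgP; split.
  by apply: nearW => n; apply: fin_num_measure; exact: (measurable_deviation (mZ n)).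
apply/cvgrPdist_le => e e0.
(* The three bounds ensure that EZ n >= 1 / 2, that EZ n is within eps / 4 of L,
   and that Markov's inequality at eps / 4 leaves a probability of at most e. *)
pose del := Num.min 2^-1 (Num.min (eps / 4) (e * (eps / 4))).
have eps4 : 0 < eps / 4 by rewrite divr_gt0.
have del0 : 0 < del by rewrite !lt_min invr_gt0 ltr0n eps4 mulr_gt0.
have [N0 HN0] := dev psi0 del (ltW psi0_gt0) fpsi0 del0.
have del2 : del <= 2^-1 by rewrite /del ge_min lexx.
have deleps : del <= eps / 4 by rewrite /del !ge_min lexx orbT.
have dele : del <= e * (eps / 4) by rewrite /del !ge_min lexx !orbT.
apply: (filterS (P := fun n => (N0 <= n)%N)); last by exists N0 => //= n Nn _.
move=> n Nn /=; set S := [set w | _ <= eps * _].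
have close : `|EZ n - L| <= del := expectation_close (mZ n) (HN0 n Nn).
have tail := markov_deviation (mZ n) (HN0 n Nn) eps4.
have EZ2 : 2^-1 <= EZ n.
  move: close; rewrite ler_distl => /andP[+ _].
  by move: L1 del2; clear; move: L del (EZ n) => l dl z; lra.
have dS : [set w | `|Z n w - L| <= eps / 4] `<=` S.
  move=> w; rewrite /S /=; move: close; rewrite !ler_norml => /andP[c1 c2] /andP[z1 z2].
  have : eps * 2^-1 <= eps * EZ n by rewrite ler_wpM2l // ltW.
  move: c1 c2 z1 z2 deleps; clear; move: (Z n w) L del (eps * EZ n) => z l dl em; move: (EZ n) => m.
  by move=> *; apply/andP; split; lra.
have mS : measurable S by exact: (measurable_deviation (mZ n)).
have PS : ((1 - e)%:E <= P n S)%E.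
  apply: (@le_trans _ _ (1 - del / (eps / 4))%:E).
    by rewrite lee_fin lerD2l lerN2 ler_pdivrMr.
  apply: (le_trans tail); apply: le_measure dS; rewrite inE //.
  exact: (measurable_deviation (mZ n)).
have finS : P n S \is a fin_num by exact: fin_num_measure.
rewrite ger0_norm ?subr_ge0; last first.
  by rewrite -lee_fin fineK //; exact: probability_le1.
by rewrite lerBlDr -lerBlDl -lee_fin fineK.
Qed.
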